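(* Let $n\ge 2$, $q\ge 1$, $a>0$, and let $0<d<n$ satisfy $\bigl(1-\frac{n-d}{q}\bigr)a<n-d$. Then there exists a homeomorphism $f:(-1,1)^n\to(-1,1)^n$ with the following properties: - $f$ is of class $C^1$; - $f\in W^{2,q}((-1,1)^n,(-1,1)^n)$; - $J_f^{-a}\in L^1((-1,1)^n)$; - $\mathcal H^d(\{x: J_f(x)=0\})>0$.
   Context: $J_f=\det Df$. $\mathcal H^d$ is the $d$-dimensional Hausdorff measure. *)

(* Defs.v *)
From HB Require Import structures.
From mathcomp Require Import all_boot all_order all_algebra.
From mathcomp Require Import all_classical all_reals all_analysis.
Set Implicit Arguments.
Unset Strict Implicit.
Unset Printing Implicit Defensive.
Import Order.TTheory GRing.Theory Num.Theory.
Import numFieldNormedType.Exports.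
Local Open Scope classical_set_scope.
Local Open Scope ring_scope.

Definition cube (R : realType) (n : nat) : set 'rV[R]_n :=
  [set x | forall i : 'I_n, -1 < x 0 i < 1].
Arguments cube R n : clear implicits.

Definition ebasis (R : realType) (n : nat) (j : 'I_n) : 'rV[R]_n := delta_mx 0 j.
Arguments ebasis {R n} j.

(** Euclidean norm and (Euclidean) diameter, with diam set0 = 0. *)
Definition enorm (R : realType) (n : nat) (x : 'rV[R]_n) : R :=
  Num.sqrt (\sum_(i < n) x 0 i ^+ 2).

Definition ediam (R : realType) (n : nat) (A : set 'rV[R]_n) : \bar R :=
  ereal_sup ([set 0%E] `|`
    [set r | exists x y, A x /\ A y /\ r = (enorm (x - y))%:E]).

Definition box (R : realType) (n : nat) (a b : 'rV[R]_n) : set 'rV[R]_n :=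
  [set x | forall i : 'I_n, a 0 i <= x 0 i <= b 0 i].

Definition boxvol (R : realType) (n : nat) (a b : 'rV[R]_n) : R :=
  \prod_(i < n) (b 0 i - a 0 i).

Definition leb_outer (R : realType) (n : nat) (A : set 'rV[R]_n) : \bar R :=
  ereal_inf [set s | exists a b : nat -> 'rV[R]_n,
    (forall k (i : 'I_n), a k 0 i <= b k 0 i) /\
    A `<=` \bigcup_k box (a k) (b k) /\
    s = (\sum_(0 <= k <oo) (boxvol (a k) (b k))%:E)%E].

Definition leb_measurable (R : realType) (n : nat) (E : set 'rV[R]_n) : Prop :=
  forall A : set 'rV[R]_n,
    leb_outer A = (leb_outer (A `&` E) + leb_outer (A `&` ~` E))%E.

Definition leb_measurable_fun (R : realType) (n : nat) (O : set 'rV[R]_n)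
    (g : 'rV[R]_n -> \bar R) : Prop :=
  leb_measurable O /\ forall t : R, leb_measurable [set x | O x /\ (t%:E < g x)%E].

(** Lebesgue integral over O of a nonnegative function (layer-cake formula,
    the inner measure being n-dimensional Lebesgue measure, the outer
    integral the 1-dimensional Lebesgue integral). *)
Definition nnint (R : realType) (n : nat) (O : set 'rV[R]_n)
    (g : 'rV[R]_n -> \bar R) : \bar R :=
  (\int[@lebesgue_measure R]_(t in `]0%R, +oo[%classic)
      leb_outer [set x | O x /\ (t%:E < g x)%E])%E.

Definition sint (R : realType) (n : nat) (O : set 'rV[R]_n)
    (g : 'rV[R]_n -> R) : \bar R :=
  (nnint O (fun x => (Num.max (g x) 0)%:E) -
   nnint O (fun x => (Num.max (- g x) 0)%:E))%E.

Definition Lp (R : realType) (n : nat) (O : set 'rV[R]_n) (p : R)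
    (g : 'rV[R]_n -> R) : Prop :=
  leb_measurable_fun O (fun x => (g x)%:E) /\
  (nnint O (fun x => (`|g x| `^ p)%:E) < +oo)%E.

Definition L1_nonneg (R : realType) (n : nat) (O : set 'rV[R]_n)
    (g : 'rV[R]_n -> \bar R) : Prop :=
  leb_measurable_fun O g /\ (nnint O g < +oo)%E.

Definition pd (R : realType) (n : nat) (k : 'I_n) (phi : 'rV[R]_n -> R) :
    'rV[R]_n -> R :=
  fun x => derive phi x (ebasis k).

Definition iterd (R : realType) (n : nat) (s : seq 'I_n) (phi : 'rV[R]_n -> R) :
    'rV[R]_n -> R :=
  foldr (fun k g => pd k g) phi s.

Definition smooth (R : realType) (n : nat) (phi : 'rV[R]_n -> R) : Prop :=
  forall s : seq 'I_n, continuous (iterd s phi) /\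
    forall (k : 'I_n) (x : 'rV[R]_n), derivable (iterd s phi) x (ebasis k).

Definition test_fun (R : realType) (n : nat) (O : set 'rV[R]_n)
    (phi : 'rV[R]_n -> R) : Prop :=
  smooth phi /\ exists K : set 'rV[R]_n,
    compact K /\ K `<=` O /\ forall x, ~ K x -> phi x = 0.

(** w is the weak derivative D^s u of u on O, s a multi-index written as a
    sequence of directions. *)
Definition weak_deriv (R : realType) (n : nat) (O : set 'rV[R]_n)
    (s : seq 'I_n) (u w : 'rV[R]_n -> R) : Prop :=
  forall phi, test_fun O phi ->
    sint O (fun x => u x * iterd s phi x) =
    (((-1) ^+ size s)%:E * sint O (fun x => (w x * phi x)%R))%E.

Definition sobolev2 (R : realType) (n : nat) (O O' : set 'rV[R]_n) (q : R)
    (f : 'rV[R]_n -> 'rV[R]_n) : Prop :=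
  (forall x, O x -> O' (f x)) /\
  forall i : 'I_n, let u := fun x => f x 0 i in
    Lp O q u /\
    forall s : seq 'I_n, (1 <= size s <= 2)%N ->
      exists w, Lp O q w /\ weak_deriv O s u w.

Definition C1_on (R : realType) (n : nat) (O : set 'rV[R]_n)
    (f : 'rV[R]_n -> 'rV[R]_n) : Prop :=
  forall x, O x -> differentiable f x /\
    forall j : 'I_n, {for x, continuous (fun y => derive f y (ebasis j))}.

Definition homeo_on (R : realType) (n : nat) (O : set 'rV[R]_n)
    (f : 'rV[R]_n -> 'rV[R]_n) : Prop :=
  (forall x, O x -> O (f x)) /\
  exists g : 'rV[R]_n -> 'rV[R]_n,
    (forall y, O y -> O (g y)) /\
    (forall x, O x -> g (f x) = x) /\
    (forall y, O y -> f (g y) = y) /\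
    (forall x, O x -> {for x, continuous f}) /\
    (forall y, O y -> {for y, continuous g}).

Definition jacdet (R : realType) (n : nat) (f : 'rV[R]_n -> 'rV[R]_n)
    (x : 'rV[R]_n) : R :=
  \det ('J f x).

Definition Gamma (R : realType) (s : R) : R :=
  fine (\int[@lebesgue_measure R]_(t in `]0%R, +oo[%classic)
          (t `^ (s - 1) * expR (- t))%:E)%E.

(** d-dimensional Hausdorff (outer) measure on R^n, with the usual
    normalisation omega_d / 2^d = pi^(d/2) / (2^d Gamma(d/2+1)). *)
Definition hausdorff_const (R : realType) (d : R) : R :=
  pi `^ (d / 2) / (2 `^ d * Gamma (d / 2 + 1)).

Definition hausdorff_delta (R : realType) (n : nat) (d delta : R)
    (A : set 'rV[R]_n) : \bar R :=
  ereal_inf [set s | exists C : nat -> set 'rV[R]_n,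
    A `<=` \bigcup_k C k /\
    (forall k, (ediam (C k) <= delta%:E)%E) /\
    s = (\sum_(0 <= k <oo) (hausdorff_const d * fine (ediam (C k)) `^ d)%:E)%E].

Definition hausdorff_measure (R : realType) (n : nat) (d : R) (A : set 'rV[R]_n) : \bar R :=
  ereal_sup [set hausdorff_delta d delta A | delta in `]0%R, +oo[%classic].

Definition jac_negpow (R : realType) (n : nat) (f : 'rV[R]_n -> 'rV[R]_n) (a : R)
    (x : 'rV[R]_n) : \bar R :=
  if jacdet f x == 0 then +oo%E else (`|jacdet f x| `^ (- a))%:E.

(* Main.v *)
Require Import Defs.
From HB Require Import structures.
From mathcomp Require Import all_boot all_order all_algebra.
From mathcomp Require Import all_classical all_reals all_analysis.
From mathcomp Require Import measurable_realfun.
From mathcomp Require Import ring lra.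
Import Order.TTheory GRing.Theory Num.Theory.
Import numFieldNormedType.Exports.
Set Implicit Arguments.
Unset Strict Implicit.
Unset Printing Implicit Defensive.
Local Open Scope classical_set_scope.
Local Open Scope ring_scope.

(** The map is [f x = x - P x * e_0]. Fix [lam] with [lam ^ d = 2 ^ (- n)] and
    [kap = lam ^ beta], where [max (0, 1 - (n - d) / q) < beta < min (1, (n - d) / a)].
    The self-similar Cantor set [K] of ratio [lam] is the maximal invariant set
    of the [n]-fold product of a piecewise affine expanding map [T], and the [k]-th
    shell, the set of the [x] with [T^j x] in the cube for [j <= k], consists of
    [2 ^ (n k)] cubes of side [2 lam ^ k]. Put
    [P x = \sum_k kap ^ k (1 - kap) lam ^ k B (T^k x)], where [B] is a C^2 function
    supported in the cube with [d_0 B <= 1], and [d_0 B = 1] near [K]. Then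
    [d_0 P <= 1 - kap ^ k] off the [k]-th shell and [d_0 P = 1] on [K], and the
    second derivatives of [P] are [O ((kap / lam) ^ k)] on the [k]-th shell minus
    the next. As [det Df = 1 - d_0 P], both integrals reduce to geometric series
    of ratios [kap ^ (- a) (2 lam) ^ n] and [(kap / lam) ^ q (2 lam) ^ n], which
    are less than 1 by the choice of [beta]. The map [f] is strictly increasing
    along [e_0] because [T] expands, so that every segment leaves some shell. *)

(** * Lebesgue measure on row vectors *)

(** The shear acts in the single direction [e_0], so the Jacobian matrix is triangular and
    bijectivity reduces to monotonicity on lines; the inverse function theorem would fail exactly on
    [K], where the determinant vanishes. The relation [lam ^ d = 2 ^ (- n)] balances the [2 ^ n]
    children of a cube against the factor [lam] in their diameter, which makes the inverse of a
    binary parametrisation of [K] Hoelder of exponent [d]. The exponent [beta] serves two opposing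
    demands: a large [kap] slows the decay of the Jacobian, a small [kap] tames the second
    derivatives. The hypothesis on [a], [q], [d] says that the two ranges of [beta] meet. The jumps
    of [T] cost no smoothness: a neighbourhood of each hyperplane [x_i = 0] is sent out of the cube,
    where [B] vanishes. As [kap > lam], the bound on the second derivatives blows up at [K]; the
    weak second derivatives come from the partial sums by dominated convergence, [K] being null.
    Measure and integral in the statement are built from box covers and superlevel sets, so
    Caratheodory's construction and Tonelli's theorem first tie them to the library integral. *)

Section LebesgueOuterMeasure.
Context {R : realType} {n : nat}.
Local Notation V := 'rV[R]_n.+1.
Local Notation mu := (@leb_outer R n.+1).

Lemma boxvol_ge0 (a b : V) : (forall i, a 0 i <= b 0 i) -> 0 <= boxvol a b.
Proof. by move=> ab; apply: prodr_ge0 => i _; rewrite subr_ge0. Qed.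

Lemma leb_outer_ge0 (A : set V) : (0 <= mu A)%E.
Proof.
apply: le_ereal_inf_tmp => _ [a [b [ab [_ ->]]]].
by apply: nneseries_ge0 => k _ _; rewrite lee_fin boxvol_ge0.
Qed.

Lemma leb_outer_le_box (a b : V) (A : set V) : (forall i, a 0 i <= b 0 i) ->
  A `<=` box a b -> (mu A <= (boxvol a b)%:E)%E.
Proof.
move=> ab Aab; apply: ereal_inf_lbound.
(* The box is followed by copies of the degenerate box at 0, whose volume is 0 because there is at
   least one coordinate. *)
exists (fun k => if k == 0%N then a else 0), (fun k => if k == 0%N then b else 0).
split=> [[|k] i //|]; split.
  by move=> x /Aab xab; exists 0%N.
rewrite (nneseries_split _ 1) //.
  rewrite big_nat1 eseries0 ?adde0 //.
  by case=> //= k _ _; rewrite /boxvol big_ord_recl !mxE subr0 mul0r.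
case=> [|k] _; rewrite lee_fin boxvol_ge0 //.
Qed.

Lemma leb_outer0 : mu set0 = 0%E.
Proof.
apply/eqP; rewrite eq_le leb_outer_ge0 andbT.
apply: le_trans (@leb_outer_le_box 0 0 _ _ _) _ => //.
by rewrite /boxvol big_ord_recl !mxE subr0 mul0r.
Qed.

Lemma le_leb_outer : {homo mu : A B / A `<=` B >-> (A <= B)%E}.
Proof.
move=> A B AB; apply: ereal_inf_le_tmp => x [a [b [ab [Bab ->]]]].
by exists a, b; split => //; split => //; exact: subset_trans Bab.
Qed.

Lemma leb_outer_sigma_subadditive : sigma_subadditive mu.
Proof.
move=> A; have [[i ioo]|] := pselect (exists i, mu (A i) = +oo%E).
  rewrite (eseries_pinfty _ _ ioo) ?leey// => k _.
  by rewrite -ltNye (lt_le_trans _ (leb_outer_ge0 _)).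
rewrite -forallNE => Aoo.
suff add2e (e : {posnum R}) :
    (mu (\bigcup_n A n) <= \sum_(i <oo) mu (A i) + e%:num%:E)%E.
  by apply/lee_addgt0Pr => _/posnumP[].
apply: le_trans (epsilon_trick _ _ _); last 2 first.
- by move=> k; exact: leb_outer_ge0.
- by [].
(* [P k c] says that [c] covers [A k] with excess at most [e / 2 ^ (k + 1)]. The resulting double
   sequence of boxes is enumerated below by a bijection from [nat] to [nat * nat]. *)
pose P k (c : nat -> V * V) := [/\ forall j i, (c j).1 0 i <= (c j).2 0 i,
   A k `<=` \bigcup_j box (c j).1 (c j).2 &
  (\sum_(0 <= j <oo) (boxvol (c j).1 (c j).2)%:E <=
     mu (A k) + (e%:num / (2 ^ k.+1)%:R)%:E)%E].
have [G PG] : {G : nat -> nat -> V * V & forall k, P k (G k)}.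
  apply: (@choice _ _ P) => k.
  have fk : mu (A k) \is a fin_num.
    by rewrite ge0_fin_numE ?leb_outer_ge0 // ltey; apply/eqP/Aoo.
  have ek : 0 < e%:num / (2 ^ k.+1)%:R by [].
  have [x [a [b [ab [Aab ->]]]] xS] := lb_ereal_inf_adherent ek fk.
  by exists (fun j => (a j, b j)); split => //; exact: ltW.
have /card_esym/ppcard_eqP[f] := card_nat2.
pose F (p : nat * nat) : \bar R := (boxvol (G p.1 p.2).1 (G p.1 p.2).2)%:E.
have F0 p : (0 <= F p)%E by rewrite lee_fin boxvol_ge0 // => i; case: (PG p.1).
apply: (@le_trans _ _ (\esum_(p in setT) F p)%E).
  apply: ereal_inf_lbound => /=.
  exists (fun k => (G (f k).1 (f k).2).1), (fun k => (G (f k).1 (f k).2).2).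
  split; first by move=> k i; case: (PG (f k).1).
  split.
    move=> x [k _ Akx]; have [_ /(_ _ Akx) [j _ xj] _] := PG k.
    by exists (f^-1%FUN (k, j)) => //=; rewrite invK ?inE.
  rewrite nneseries_esumT; last by move=> k; exact: (F0 (f k)).
  by rewrite (reindex_esum setT setT f).
have -> : (\esum_(p in setT) F p = \sum_(k <oo) \sum_(j <oo) F (k, j))%E.
  rewrite nneseries_esumT; last by move=> k; exact: nneseries_ge0.
  transitivity (\esum_(k in setT) \esum_(j in setT) F (k, j))%E; last first.
    by apply: eq_esum => k _; rewrite nneseries_esumT.
  rewrite (@esum_esum _ _ _ setT (fun _ => setT) (fun k j => F (k, j))) //.
  have -> : [set: nat] `*`` (fun=> [set: nat]) = setT :> set (nat * nat).
    by apply/seteqP; split.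
  by apply: eq_esum => -[].
apply: lee_nneseries => k _; first by move=> ?; exact: nneseries_ge0.
by case: (PG k).
Qed.

HB.instance Definition _ := isOuterMeasure.Build R V (@leb_outer R n.+1)
  leb_outer0 leb_outer_ge0 le_leb_outer leb_outer_sigma_subadditive.

(** The map [x -> c + r x] carries covers of [A] to covers of [B]. The one-sided form serves both
    translation invariance ([r = 1]) and the shells ([r = lam]), where a piece of one shell is only
    known to be mapped into the previous one. *)
Lemma leb_outer_affine (c : V) (r : R) (A B : set V) : 0 < r ->
  (forall y, B y -> A (r^-1 *: (y - c))) ->
  (mu B <= (r ^+ n.+1)%:E * mu A)%E.
Proof.
move=> r0 BA; have rn0 : 0 < r ^+ n.+1 by rewrite exprn_gt0.
rewrite -lee_pdivrMl //; apply: le_ereal_inf_tmp => _ [a [b [ab [Aab ->]]]].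
rewrite lee_pdivrMl // -nneseriesZl; last first.
  by move=> k _; rewrite lee_fin boxvol_ge0.
apply: ereal_inf_lbound.
exists (fun k => c + r *: a k), (fun k => c + r *: b k); split.
  by move=> k i; rewrite !mxE lerD2l ler_pM2l.
split.
  move=> y /BA /Aab [k _ yk]; exists k => // i; have := yk i.
  by rewrite !mxE ler_pdivlMl // ler_pdivrMl // lerBrDl lerBlDl.
apply: eq_eseriesr => k _; rewrite -EFinM; congr EFin.
have -> : r ^+ n.+1 = \prod_(i < n.+1) r by rewrite prodr_const card_ord.
rewrite /boxvol -big_split /=.
by apply: eq_bigr => i _; rewrite !mxE; ring.
Qed.

Lemma leb_outer_translate (c : V) (A : set V) :
  mu [set x | A (x + c)] = mu A.
Proof.
apply/eqP; rewrite eq_le; apply/andP; split.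
  have := @leb_outer_affine (- c) 1 A [set x | A (x + c)] ltr01.
  by rewrite expr1n mul1e; apply => y /=; rewrite invr1 scale1r opprK.
have := @leb_outer_affine c 1 [set x | A (x + c)] A ltr01.
by rewrite expr1n mul1e; apply => y /=; rewrite invr1 scale1r subrK.
Qed.

(** The hyperplane cuts each covering box into two boxes whose volumes add up, which is
    Caratheodory's inequality after taking the infimum over covers. *)
Lemma leb_measurable_halfspace (i : 'I_n.+1) (c : R) :
  mu.-caratheodory [set x : V | x 0 i <= c].
Proof.
apply: le_caratheodory_measurable => X.
apply: le_ereal_inf_tmp => _ [a [b [ab [Xab ->]]]].
(* [m k] is [c] clamped to the [i]-th side of the box, so a box lying on one side of the hyperplane
   gets a degenerate second half. *)
pose m k := Num.max (a k 0 i) (Num.min (b k 0 i) c).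
pose b' k : V := \row_j (if j == i then m k else b k 0 j).
pose a' k : V := \row_j (if j == i then m k else a k 0 j).
have am k : a k 0 i <= m k by rewrite /m le_max lexx.
have mb k : m k <= b k 0 i by rewrite /m ge_max ab ge_min lexx.
have ab' k j : a k 0 j <= b' k 0 j by rewrite mxE; case: eqP => [->|].
have a'b k j : a' k 0 j <= b k 0 j by rewrite mxE; case: eqP => [->|].
have -> : (\sum_(0 <= k <oo) (boxvol (a k) (b k))%:E =
   \sum_(0 <= k <oo) (boxvol (a k) (b' k))%:E +
   \sum_(0 <= k <oo) (boxvol (a' k) (b k))%:E)%E.
  rewrite -nneseriesD; last 2 first.
  - by move=> k _ _; rewrite lee_fin boxvol_ge0.
  - by move=> k _ _; rewrite lee_fin boxvol_ge0.
  apply: eq_eseriesr => k _; rewrite -EFinD; congr EFin.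
  rewrite /boxvol (bigD1 i) //= [X in _ = X + _](bigD1 i) //=.
  rewrite [X in _ = _ + X](bigD1 i) //= !mxE eqxx.
  have -> : \prod_(j < n.+1 | j != i) (b' k 0 j - a k 0 j) =
            \prod_(j < n.+1 | j != i) (b k 0 j - a k 0 j).
    by apply: eq_bigr => j ji; rewrite !mxE (negbTE ji).
  have -> : \prod_(j < n.+1 | j != i) (b k 0 j - a' k 0 j) =
            \prod_(j < n.+1 | j != i) (b k 0 j - a k 0 j).
    by apply: eq_bigr => j ji; rewrite !mxE (negbTE ji).
  by ring.
apply: leeD; apply: ereal_inf_lbound.
- exists a, b'; split => //; split => // x [/Xab [k _ xk] xc]; exists k => // j.
  rewrite mxE; case: eqP => [ji|_]; last exact: xk.
  have /andP[axj xbj] := xk j; rewrite axj /=.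
  by rewrite ji in xbj *; rewrite /m !(le_max, le_min) xbj xc orbT.
- exists a', b; split => //; split => // x [/Xab [k _ xk] /= /negP xc]; exists k => // j.
  rewrite mxE; case: eqP => [ji|_]; last exact: xk.
  have /andP[axj xbj] := xk j; rewrite xbj andbT.
  rewrite ji in axj *; rewrite /m ge_max axj /= ge_min.
  by rewrite -ltNge in xc; rewrite (ltW xc) orbT.
Qed.

End LebesgueOuterMeasure.

Lemma coord_le_norm (R : realType) (n : nat) (x : 'rV[R]_n) (i : 'I_n) :
  `|x 0 i| <= `|x|.
Proof.
rewrite [leRHS]/Num.norm /= mx_normrE.
by apply/bigmax_geP; right => /=; exists (0, i).
Qed.

Section LebesgueMeasure.
Context {R : realType} {n : nat}.
Local Notation V := 'rV[R]_n.+1.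
Local Notation X := (caratheodory_type (@leb_outer R n.+1)).

Definition leb : set X -> \bar R := @leb_outer R n.+1.

HB.instance Definition _ := isMeasure.Build _ X R leb
  (@caratheodory_measure0 R V (@leb_outer R n.+1))
  (@caratheodory_measure_ge0 R V (@leb_outer R n.+1))
  (@caratheodory_measure_sigma_additive R V (@leb_outer R n.+1)).

Lemma measurable_coord (i : 'I_n.+1) :
  measurable_fun [set: X] (fun x : X => (x : V) 0 i).
Proof.
apply: (measurability _ (RGenOInfty.measurableE R)) => _ [_ [c ->]] <-.
rewrite setTI.
have -> : (fun x : X => (x : V) 0 i) @^-1` `]c, +oo[ =
   ~` ([set x : V | x 0 i <= c] : set X).
  by apply/seteqP; split => x /=; rewrite in_itv/= andbT ltNge => /negP.
by apply: measurableC; exact: leb_measurable_halfspace.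
Qed.

Lemma measurable_open_box (a b : V) :
  measurable ([set x : V | forall i, a 0 i < x 0 i < b 0 i] : set X).
Proof.
have -> : ([set x : V | forall i, a 0 i < x 0 i < b 0 i] : set X) =
  \bigcap_(i in [set: 'I_n.+1])
     (fun x : X => (x : V) 0 i) @^-1` `]a 0 i, b 0 i[.
  apply/seteqP; split => x /= xab i; first by move=> _ /=; rewrite in_itv/=.
  by have := xab i Logic.I; rewrite /= in_itv.
apply: fin_bigcap_measurable => // i _; rewrite -[X in measurable X]setTI.
exact: measurable_coord.
Qed.

Lemma measurable_cube : measurable (cube R n.+1 : set X).
Proof.
have -> : cube R n.+1 =
    [set x : V | forall i, (const_mx (-1) : V) 0 i < x 0 i < (const_mx 1 : V) 0 i].
  by apply/seteqP; split => x /= h i; have := h i; rewrite !mxE.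
exact: measurable_open_box.
Qed.

(** Tonelli's theorem, on which [nnintE] rests, asks for this. *)
Lemma leb_sigma_finite : sigma_finite [set: X] leb.
Proof.
pose B k : set V := [set x : V | forall i,
   (const_mx (- k%:R) : V) 0 i < x 0 i < (const_mx k%:R : V) 0 i].
exists B; last first.
  move=> k; split; first exact: measurable_open_box.
  apply: le_lt_trans (@leb_outer_le_box _ _ (const_mx (- k%:R)) (const_mx k%:R) _ _ _) _.
  - by move=> i; rewrite !mxE -subr_ge0 opprK addr_ge0.
  - by move=> x xk i; have /andP[/ltW -> /ltW ->] := xk i.
  - by rewrite ltry.
apply/seteqP; split => // x _; exists (Num.bound `|x : V|) => // i; rewrite !mxE.
rewrite -ltr_norml; apply: le_lt_trans (archi_boundP _) => //.
exact: (@coord_le_norm _ _ (x : V)).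
Qed.

HB.instance Definition _ := Measure_isSigmaFinite.Build _ X R leb leb_sigma_finite.

(** Boxes with rational corners form a countable base; [unpickle] enumerates the pairs of corners,
    and indices that code no box inside [U] contribute the empty set. *)
Lemma measurable_open (U : set V) : open U -> measurable (U : set X).
Proof.
move=> oU; pose bx (p : 'rV[rat]_n.+1 * 'rV[rat]_n.+1) : set V :=
  [set x : V | forall i, (map_mx ratr p.1 : V) 0 i < x 0 i < (map_mx ratr p.2 : V) 0 i].
have -> : U = \bigcup_k (if unpickle k is Some p then
    if `[< bx p `<=` U >] then bx p else set0 else set0).
  apply/seteqP; split => [x Ux|x [k _]]; last first.
    by case: unpickle => // p; case: asboolP => // + /=; apply.
  have /nbhs_ballP[e /= e0 xeU] : nbhs x U by exact: open_nbhs_nbhs.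
  have /choice[p pP] (i : 'I_n.+1) : exists q : rat, ratr q \in `]x 0 i - e, x 0 i[.
    by apply: rat_in_itvoo; rewrite ltrBlDr ltrDl.
  have /choice[q qP] (i : 'I_n.+1) : exists q : rat, ratr q \in `]x 0 i, x 0 i + e[.
    by apply: rat_in_itvoo; rewrite ltrDl.
  pose pq := (\row_i p i, \row_i q i).
  exists (pickle pq) => //; rewrite pickleK asboolT.
    move=> i; rewrite !mxE; move: (pP i) (qP i).
    by rewrite !in_itv/= => /andP[_ ->] /andP[-> _].
  move=> y yb; apply: xeU; split => // i j; rewrite ord1 {i}.
  have := yb j; rewrite !mxE /= => /andP[py yq].
  move: (pP j) (qP j); rewrite !in_itv/= => /andP[xp _] /andP[_ qx].
  by rewrite /ball/= ltr_norml ltrBlDr ltrBrDr; apply/andP; split; lra.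
apply: bigcupT_measurable => k; case: unpickle => // p; case: asboolP => // _.
exact: measurable_open_box.
Qed.

Lemma continuous_measurable (f : V -> R) : continuous f ->
  measurable_fun [set: X] (f : X -> R).
Proof.
move=> /continuousP cf; apply: (measurability _ (RGenOpens.measurableE R)).
by move=> _ [_ [a [b ->]] <-]; rewrite setTI; apply/measurable_open/cf/interval_open.
Qed.

Local Open Scope ereal_scope.

(* The layer-cake definition of [nnint] agrees with the library integral, by
   Tonelli on the subgraph of [g]. *)
Lemma nnintE (D : set V) (g : V -> \bar R) : measurable (D : set X) ->
  measurable_fun (D : set X) (g : X -> \bar R) -> (forall x, D x -> 0 <= g x) ->
  nnint D g = \int[leb]_(x in D) g x.
Proof.
move=> mD mg g0.
pose G : X -> \bar R := g \_ D.
have mG : measurable_fun [set: X] G by exact: (measurable_restrictT _ mD).1.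
have G0 x : 0 <= G x by rewrite /G patchE; case: ifPn => // /set_mem /g0.
pose S : set (X * measurableTypeR R) := [set p | (0 < p.2)%R] `&` [set p | p.2%:E < G p.1].
have mS : measurable S.
  apply: measurableI.
    have : measurable_fun [set: X * measurableTypeR R] (fun p => (0 < p.2)%R).
      exact: measurable_fun_ltr.
    by move=> /(_ measurableT [set true]); rewrite setTI; exact.
  rewrite -[X in measurable X]setTI.
  apply: measurable_lte => //.
  - by apply/measurable_EFinP; exact: measurable_snd.
  - by apply: measurableT_comp => //; exact: measurable_fst.
pose h (p : X * measurableTypeR R) : \bar R := (\1_S p)%:E.
have mh : measurable_fun setT h by apply/measurable_EFinP/measurable_indic.
have h0 p : 0 <= h p by rewrite lee_fin.
rewrite /nnint.
transitivity (\int[@lebesgue_measure R]_t \int[leb]_x h (x, t)).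
  rewrite integral_mkcond; apply: eq_integral => t _; rewrite patchE.
  case: ifPn => [|]; rewrite ?inE ?notin_setE/= in_itv/= andbT => t0; last first.
    rewrite integral0_eq // => x _; rewrite /h indicE memNset //=.
    by move=> [].
  rewrite (_ : (fun x => h (x, t)) =
     (fun x : X => (\1_([set x | D x /\ ((t : R)%:E < g x)%E] : set X) x)%:E)); last first.
    apply/funext => x; rewrite /h !indicE; congr ((_ _)%:R%:E).
    apply/idP/idP; rewrite !inE /S /G /= patchE.
      case=> _; case: ifPn => [/set_mem //|_]; rewrite lte_fin.
      by move=> t0'; rewrite ltNge (ltW t0) in t0'.
    by move=> [Dx tg]; rewrite mem_set.
  rewrite integral_indic // ?setIT //.
  have -> : [set x : X | D x /\ (t : R)%:E < g x] = D `&` [set x : X | (t : R)%:E < g x] by [].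
  by apply: measurable_lte => //; exact: measurable_cst.
transitivity (\int[leb]_x \int[@lebesgue_measure R]_t h (x, t)).
  by symmetry; exact: (@fubini_tonelli _ _ X (measurableTypeR R) R leb
    (@lebesgue_measure R) h mh h0).
rewrite [RHS]integral_mkcond; apply: eq_integral => x _.
rewrite -/(G x).
transitivity (\int[@lebesgue_measure R]_t
   (\1_([set t : R | (0 < t)%R /\ (t%:E < G x)%E]) t)%:E).
  by apply: eq_integral => t _; rewrite /h !indicE.
have GE : [set t : R | (0 < t)%R /\ t%:E < G x] =
    [set` Interval (BRight 0%R) (if G x is r%:E then BLeft r else +oo%O)].
  apply/seteqP; split => t; rewrite /= in_itv/=; move: (G0 x); case: (G x) => [r| |] //=.
  - by move=> _ []; rewrite lte_fin => -> ->.
  - by move=> _ [->].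
  - by move=> _ /andP[-> tr]; rewrite lte_fin.
  - by move=> _ /andP[-> _]; rewrite ltry.
rewrite integral_indic ?setIT ?GE //.
rewrite [LHS]lebesgue_measure_itv; move: (G0 x); case: (G x) => [r| |] //=.
- rewrite lee_fin !lte_fin le_eqVlt => /orP[/eqP <-|r0]; first by rewrite ltxx.
  by rewrite r0 sube0.
- by rewrite ltry addye.
Qed.

(** In layer-cake form both sides are integrals over [t] of outer measures of superlevel sets, and
    these are translation invariant. *)
Lemma integral_translate (c : V) (g : V -> \bar R) :
  measurable_fun [set: X] (g : X -> \bar R) ->
  measurable_fun [set: X] ((fun x => g (x + c)%R) : X -> \bar R) ->
  (forall x, 0 <= g x) ->
  \int[leb]_x g (x + c)%R = \int[leb]_x g x.
Proof.
move=> mg mgc g0; rewrite -!nnintE //.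
rewrite /nnint; apply: eq_integral => t _.
rewrite -[RHS](leb_outer_translate c); congr leb_outer.
Qed.

End LebesgueMeasure.

(** * Integration by parts on the cube *)

Lemma is_derive_line (R : realType) (V W : normedModType R) (f : V -> W) (a v : V)
    (df : W) (t : R) :
  is_derive (a + t *: v) v f df ->
  is_derive t (1 : R) (fun s : R => f (a + s *: v)) df.
Proof.
have E : (fun h : R => h^-1 *: (((fun s : R => f (a + s *: v)) \o shift t) (h *: (1 : R))
    - (fun s : R => f (a + s *: v)) t)) =
  (fun h : R => h^-1 *: ((f \o shift (a + t *: v)) (h *: v) - f (a + t *: v))).
  apply/funext => h /=; congr (_ *: (f _ - _)).
  by rewrite [h *: (1 : R)]mulr1 scalerDl addrCA.
by case=> d dE; apply: DeriveDef; rewrite /derivable /derive /= E.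
Qed.

Lemma deriv_zero_off_closed (R : realType) (V : normedModType R) (f : V -> R)
    (K : set V) (x v : V) (df : R) : closed K ->
  (forall y, ~ K y -> f y = 0) -> ~ K x -> is_derive x v f df -> df = 0.
Proof.
move=> cK f0 Kx [_ <-]; rewrite -(derive_cst (0 : R) x v).
apply: near_eq_derive; near=> y; apply: f0; near: y.
by apply: open_nbhs_nbhs; split; [exact: closed_openC|].
Unshelve. all: by end_near. Qed.

Section IntegrationByParts.
Context {R : realType} {n : nat}.
Local Notation V := 'rV[R]_n.+1.
Local Notation X := (caratheodory_type (@leb_outer R n.+1)).

Definition abox (M : R) : set V := [set x | forall i, - M <= x 0 i <= M].

Lemma continuous_translate (F : V -> R) (c : V) : continuous F ->
  continuous (fun x : V => F (x + c)).
Proof.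
move=> cF x; pose s (y : V) : V := y + c.
apply: (@continuous_comp _ _ _ s F); last exact: cF.
have -> : s = id \+ cst c by [].
apply: (@cvgD R V V (nbhs x) _ id (cst c) x c); [exact: cvg_id|exact: cvg_cst].
Qed.

Lemma compact_abox M : compact (abox M).
Proof.
have := @rV_compact R n.+1 (fun=> `[- M, M]%classic) (fun=> @segment_compact R _ _).
by congr compact; apply/seteqP; split => x /= h i; have := h i; rewrite ?in_itv.
Qed.

Lemma measurable_abox M : measurable (abox M : set X).
Proof.
have -> : abox M = ~` (~` (abox M : set V)) by rewrite setCK.
apply: (@measurableC _ X); apply/measurable_open/closed_openC.
by apply: compact_closed (@compact_abox M); exact: norm_hausdorff.
Qed.

Lemma leb_abox_lty M : (leb (abox M) < +oo)%E.
Proof.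
have [M0|M0] := leP 0 M.
  apply: le_lt_trans (@leb_outer_le_box _ _ (const_mx (- M)) (const_mx M) _ _ _) _.
  - by move=> i; rewrite !mxE -subr_ge0 opprK addr_ge0.
  - by move=> x xk i; rewrite !mxE.
  - by rewrite ltry.
have -> : abox M = set0.
  by apply/seteqP; split => // x /(_ ord0) h; exfalso; lra.
by rewrite measure0.
Qed.

Lemma continuous_bounded_abox (F : V -> R) M : continuous F ->
  exists C : R, forall x, abox M x -> `|F x| <= C.
Proof.
move=> cF; have : compact (F @` abox M).
  by apply: continuous_compact; [exact: continuous_subspaceT|exact: compact_abox].
move=> /compact_bounded [C [_ CP]]; exists (C + 1) => x xM.
by apply: (CP (C + 1)); [rewrite ltrDl|exists x].
Qed.

Lemma cube_sub_abox : cube R n.+1 `<=` abox 1.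
Proof. by move=> x xc i; have /andP[/ltW -> /ltW ->] := xc i. Qed.

Lemma leb_cube_lty : (leb (cube R n.+1) < +oo)%E.
Proof. exact: le_lt_trans (le_leb_outer cube_sub_abox) (leb_abox_lty 1). Qed.

Lemma measurable_EFin_continuous (D : set V) (F : V -> R) : continuous F ->
  measurable_fun (D : set X) (EFin \o F : X -> \bar R).
Proof.
move=> cF; apply/measurable_EFinP.
by apply: measurable_funS (continuous_measurable cF).
Qed.

Lemma integrable_cst_abox (C M : R) :
  leb.-integrable [set: X] ((cst C%:E : X -> \bar R) \_ (abox M)).
Proof.
apply/(integrable_mkcond _ (measurable_abox M)).
apply: (@measurable_bounded_integrable _ X R leb (cst C)) => //.
- exact: measurable_abox.
- exact: leb_abox_lty.
- by exists `|C|; split => // z zC x _ /=; exact: ltW.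
Qed.

Lemma integrable_continuous_abox (F : V -> R) M : continuous F ->
  (forall x, ~ abox M x -> F x = 0) ->
  leb.-integrable [set: X] (EFin \o F : X -> \bar R).
Proof.
move=> cF F0; have [C CP] := @continuous_bounded_abox F M cF.
apply: (@le_integrable _ X R leb setT measurableT (EFin \o F)
  ((cst C%:E : X -> \bar R) \_ (abox M)) _ _ (integrable_cst_abox C M)).
  exact: measurable_EFin_continuous.
move=> x _ /=; rewrite patchE; case: ifPn => [/set_mem xM|/negP xM].
  by rewrite /= lee_fin (le_trans (CP _ xM)) ?ler_norm.
have xM' : ~ abox M x by move=> h; apply: xM; rewrite inE.
by rewrite /= (F0 _ xM') normr0.
Qed.

Lemma integrable_continuous_cube (F : V -> R) : continuous F ->
  leb.-integrable (cube R n.+1 : set X) (EFin \o F : X -> \bar R).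
Proof.
move=> cF; have [C CP] := continuous_bounded_abox 1 cF.
apply: (@measurable_bounded_integrable _ X R leb F) => //.
- exact: measurable_cube.
- exact: leb_cube_lty.
- by apply: measurable_funS (continuous_measurable cF).
exists `|C|; split => // z zC x xc /=.
by rewrite (le_trans (CP _ (cube_sub_abox xc))) // (le_trans (ler_norm _)) // ltW.
Qed.

Lemma integral_translate_abox (F : V -> R) M (c : V) : continuous F ->
  (forall x, ~ abox M x -> F x = 0) ->
  (\int[leb]_x (F (x + c))%:E = \int[leb]_x (F x)%:E)%E.
Proof.
move=> cF F0; rewrite [LHS]integralE [RHS]integralE.
have cFc := @continuous_translate F c cF.
have mF := measurable_EFin_continuous (D := setT) cF.
have mFc := measurable_EFin_continuous (D := setT) cFc.
have Ep : ((EFin \o (fun x : V => F (x + c)%R))^\+ = (fun x : V => (EFin \o F)^\+ (x + c)%R))%E.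
  exact: (funepos_comp (EFin \o F) (fun x : V => x + c)).
have En : ((EFin \o (fun x : V => F (x + c)%R))^\- = (fun x : V => (EFin \o F)^\- (x + c)%R))%E.
  exact: (funeneg_comp (EFin \o F) (fun x : V => x + c)).
congr (_ - _)%E.
  have := @integral_translate R n c _ (measurable_funepos mF); rewrite -Ep.
  by apply; [exact: measurable_funepos|exact: funepos_ge0].
have := @integral_translate R n c _ (measurable_funeneg mF); rewrite -En.
by apply; [exact: measurable_funeneg|exact: funeneg_ge0].
Qed.


(** By translation invariance every difference quotient of [f] in direction [k] has integral zero.
    The quotients converge to [df] and are dominated thanks to the mean value theorem, so no
    iterated integration along lines is involved. *)
Lemma integral_partial0 (k : 'I_n.+1) (f df : V -> R) (K : set V) :
  continuous f -> continuous df -> (forall x, is_derive x (ebasis k) f (df x)) ->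
  closed K -> K `<=` abox 1 -> (forall x, ~ K x -> f x = 0) ->
  (\int[leb]_x (df x)%:E)%E = 0%E.
Proof.
move=> cf cdf fdf cK K1 f0.
have df0 x : ~ K x -> df x = 0 by move=> Kx; exact: (@deriv_zero_off_closed R V f K x _ _ cK f0 Kx (fdf x)).
(* Steps have length at most 1: [f] lives in [abox 1], its quotients in [abox 2], and the mean value
   points in [abox 3]. *)
have [C CP] := continuous_bounded_abox 3 cdf.
pose h (m : nat) : R := m.+1%:R^-1.
have h0 m : 0 < h m by rewrite /h invr_gt0.
have h1 m : h m <= 1 by rewrite /h invf_le1 // ler1n.
pose q m x : R := (h m)^-1 * (f (x + h m *: ebasis k) - f x).
have cfh m := @continuous_translate f (h m *: ebasis k) cf.
have cq m : continuous (q m).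
  move=> x; exact: (@continuousM R V (cst (h m)^-1)
    ((fun x : V => f (x + h m *: ebasis k)) - f) x
    (@cst_continuous _ _ _ x) (@continuousB R R V _ _ x (cfh m x) (cf x))).
have shift_box (M t : R) (x : V) : 0 <= t <= 1 -> abox M (x + t *: ebasis k) -> abox (M + 1) x.
  move=> /andP[t0 t1] xM i; have := xM i; rewrite !mxE eqxx /=.
  by case: (i == k); rewrite /= ?mulr1n ?mulr0n ?mulr1 ?mulr0 => /andP[? ?]; apply/andP; split; lra.
have shift_box' (M t : R) (x : V) : 0 <= t <= 1 -> abox M x -> abox (M + 1) (x + t *: ebasis k).
  move=> /andP[t0 t1] xM i; have := xM i; rewrite !mxE eqxx /=.
  by case: (i == k); rewrite /= ?mulr1n ?mulr0n ?mulr1 ?mulr0 => /andP[? ?]; apply/andP; split; lra.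
have abox_le (M N : R) : M <= N -> abox M `<=` abox N.
  by move=> MN x xM i; have /andP[? ?] := xM i; apply/andP; split; lra.
have f01 x : ~ abox 1 x -> f x = 0 by move=> x1; apply: f0 => /K1.
have mvt m x : exists2 t : R, 0 <= t <= 1 & q m x = df (x + t *: ebasis k).
  have cl : {within `[0, h m], continuous (fun s : R => f (x + s *: ebasis k))}.
    apply: continuous_subspaceT => s.
    pose l (s : R) : V := x + s *: ebasis k.
    apply: (@continuous_comp _ _ _ l f); last exact: cf.
    by apply: (@cvgD R V R (nbhs s) _ (cst x) (fun s : R => s *: ebasis k) x (s *: ebasis k));
      [exact: cvg_cst|apply: cvgZl; exact: cvg_id].
  have [t t0h tE] := @MVT_segment R (fun s => f (x + s *: ebasis k))
    (fun s => df (x + s *: ebasis k)) 0 (h m) (ltW (h0 m))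
    (fun s _ => is_derive_line (fdf _)) cl.
  move: t0h; rewrite in_itv /= => /andP[t0 th]; exists t; first by rewrite t0 (le_trans th).
  rewrite /q; move: tE; rewrite scale0r addr0 subr0 => ->.
  by rewrite mulrCA mulVf ?mulr1 ?gt_eqF.
have q0 m x : ~ abox 2 x -> q m x = 0.
  move=> x2; rewrite /q !f01 ?subrr ?mulr0 //.
    by move=> x1; apply: x2; apply: (abox_le 1 2) x1; lra.
  move=> /shift_box h'; apply: x2; rewrite -[2]/(1 + 1); apply: h'.
  by rewrite (ltW (h0 m)) h1.
have qC m x : abox 2 x -> `|q m x| <= C.
  move=> x2; have [t t01 ->] := mvt m x; apply: CP.
  by have := shift_box' 2 t x t01 x2; rewrite (_ : 2 + 1 = 3) //; ring.
have Iq m : (\int[leb]_x (q m x)%:E)%E = 0%E.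
  have ifh : leb.-integrable [set: X] (EFin \o (fun x => f (x + h m *: ebasis k))).
    apply: (@integrable_continuous_abox _ 2) => // x x2; apply: f01.
    move=> /shift_box h'; apply: x2; rewrite -[2]/(1 + 1); apply: h'.
    by rewrite (ltW (h0 m)) h1.
  have iff : leb.-integrable [set: X] (EFin \o f) by exact: (@integrable_continuous_abox _ 1).
  under eq_integral do rewrite /q EFinM EFinB.
  rewrite integralZl //; last exact: integrableB.
  rewrite integralB_EFin // (@integral_translate_abox f 1) // subee ?mule0 //.
  exact: integrable_fin_num.
have cvq x : q m x @[m --> \oo] --> df x.
  have [fd fE] := fdf x; rewrite -fE.
  have hm : h m @[m --> \oo] --> (0 : R)^'.
    move=> A A0; have A0' : nbhs (0 : R) [set x : R | x != 0 -> A x] := A0.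
    have H : \forall m \near \oo, h m != 0 -> A (h m) by exact: cvg_harmonic A0'.
    suff : \forall m \near \oo, A (h m) by [].
    by near=> m; apply: (near H m) => //; rewrite gt_eqF.
  have -> : (fun m => q m x) = (fun t : R => t^-1 *:
      ((f \o shift x) (t *: ebasis k) - f x)) \o h.
    by apply/funext => m; rewrite /q /= [x + _]addrC.
  exact: (cvg_comp _ _ hm fd).
have cvqE : {ae leb, forall x : X, [set: X] x ->
    (EFin \o q m) x @[m --> \oo] --> (EFin \o df) x}.
  by apply: aeW => x _; apply/fine_cvgP; split; [exact: nearW|exact: cvq].
have domq : {ae leb, forall (x : X) m, [set: X] x ->
    (`|(EFin \o q m) x| <= ((cst C%:E : X -> \bar R) \_ (abox 2)) x)%E}.
  apply: aeW => x m _; rewrite patchE; case: ifPn => [/set_mem xM|/negP xM].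
    by rewrite /= lee_fin qC.
  have xM' : ~ abox 2 x by move=> x2; apply: xM; rewrite inE.
  by rewrite /= (q0 _ _ xM') normr0.
have [_ _ H] := @dominated_convergence _ X R leb setT measurableT
  (fun m => EFin \o q m) (EFin \o df) ((cst C%:E : X -> \bar R) \_ (abox 2))
  (fun m => measurable_EFin_continuous (cq m)) (measurable_EFin_continuous cdf)
  cvqE (integrable_cst_abox C 2) domq.
rewrite -(cvg_lim _ H) //.
rewrite (_ : [sequence _]_n = cst 0%E) ?lim_cst //.
by apply/funext => m; exact: Iq.
Unshelve. all: by end_near. Qed.

(** The product [u * f] vanishes off [K], so [integral_partial0] applies to it although [u] has no
    boundary condition; the product rule yields the two terms. *)
Lemma integral_by_parts (k : 'I_n.+1) (u du f df : V -> R) (K : set V) :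
  continuous u -> continuous du -> continuous f -> continuous df ->
  (forall x, is_derive x (ebasis k) u (du x)) ->
  (forall x, is_derive x (ebasis k) f (df x)) ->
  closed K -> K `<=` cube R n.+1 -> (forall x, ~ K x -> f x = 0) ->
  (\int[leb]_(x in cube R n.+1) (u x * df x)%:E =
   - \int[leb]_(x in cube R n.+1) (du x * f x)%:E)%E.
Proof.
move=> cu cdu cf cdf uD fD cK Kc f0.
have df0 x : ~ K x -> df x = 0 by move=> Kx; exact: (@deriv_zero_off_closed R V f K x _ _ cK f0 Kx (fD x)).
have cM (g h : V -> R) : continuous g -> continuous h -> continuous (fun x => g x * h x).
  by move=> cg ch x; exact: (@continuousM R V g h x (cg x) (ch x)).
have := @integral_partial0 k (u * f) (fun x => u x * df x + f x * du x) K.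
move=> /(_ (cM _ _ cu cf) _ _ cK _ _) H.
have {}H : (\int[leb]_x (u x * df x + f x * du x)%:E)%E = 0%E.
  apply: H.
  - by move=> x; exact: (@continuousD R R V _ _ x (cM _ _ cu cdf x) (cM _ _ cf cdu x)).
  - by move=> x /Kc /cube_sub_abox.
  - by move=> x /f0; rewrite /GRing.mul /= => ->; rewrite mulr0.
have : (\int[leb]_(x in cube R n.+1) (u x * df x + f x * du x)%:E)%E = 0%E.
  rewrite -H [LHS]integral_mkcond; apply: eq_integral => x _; rewrite patchE.
  case: ifPn => // /negP xc; have xK : ~ K x by move=> /Kc h; apply: xc; rewrite inE.
  by rewrite f0 // df0 // mulr0 mul0r addr0.
under eq_integral do rewrite EFinD.
rewrite integralD_EFin //; last 3 first.
- exact: measurable_cube.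
- by apply: integrable_continuous_cube; exact: cM.
- by apply: integrable_continuous_cube; exact: cM.
under [X in _ -> _ = (- X)%E]eq_integral do rewrite mulrC.
have : (\int[leb]_(x in cube R n.+1) (f x * du x)%:E)%E \is a fin_num.
  by apply: integrable_fin_num; [exact: measurable_cube|
    apply: integrable_continuous_cube; exact: cM].
move: (\int[leb]_(x in _) _)%E (\int[leb]_(x in _) (f x * du x)%:E)%E => a b.
by case: a b => [a| |] [b| |] //= _ [] /eqP; rewrite addr_eq0 => /eqP ->.
Qed.

End IntegrationByParts.

(** * Cut-off functions and the expanding map *)

Section PlateauBump.
Context {R : realType}.

Lemma is_derive_mul (f g : R -> R) (a b t : R) :
  is_derive t 1 f a -> is_derive t 1 g b ->
  is_derive t 1 (fun x => f x * g x) (a * g t + f t * b).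
Proof.
move=> fa gb; have H := @is_deriveM R R f g t 1 a b fa gb.
by apply: (@is_derive_eq _ _ _ _ _ _ _ _ H); rewrite /GRing.scale /= addrC [g t * a]mulrC.
Qed.

Lemma is_derive_add (f g : R -> R) (a b t : R) :
  is_derive t 1 f a -> is_derive t 1 g b -> is_derive t 1 (fun x => f x + g x) (a + b).
Proof. by move=> fa gb; exact: (@is_deriveD R R R f g t 1 a b fa gb). Qed.

Lemma is_derive_const (c t : R) : is_derive t 1 (fun _ : R => c) 0.
Proof. exact: is_derive_cst. Qed.

Lemma is_derive_scal (c : R) (f : R -> R) (a t : R) :
  is_derive t 1 f a -> is_derive t 1 (fun x => c * f x) (c * a).
Proof.
move=> fa; apply: (is_derive_eq (is_derive_mul (is_derive_const c t) fa)).
by rewrite mul0r add0r.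
Qed.

Lemma is_derive_continuous (f df : R -> R) :
  (forall t, is_derive t (1 : R) f (df t)) -> continuous f.
Proof.
by move=> fdf t; apply: differentiable_continuous; apply/derivable1_diffP; case: (fdf t).
Qed.

(** Truncated powers: the third one is C^2 with explicit derivatives, so a composition of such
    powers gives a concrete C^2 cut-off. *)
Definition ppow (k : nat) (s : R) : R := Num.max s 0 ^+ k.

Lemma ppow_ge0 k s : 0 <= ppow k s.
Proof. by rewrite exprn_ge0 // le_max lexx orbT. Qed.

Lemma ppow_le0 k s : s <= 0 -> ppow k.+1 s = 0.
Proof. by move=> s0; rewrite /ppow max_r // exprS mul0r. Qed.

Lemma continuous_ppow k : continuous (ppow k).
Proof.
have cm : continuous ((@id R) \max (cst 0)).
  by apply: max_fun_continuous => x; [exact: cvg_id|exact: cvg_cst].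
move=> s; apply: (@continuous_comp _ _ _ ((@id R) \max (cst 0)) (fun s : R => s ^+ k)).
  exact: cm.
exact: exprn_continuous.
Qed.

Lemma is_derive_ppow k (s : R) :
  is_derive s 1 (ppow k.+2) (k.+2%:R * ppow k.+1 s).
Proof.
have [s0|s0|->] := ltgtP s 0.
- rewrite ppow_le0 ?(ltW s0) // mulr0; apply: (@near_eq_is_derive _ _ _ (cst 0)).
  by near=> t; rewrite /= ppow_le0 //; apply/ltW; near: t; exact: lt_nbhsl.
- have -> : ppow k.+1 s = s ^+ k.+1 by rewrite /ppow max_l // ltW.
  apply: (@near_eq_is_derive _ _ _ (fun t : R => t ^+ k.+2)).
    near=> t; rewrite /ppow max_l //; apply/ltW; near: t; exact: lt_nbhsr.
  apply: DeriveDef; first exact: exprn_derivable.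
  by rewrite exp_derive /GRing.scale /= mulr1.
- rewrite ppow_le0 // mulr0.
  (* At 0 the difference quotient of [ppow k.+2] is [ppow k.+1] itself, which tends to 0. *)
  have H : (fun h : R => h^-1 *: ((ppow k.+2 \o shift 0) (h *: (1 : R)) - ppow k.+2 0))
      @ 0^' --> (0 : R).
    apply: (@cvg_trans _ (ppow k.+1 @ 0^')).
      apply: near_eq_cvg; near=> h.
      rewrite /= [h *: _]mulr1 addr0 (ppow_le0 _ (lexx 0)) subr0 /GRing.scale /=.
      have h0 : h != 0 by near: h; exact: nbhs_dnbhs_neq.
      have [h1|h1] := leP h 0; first by rewrite !ppow_le0 ?mulr0.
      by rewrite /ppow max_l ?ltW // [in RHS]exprS mulKf.
    rewrite -{2}(ppow_le0 k (lexx 0)); apply: cvg_within_filter; exact: continuous_ppow.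
  by apply: DeriveDef; [exact: (cvgP _ H)|exact: (cvg_lim _ H)].
Unshelve. all: by end_near. Qed.

Variable l : R.
Hypotheses (l0 : 0 < l) (l1 : l < 1).

(** [u] is the even quadratic with value 0 at [|t| = l] and 1 at [|t| = 1]. The cut-off [bump0] is
    the positive part of [1 - u_+ ^ 3], cubed: it equals 1 where [u <= 0] and 0 where [u >= 1]. *)
Let w := (1 - l ^+ 2)^-1.
Let u (t : R) := w * (t ^+ 2 - l ^+ 2).

Let w0 : 0 < w.
Proof. by rewrite invr_gt0 subr_gt0 expr_lt1 // ltW. Qed.

Let u_is_derive (t : R) : is_derive t (1 : R) u (2 * w * t).
Proof.
have D := is_derive_mul (is_derive_id t (1 : R)) (is_derive_id t (1 : R)).
apply: (is_derive_eq (is_derive_scal w (is_derive_add D (is_derive_const (- l ^+ 2) t)))).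
by rewrite /=; ring.
Qed.

Let u1_is_derive (t : R) : is_derive t (1 : R) (fun t => 2 * w * t) (2 * w).
Proof.
by apply: (is_derive_eq (is_derive_scal (2 * w) (is_derive_id t (1 : R)))); rewrite mulr1.
Qed.

Let pu_is_derive k (t : R) :
  is_derive t (1 : R) (fun t => ppow k.+2 (u t)) (k.+2%:R * ppow k.+1 (u t) * (2 * w * t)).
Proof. exact: (is_derive1_comp (is_derive_ppow k (u t)) (u_is_derive t)). Qed.

Let v t := 1 + -1 * ppow 3 (u t).
Let v1 t := -1 * (3 * ppow 2 (u t) * (2 * w * t)).
Let v2 t := -1 * (3 * (2 * ppow 1 (u t) * (2 * w * t) * (2 * w * t) + ppow 2 (u t) * (2 * w))).

Let v_is_derive t : is_derive t (1 : R) v (v1 t).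
Proof.
apply: (is_derive_eq (is_derive_add (is_derive_const 1 t) (is_derive_scal (-1) (pu_is_derive 1 t)))).
by rewrite add0r.
Qed.

Let v1_is_derive t : is_derive t (1 : R) v1 (v2 t).
Proof.
have D := is_derive_mul (is_derive_scal 3 (pu_is_derive 0 t)) (u1_is_derive t).
apply: (is_derive_eq (is_derive_scal (-1) D)).
by rewrite /v2 /=; ring.
Qed.

Let bump0 t := ppow 3 (v t).
Let bump1 t := 3 * ppow 2 (v t) * v1 t.
Let bump2 t := 3 * (2 * ppow 1 (v t) * v1 t * v1 t + ppow 2 (v t) * v2 t).

Let bump0_is_derive (t : R) : is_derive t (1 : R) bump0 (bump1 t).
Proof. exact: (is_derive1_comp (is_derive_ppow 1 (v t)) (v_is_derive t)). Qed.

Let bump1_is_derive (t : R) : is_derive t (1 : R) bump1 (bump2 t).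
Proof.
have D := is_derive1_comp (is_derive_ppow 0 (v t)) (v_is_derive t).
apply: (is_derive_eq (is_derive_mul (is_derive_scal 3 D) (v1_is_derive t))).
by rewrite /bump2 /=; ring.
Qed.

Let cM (f g : R -> R) : continuous f -> continuous g -> continuous (fun t => f t * g t).
Proof. by move=> cf cg t; exact: (continuousM (cf t) (cg t)). Qed.

Let cD (f g : R -> R) : continuous f -> continuous g -> continuous (fun t => f t + g t).
Proof. by move=> cf cg t; exact: (continuousD (cf t) (cg t)). Qed.

Let cC (c : R) : continuous (fun _ : R => c).
Proof. by move=> t; exact: cst_continuous. Qed.

Let cp k (f : R -> R) : continuous f -> continuous (fun t => ppow k (f t)).
Proof. by move=> cf t; apply: continuous_comp; [exact: cf|exact: continuous_ppow]. Qed.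

Let cu1 : continuous (fun t => 2 * w * t).
Proof. exact: is_derive_continuous u1_is_derive. Qed.

Let cu : continuous u.
Proof. exact: is_derive_continuous u_is_derive. Qed.

Let cv : continuous v.
Proof. exact: is_derive_continuous v_is_derive. Qed.

Let cv1 : continuous v1.
Proof. exact: is_derive_continuous v1_is_derive. Qed.

Let cv2 : continuous v2.
Proof.
exact: (cM (@cC (-1)) (cM (@cC 3) (cD (cM (cM (cM (@cC 2) (cp (k := 1) cu)) cu1) cu1)
  (cM (cp (k := 2) cu) (@cC (2 * w)))))).
Qed.

Let bump2_continuous : continuous bump2.
Proof.
exact: (cM (@cC 3) (cD (cM (cM (cM (@cC 2) (cp (k := 1) cv)) cv1) cv1)
  (cM (cp (k := 2) cv) cv2))).
Qed.

Let u_ge1 t : 1 <= `|t| -> 1 <= u t.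
Proof.
move=> t1; rewrite /u /w ler_pdivlMl; last by rewrite -invr_gt0.
by rewrite mulr1 lerB // -[t ^+ 2]real_normK ?num_real // exprn_ege1.
Qed.

Let v_le0 t : 1 <= `|t| -> v t <= 0.
Proof.
by move=> /u_ge1 ut; rewrite /v mulN1r subr_le0 /ppow exprn_ege1 // le_max ut.
Qed.

Let u_le0 t : `|t| <= l -> u t <= 0.
Proof.
move=> tl; rewrite /u pmulr_rle0 // subr_le0 -[t ^+ 2]real_normK ?num_real //.
by rewrite lerXn2r ?nnegrE // ltW.
Qed.

(* The [o]-th derivative of a C^2 cut-off ([b = false]), or of [t] times that
   cut-off ([b = true]). *)
Definition plateau_bump (b : bool) (o : nat) (t : R) : R :=
  match o with
  | 0 => if b then t * bump0 t else bump0 t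
  | 1 => if b then bump0 t + t * bump1 t else bump1 t
  | 2 => if b then 2 * bump1 t + t * bump2 t else bump2 t
  | _ => 0
  end.

Lemma bump_is_derive b o t : (o < 2)%N -> is_derive t (1 : R) (plateau_bump b o) (plateau_bump b o.+1 t).
Proof.
case: o => [_|[_|//]]; case: b => //=.
- apply: (is_derive_eq (is_derive_mul (is_derive_id t (1 : R)) (bump0_is_derive t))).
  by rewrite mul1r.
- have D := is_derive_mul (is_derive_id t (1 : R)) (bump1_is_derive t).
  apply: (is_derive_eq (is_derive_add (bump0_is_derive t) D)).
  by rewrite mul1r addrA -mulr2n mulr_natl.
Qed.

Lemma bump_continuous b o : continuous (plateau_bump b o).
Proof.
case: o => [|[|[|o]]]; last exact: cC.
- exact: (is_derive_continuous (fun t => @bump_is_derive b 0 t isT)).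
- exact: (is_derive_continuous (fun t => @bump_is_derive b 1 t isT)).
- case: b; last exact: bump2_continuous.
  have cid : continuous (fun t : R => t) by move=> t; exact: cvg_id.
  exact: (cD (cM (@cC 2) (is_derive_continuous bump1_is_derive)) (cM cid bump2_continuous)).
Qed.

Lemma bump_off b o t : 1 <= `|t| -> plateau_bump b o t = 0.
Proof.
move=> /v_le0 vt; have b0 : bump0 t = 0 by rewrite /bump0 ppow_le0.
have b1 : bump1 t = 0 by rewrite /bump1 ppow_le0 // mulr0 mul0r.
have b2 : bump2 t = 0 by rewrite /bump2 !ppow_le0 // !(mulr0, mul0r) addr0 mulr0.
by case: o b => [|[|[|o]]] [] //=; rewrite ?b0 ?b1 ?b2 ?mulr0 ?addr0.
Qed.

Let bump0_ge0 t : 0 <= bump0 t.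
Proof. exact: ppow_ge0. Qed.

Let bump0_le1 t : bump0 t <= 1.
Proof.
rewrite /bump0 /ppow exprn_ile1 ?le_max ?lexx ?orbT // ge_max ler01 andbT.
by rewrite /v mulN1r gerBl ppow_ge0.
Qed.

Lemma bump_itv t : 0 <= plateau_bump false 0 t <= 1.
Proof. by rewrite /= bump0_ge0 bump0_le1. Qed.

(* [bump0] decreases in [|t|], so [t * bump1 t <= 0]. *)
Lemma bump_slope_le1 t : plateau_bump true 1 t <= 1.
Proof.
have E : t * bump1 t = - (9 * ppow 2 (v t) * ppow 2 (u t) * (2 * w * t ^+ 2)).
  by rewrite /bump1 /v1; ring.
rewrite /= -[leRHS]addr0 lerD ?bump0_le1 // E oppr_le0.
move: (ppow 2 (v t)) (ppow 2 (u t)) (t ^+ 2) (ppow_ge0 2 (v t)) (ppow_ge0 2 (u t)) (sqr_ge0 t).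
by move=> A B C A0 B0 C0; rewrite !mulr_ge0 // ltW.
Qed.

Lemma bump_plateau t : `|t| <= l -> plateau_bump false 0 t = 1 /\ plateau_bump true 1 t = 1.
Proof.
move=> /u_le0 ut; have vt : v t = 1 by rewrite /v ppow_le0 // mulr0 addr0.
have b0 : bump0 t = 1 by rewrite /bump0 vt /ppow max_l // expr1n.
by rewrite /= b0 /bump1 /v1 (ppow_le0 1 ut) !(mulr0, mul0r) addr0.
Qed.

End PlateauBump.

Section Expand.
Context {R : realType}.
Variable lam : R.

Definition sgp (t : R) : R := if 0 <= t then 1 else -1.

(* The expanding map whose maximal invariant set in [-1, 1] is the Cantor set
   with ratio [lam]. *)
Definition cexpand (t : R) : R := lam^-1 * (t - sgp t / 2).

Hypotheses (lam0 : 0 < lam) (lam2 : lam < 2^-1).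

Lemma norm_sub_sgp t : `|t - sgp t / 2| = `| `|t| - 2^-1|.
Proof.
rewrite /sgp; have [t0|t0] := leP 0 t; first by rewrite (ger0_norm t0) mul1r.
rewrite (ltr0_norm t0) (_ : - t - 2^-1 = - (t - -1 / 2)) ?normrN //; lra.
Qed.

Lemma norm_expand t : `|cexpand t| = lam^-1 * `| `|t| - 2^-1|.
Proof. by rewrite /cexpand normrM norm_sub_sgp ger0_norm // invr_ge0 ltW. Qed.

(** An orbit that has left [(-1, 1)] never returns, because [(|t| - 1/2) / lam > 1] for [|t| >= 1];
    hence the shells are nested. *)
Lemma expand_off t : 1 <= `|t| -> 1 <= `|cexpand t|.
Proof.
have aux (u : R) : 1 <= u -> lam <= u - 2^-1 by move: lam2 => ? ?; lra.
move=> t1; rewrite norm_expand ler_pdivlMl // mulr1.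
exact: le_trans (aux _ t1) (ler_norm _).
Qed.

Lemma expand_mid t : `|t| <= 2^-1 - lam -> 1 <= `|cexpand t|.
Proof.
have aux (u : R) : u <= 2^-1 - lam -> lam <= 2^-1 - u by move: lam2 => ? ?; lra.
move=> t1; rewrite norm_expand ler_pdivlMl // mulr1 distrC.
exact: le_trans (aux _ t1) (ler_norm _).
Qed.

Lemma near_sgp (t : R) : t != 0 -> \forall s \near t, sgp s = sgp t.
Proof.
move=> t0; have [tn|tp] : t < 0 \/ 0 < t by apply/orP; rewrite -neq_lt.
  near=> s; rewrite /sgp !leNgt tn; have -> // : s < 0.
  by near: s; exact: lt_nbhsl.
near=> s; rewrite /sgp (ltW tp) ifT //; apply: ltW; near: s; exact: lt_nbhsr.
Unshelve. all: by end_near. Qed.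

Lemma near_expand_mid : \forall s \near (0 : R), 1 <= `|cexpand s|.
Proof.
have e0 : 0 < 2^-1 - lam by rewrite subr_gt0.
by apply: filterS (@nbhs0_le R R _ e0) => s; exact: expand_mid.
Qed.

(** The jump of [cexpand lam] at 0 is invisible to [g]: points near 0 are sent outside [(-1, 1)],
    where [g] vanishes. Away from 0 the sign is locally constant and [cexpand lam] is affine of
    slope [1 / lam]. *)
Lemma is_derive_comp_expand (g dg : R -> R) :
  (forall t, is_derive t (1 : R) g (dg t)) ->
  (forall t, 1 <= `|t| -> g t = 0) -> (forall t, 1 <= `|t| -> dg t = 0) ->
  forall t, is_derive t (1 : R) (fun t => g (cexpand t)) (lam^-1 * dg (cexpand t)).
Proof.
move=> gdg g0 dg0 t; have [->|t0] := eqVneq t 0.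
  rewrite dg0 ?mulr0; last by apply: nbhs_singleton near_expand_mid.
  apply: (@near_eq_is_derive _ _ _ (cst 0)).
  by near=> s; rewrite /= g0 //; near: s; exact: near_expand_mid.
apply: (@near_eq_is_derive _ _ _ (fun s => g (lam^-1 * (s + - (sgp t / 2))))).
  by near=> s; rewrite /cexpand; congr (g (_ * (_ - _ / _))); apply/esym; near: s; exact: near_sgp.
have D : is_derive t (1 : R) (fun s : R => lam^-1 * (s + - (sgp t / 2))) lam^-1.
  apply: (is_derive_eq (is_derive_scal lam^-1 (is_derive_add (is_derive_id t (1 : R))
    (is_derive_const (- (sgp t / 2)) t)))).
  by rewrite addr0 mulr1.
pose e (s : R) := lam^-1 * (s + - (sgp t / 2)).
have E := @is_derive1_comp R g e t (dg (e t)) _ (gdg (e t)) D.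
exact: (is_derive_eq E (mulrC _ _)).
Unshelve. all: by end_near. Qed.

Lemma continuous_comp_expand (g : R -> R) : continuous g ->
  (forall t, 1 <= `|t| -> g t = 0) -> continuous (fun t => g (cexpand t)).
Proof.
move=> cg g0 t; have [->|t0] := eqVneq t 0.
  apply: (@cvg_trans _ (cst (g (cexpand 0)) @ nbhs (0 : R))); last exact: cvg_cst.
  have h0 := nbhs_singleton near_expand_mid.
  by apply: near_eq_cvg; near=> s; rewrite /= (g0 _ h0) g0 //; near: s; exact: near_expand_mid.
pose e s := lam^-1 * (s + - (sgp t / 2)).
apply: (@cvg_trans _ ((g \o e) @ nbhs t)).
  apply: near_eq_cvg; near=> s; rewrite /= /e /cexpand; congr (g (_ * (_ - _ / _))).
  by apply/esym; near: s; exact: near_sgp.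
have De (s : R) : is_derive s (1 : R) e (lam^-1 * (1 + 0)).
  exact: (is_derive_scal lam^-1 (is_derive_add (is_derive_id s (1 : R))
    (is_derive_const (- (sgp t / 2)) s))).
have ce : continuous e := is_derive_continuous De.
exact: (@continuous_comp _ _ _ e g t (ce t) (cg (e t))).
Unshelve. all: by end_near. Qed.

(** The induction varies [g]: by [expand_off], the composite of [g] with [cexpand lam] satisfies the
    same vanishing hypotheses. *)
Lemma is_derive_comp_iter_expand k (g dg : R -> R) :
  (forall t, is_derive t (1 : R) g (dg t)) ->
  (forall t, 1 <= `|t| -> g t = 0) -> (forall t, 1 <= `|t| -> dg t = 0) ->
  forall t, is_derive t (1 : R) (fun t => g (iter k cexpand t))
     (lam^-1 ^+ k * dg (iter k cexpand t)).
Proof.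
elim: k g dg => [|k IH] g dg gdg g0 dg0 t.
  by rewrite expr0 mul1r; exact: gdg.
have dg0' s : 1 <= `|s| -> lam^-1 * dg (cexpand s) = 0.
  by move=> hs; rewrite (dg0 _ (expand_off hs)) mulr0.
have := IH _ _ (is_derive_comp_expand gdg g0 dg0)
  (fun t ht => g0 _ (expand_off ht)) dg0' t.
by rewrite exprSr -mulrA.
Qed.

Lemma continuous_comp_iter_expand k (g : R -> R) : continuous g ->
  (forall t, 1 <= `|t| -> g t = 0) -> continuous (fun t => g (iter k cexpand t)).
Proof.
elim: k g => [//|k IH] g cg g0.
apply: (IH (fun t => g (cexpand t))); first exact: continuous_comp_expand.
by move=> t /expand_off; exact: g0.
Qed.

End Expand.

(** * Uniform limits of differentiable functions *)

Section UniformLimit.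
Context {R : realType} {n : nat}.
Local Notation V := 'rV[R]_n.+1.

Lemma diff_sum_coord (f : V -> R) (x h : V) : differentiable f x ->
  'd f x h = \sum_j h 0 j * 'D_(ebasis j) f x.
Proof.
move=> df; rewrite [in LHS](row_sum_delta h) linear_sum /=.
by apply: eq_bigr => j _; rewrite linearZ /= deriveE.
Qed.

Lemma norm_diff_le (f : V -> R) (x h : V) (c : R) : differentiable f x ->
  (forall j, `|'D_(ebasis j) f x| <= c) -> `|'d f x h| <= n.+1%:R * c * `|h|.
Proof.
move=> df fc; rewrite diff_sum_coord // (le_trans (ler_norm_sum _ _ _)) //.
have -> : n.+1%:R * c * `|h| = \sum_(j < n.+1) c * `|h|.
  by rewrite sumr_const card_ord -mulrA mulr_natl.
apply: ler_sum => j _; rewrite normrM mulrC ler_pM //.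
exact: coord_le_norm.
Qed.

Lemma mean_value_bound (f : V -> R) (x h : V) (c : R) :
  (forall y, differentiable f y) ->
  (forall y j, `|'D_(ebasis j) f y| <= c) ->
  `|f (x + h) - f x| <= n.+1%:R * c * `|h|.
Proof.
move=> df fc.
have D (s : R) : is_derive s (1 : R) (fun s : R => f (x + s *: h)) ('d f (x + s *: h) h).
  apply: is_derive_line; apply: DeriveDef; first exact: diff_derivable.
  by rewrite deriveE.
have cl : {within `[0, 1], continuous (fun s : R => f (x + s *: h))}.
  apply: continuous_subspaceT => s; apply: differentiable_continuous.
  by apply/derivable1_diffP; case: (D s).
have [t _] := @MVT_segment R _ _ 0 1 ler01 (fun s _ => D s) cl.
by rewrite scale1r scale0r addr0 subr0 mulr1 => ->; exact: norm_diff_le.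
Qed.

Lemma differentiable_of_littleo (f : V -> R) (x : V) (D : 'I_n.+1 -> R) :
  (forall e, 0 < e -> \forall h \near (0 : V),
     `|f (h + x) - f x - \sum_j h 0 j * D j| <= e * `|h|) ->
  differentiable f x /\ forall j, 'D_(ebasis j) f x = D j.
Proof.
move=> fo.
have @L : {linear V -> R}.
  exists (fun h : V => \sum_j h 0 j * D j).
  do 2![eexists]; do ?[constructor] => //=.
  - by rewrite big1 // => j _; rewrite mxE mul0r.
  - move=> u v /=; rewrite -big_split /=.
    by apply: eq_bigr => j _; rewrite mxE mulrDl.
  - move=> a u /=; rewrite /GRing.scale /= mulr_sumr.
    by apply: eq_bigr => j _; rewrite mxE mulrA.
have LE h : L h = \sum_j h 0 j * D j by [].
have cL : continuous L.
  move=> y; rewrite (_ : (L : V -> R) = \sum_(j < n.+1) (fun h : V => h 0 j * D j)); last first.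
    by apply/funext => h; rewrite LE fct_sumE.
  apply: differentiable_continuous; apply: differentiable_sum => j.
  have -> : (fun h : V => h 0 j * D j) = (D j) *: (fun h : V => h 0 j).
    by apply/funext => h; rewrite mulrC.
  by apply: differentiableZ; exact: differentiable_coord.
have H : f \o shift x = cst (f x) + L +o_ (0 : V) id.
  apply/eqaddoP => e e0; have := fo e e0; apply: filterS => h.
  rewrite -LE; suff -> : (f \o shift x - (cst (f x) + L)) h = f (h + x) - f x - L h by [].
  by rewrite -[LHS]/(f (h + x) - (f x + L h)) opprD addrA.
have dfL := diff_unique cL H.
have df : differentiable f x by apply/diff_locallyP; rewrite dfL.
split=> // j; rewrite deriveE // dfL LE (bigD1 j) //= big1 => [|i ij].
  by rewrite addr0 mxE !eqxx mul1r.
by rewrite mxE eqxx /= (negbTE ij) mul0r.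
Qed.

(** The mean value bound for [F N - F M], uniform in [N], passes to the limit and controls the
    increment of [f - F M]. The remainder of [f] at [x] then splits into the remainder of [F M],
    that increment, and the error of the differential, each at most a third of [e * |h|]. *)
Lemma differentiable_uniform_limit (F : nat -> V -> R) (f : V -> R)
    (D : 'I_n.+1 -> V -> R) (eps : nat -> R) :
  (forall N x, differentiable (F N) x) ->
  (forall M N x j, (M <= N)%N ->
     `|'D_(ebasis j) (F N) x - 'D_(ebasis j) (F M) x| <= eps M) ->
  eps @ \oo --> 0 ->
  (forall x, F N x @[N --> \oo] --> f x) ->
  (forall x j, 'D_(ebasis j) (F N) x @[N --> \oo] --> D j x) ->
  forall x, differentiable f x /\ forall j, 'D_(ebasis j) f x = D j x.
Proof.
move=> dF Feps eps0 Ff FD x; apply: differentiable_of_littleo => e e0.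
have DF M N y j : 'D_(ebasis j) (F N - F M) y = 'D_(ebasis j) (F N) y - 'D_(ebasis j) (F M) y.
  by rewrite deriveB //; exact: diff_derivable.
have Fle M h : `|(f (h + x) - F M (h + x)) - (f x - F M x)| <= n.+1%:R * eps M * `|h|.
  have cv : (fun N => `|(F N (h + x) - F M (h + x)) - (F N x - F M x)|) @ \oo -->
      `|(f (h + x) - F M (h + x)) - (f x - F M x)|.
    by apply: cvg_norm; apply: cvgB; apply: cvgB; [exact: Ff|exact: cvg_cst|exact: Ff|exact: cvg_cst].
  rewrite -(cvg_lim _ cv) //; apply: limr_le; first exact: (cvgP _ cv).
  near=> N; rewrite [h + x]addrC.
  apply: (@mean_value_bound (F N - F M)) => [y|y j]; first exact: differentiableB.
  by rewrite DF; apply: Feps; near: N; exact: nbhs_infty_ge.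
have Dle M j : `|'D_(ebasis j) (F M) x - D j x| <= eps M.
  have cv : (fun N => `|'D_(ebasis j) (F N) x - 'D_(ebasis j) (F M) x|) @ \oo -->
      `|D j x - 'D_(ebasis j) (F M) x|.
    by apply: cvg_norm; apply: cvgB; [exact: FD|exact: cvg_cst].
  rewrite distrC -(cvg_lim _ cv) //; apply: limr_le; first exact: (cvgP _ cv).
  by near=> N; apply: Feps; near: N; exact: nbhs_infty_ge.
have dle M h : `|'d (F M) x h - \sum_j h 0 j * D j x| <= n.+1%:R * eps M * `|h|.
  rewrite diff_sum_coord // -sumrB (le_trans (ler_norm_sum _ _ _)) //.
  have -> : n.+1%:R * eps M * `|h| = \sum_(j < n.+1) eps M * `|h|.
    by rewrite sumr_const card_ord -mulrA mulr_natl.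
  apply: ler_sum => j _; rewrite -mulrBr normrM mulrC ler_pM //.
  exact: coord_le_norm.
have [M Me] : exists M, n.+1%:R * eps M <= e / 3.
  have e30 : 0 < e / 3 / n.+1%:R by rewrite !divr_gt0.
  have /cvgr0Pnorm_le /(_ _ e30) [M _ MP] := eps0; exists M.
  have := MP M (leqnn M); rewrite /= ler_pdivlMr // mulrC; apply: le_trans.
  by rewrite ler_pM2l // ler_norm.
have := dF M x => /diff_locallyP [_] /eqaddoP /(_ (e / 3)) /=.
rewrite divr_gt0 // => /(_ isT); apply: filterS => h /= hM.
have -> : f (h + x) - f x - \sum_j h 0 j * D j x =
  (F M (h + x) - (F M x + 'd (F M) x h)) +
  ((f (h + x) - F M (h + x)) - (f x - F M x)) +
  ('d (F M) x h - \sum_j h 0 j * D j x) by ring.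
have -> : e * `|h| = e / 3 * `|h| + e / 3 * `|h| + e / 3 * `|h| by field.
apply: le_trans (ler_normD _ _) _; apply: lerD.
  apply: le_trans (ler_normD _ _) _; apply: lerD => //.
  by apply: le_trans (Fle M h) _; rewrite ler_wpM2r.
by apply: le_trans (dle M h) _; rewrite ler_wpM2r.
Unshelve. all: by end_near. Qed.

End UniformLimit.

(** * The perturbation and its derivatives *)

Lemma is_derive_of_line (R : realType) (V W : normedModType R) (f : V -> W) (a v : V)
    (df : W) :
  is_derive (0 : R) (1 : R) (fun s : R => f (a + s *: v)) df -> is_derive a v f df.
Proof.
have E : (fun h : R => h^-1 *: (((fun s : R => f (a + s *: v)) \o shift 0) (h *: (1 : R))
    - (fun s : R => f (a + s *: v)) 0)) =
  (fun h : R => h^-1 *: ((f \o shift a) (h *: v) - f a)).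
  apply/funext => h /=; rewrite scale0r addr0 [h *: (1 : R)]mulr1 addr0.
  by rewrite [a + _]addrC.
by case=> d dE; apply: DeriveDef; move: d dE; rewrite /derivable /derive /= E.
Qed.

Lemma cvg_of_geometric_bound (R : realType) (a : nat -> R) (C r : R) :
  0 <= r -> r < 1 ->
  (forall M N, (M <= N)%N -> `|a N - a M| <= C * r ^+ M) -> cvgn a.
Proof.
move=> r0 r1 aC; apply/cauchy_cvgP; apply: cauchy_exP => e e0.
have : (fun M => C * r ^+ M) @ \oo --> C * 0.
  by apply: cvgMr; apply: cvg_expr; rewrite ger0_norm.
rewrite mulr0 => /cvgr0Pnorm_lt /(_ e e0) [M _ MP].
exists (a M); exists M => // N MN; rewrite /= /ball /= distrC.
exact: le_lt_trans (aC _ _ MN) (le_lt_trans (ler_norm _) (MP M (leqnn M))).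
Qed.

Lemma continuous_bounded_off (R : realType) (g : R -> R) : continuous g ->
  (forall t, 1 <= `|t| -> g t = 0) -> exists C : R, forall t, `|g t| <= C.
Proof.
move=> cg g0; have : compact (g @` `[-1, 1]).
  by apply: continuous_compact; [exact: continuous_subspaceT|exact: segment_compact].
move=> /compact_bounded [C [_ CP]]; exists (Num.max 0 (C + 1)) => t.
have [t1|/ltW t1] := leP 1 `|t|; first by rewrite g0 // normr0 le_max lexx.
rewrite le_max; apply/orP; right; apply: (CP (C + 1)); first by rewrite ltrDl.
by exists t => //; rewrite /= in_itv /= -ler_norml.
Qed.

Section Tensor.
Context {R : realType} {n : nat}.
Local Notation V := 'rV[R]_n.+1.
Variable lam : R.
Hypotheses (lam0 : 0 < lam) (lam2 : lam < 2^-1).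

(* The Cantor set lies in [[- plateau, plateau]]: [plateau] is the sum of the
   series of the [lam ^ k / 2]. *)
Definition plateau : R := (2 * (1 - lam))^-1.
Definition prof : bool -> nat -> R -> R := plateau_bump plateau.
Definition orbit_coord (k : nat) (t : R) : R := iter k (cexpand lam) t.

Lemma plateau0 : 0 < plateau.
Proof. by rewrite invr_gt0 mulr_gt0 // subr_gt0; move: lam2 => ?; lra. Qed.

Lemma plateau1 : plateau < 1.
Proof.
have h : 1 < 2 * (1 - lam) by move: lam2 => ?; lra.
by rewrite /plateau invf_lt1 // (lt_trans ltr01).
Qed.

(* [al] is the multi-index of derivatives, up to the factor [lam ^ (- k |al|)]. *)
Definition tensor (k : nat) (al : 'I_n.+1 -> nat) (x : V) : R :=
  \prod_i prof (i == ord0) (al i) (orbit_coord k (x 0 i)).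

(** Testing the [k]-th iterate alone suffices: by [expand_off] it forces all earlier iterates to lie
    in [(-1, 1)] too. *)
Definition shell (k : nat) : set V := [set x | forall i, `|orbit_coord k (x 0 i)| < 1].

Lemma shellS k : shell k.+1 `<=` shell k.
Proof.
move=> x xk i; rewrite ltNge; apply/negP => h.
by have := xk i; rewrite ltNge /orbit_coord iterS expand_off.
Qed.

Lemma shell_le j k : (j <= k)%N -> shell k `<=` shell j.
Proof.
by move=> jk; rewrite -(subnKC jk); elim: (k - j)%N => [|m IH]; rewrite ?addn0 // addnS => x /shellS /IH.
Qed.

Lemma tensor_off k al x : ~ shell k x -> tensor k al x = 0.
Proof.
move=> /existsNP [i /negP]; rewrite -leNgt => xi.
by rewrite /tensor (bigD1 i) //= /prof bump_off ?mul0r ?plateau0 ?plateau1.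
Qed.

Lemma tensor_bounded : exists C : R, forall k al x, `|tensor k al x| <= C.
Proof.
have [c cP] : exists c : bool -> nat -> R, forall b o t, `|prof b o t| <= c b o.
  have H b o : exists C : R, forall t, `|prof b o t| <= C.
    apply: continuous_bounded_off; first exact: bump_continuous.
    exact: (bump_off plateau0 plateau1).
  have /choice[c cP] (p : bool * nat) := H p.1 p.2.
  by exists (fun b o => c (b, o)) => b o; exact: (cP (b, o)).
(* The sum of the six suprema dominates each of them. *)
pose C := \sum_(b : bool) \sum_(o < 3) c b o.
have c0 b o : 0 <= c b o by exact: le_trans (cP b o 0).
have bC b o t : `|prof b o t| <= C.
  have C0 b' : 0 <= \sum_(o < 3) c b' o by apply: sumr_ge0.
  (* Orders from 3 on give the function 0 by the convention in [plateau_bump], so one bound serves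
     all multi-indices. *)
  have [lt3|ge3] := ltnP o 3; last first.
    by rewrite /prof; case: o ge3 => [|[|[|o]]] //= _; rewrite normr0; exact: sumr_ge0.
  apply: le_trans (cP b o t) _; rewrite /C (bigD1 b) //= (bigD1 (Ordinal lt3)) //=.
  by rewrite -addrA lerDl addr_ge0 // ?sumr_ge0.
exists (C ^+ n.+1) => k al x; rewrite /tensor normr_prod.
have -> : C ^+ n.+1 = \prod_(i < n.+1) C by rewrite prodr_const card_ord.
by apply: ler_prod => i _; rewrite normr_ge0 bC.
Qed.

Lemma factor_continuous k b o : continuous (fun t => prof b o (orbit_coord k t)).
Proof.
apply: (continuous_comp_iter_expand lam0 lam2) => //.
  exact: bump_continuous.
exact: (bump_off plateau0 plateau1).
Qed.

Lemma factor_is_derive k b o t : (o < 2)%N ->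
  is_derive t (1 : R) (fun t => prof b o (orbit_coord k t))
    (lam^-1 ^+ k * prof b o.+1 (orbit_coord k t)).
Proof.
move=> o2; apply: (is_derive_comp_iter_expand lam0 lam2) => s.
- exact: bump_is_derive.
- exact: (bump_off plateau0 plateau1).
- exact: (bump_off plateau0 plateau1).
Qed.

Lemma tensor_continuous k al : continuous (tensor k al).
Proof.
pose F i (x : V) := prof (i == ord0) (al i) (orbit_coord k (x 0 i)).
have cF i : continuous (F i).
  move=> x; apply: (@continuous_comp _ _ _ (fun x : V => x 0 i)
    (fun t => prof (i == ord0) (al i) (orbit_coord k t))).
    exact: coord_continuous.
  exact: factor_continuous.
suff H r : continuous (fun x => \prod_(i <- r) F i x) by exact: H.
elim: r => [|i r IH] x.
  rewrite (_ : (fun x : V => \prod_(i <- [::]) F i x) = cst 1); first exact: cst_continuous.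
  by apply/funext => y; rewrite big_nil.
rewrite (_ : (fun x : V => \prod_(j <- i :: r) F j x) =
    (fun x => F i x * \prod_(j <- r) F j x)).
  exact: (@continuousM R V (F i) _ x (cF i x) (IH x)).
by apply/funext => y; rewrite big_cons.
Qed.

Lemma tensor_differentiable k al x : (forall i, (al i < 2)%N) ->
  differentiable (tensor k al) x.
Proof.
move=> al2; pose F i (x : V) := prof (i == ord0) (al i) (orbit_coord k (x 0 i)).
have dF i : differentiable (F i) x.
  apply: (@differentiable_comp _ _ _ _ (fun x : V => x 0 i)
    (fun t => prof (i == ord0) (al i) (orbit_coord k t))).
    exact: differentiable_coord.
  by apply/derivable1_diffP; case: (@factor_is_derive k (i == ord0) (al i) (x 0 i) (al2 i)).
suff H r : differentiable (fun x => \prod_(i <- r) F i x) x by exact: H.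
elim: r => [|i r IH].
  rewrite (_ : (fun x : V => \prod_(i <- [::]) F i x) = cst 1); first exact: differentiable_cst.
  by apply/funext => y; rewrite big_nil.
rewrite (_ : (fun x : V => \prod_(j <- i :: r) F j x) =
    F i * (fun x => \prod_(j <- r) F j x)).
  exact: differentiableM.
by apply/funext => y; rewrite big_cons.
Qed.

Definition incr (al : 'I_n.+1 -> nat) (j : 'I_n.+1) : 'I_n.+1 -> nat :=
  fun i => (al i + (i == j))%N.

Lemma tensor_is_derive k al j x : (al j < 2)%N ->
  is_derive x (ebasis j) (tensor k al) (lam^-1 ^+ k * tensor k (incr al j) x).
Proof.
move=> al2; apply: is_derive_of_line.
pose c := \prod_(i | i != j) prof (i == ord0) (al i) (orbit_coord k (x 0 i)).
have -> : (fun s : R => tensor k al (x + s *: ebasis j)) =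
  (fun s : R => c * prof (j == ord0) (al j) (orbit_coord k (x 0 j + s))).
  apply/funext => s; rewrite /tensor (bigD1 j) //= mulrC; congr (_ * _).
    apply: eq_bigr => i ij; congr (prof _ _ (orbit_coord _ _)).
    by rewrite !mxE eqxx (negbTE ij) /= mulr0 addr0.
  by congr (prof _ _ (orbit_coord _ _)); rewrite !mxE !eqxx mulr1.
have -> : lam^-1 ^+ k * tensor k (incr al j) x =
  c * (lam^-1 ^+ k * prof (j == ord0) (al j).+1 (orbit_coord k (x 0 j + 0)) * 1).
  rewrite addr0 mulr1.
  have -> : tensor k (incr al j) x = prof (j == ord0) (al j).+1 (orbit_coord k (x 0 j)) * c.
    rewrite /tensor (bigD1 j) // /incr eqxx addn1; congr (_ * _).
    by apply: eq_bigr => i ij; rewrite (negbTE ij) addn0.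
  by rewrite mulrA mulrC.
apply: is_derive_scal.
have D : is_derive (0 : R) (1 : R) (fun s : R => x 0 j + s) 1.
  apply: (is_derive_eq (is_derive_add (is_derive_const (x 0 j) 0) (is_derive_id 0 (1 : R)))).
  by rewrite add0r.
exact: (@is_derive1_comp R (fun t => prof (j == ord0) (al j) (orbit_coord k t))
  (fun s : R => x 0 j + s) 0 _ 1 (factor_is_derive _ _ _ al2) D).
Qed.

End Tensor.

Lemma is_derive_lincomb (R : realType) (V : normedModType R) (a : nat -> R)
    (T dT : nat -> V -> R) (x v : V) (N : nat) :
  (forall k, is_derive x v (T k) (dT k x)) ->
  is_derive x v (fun y => \sum_(k < N) a k * T k y) (\sum_(k < N) a k * dT k x).
Proof.
move=> TdT; elim: N => [|N IH].
  rewrite big_ord0 (_ : (fun y => _) = cst 0); first exact: is_derive_cst.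
  by apply/funext => y; rewrite big_ord0.
rewrite big_ord_recr /= (_ : (fun y => _) =
    (fun y => \sum_(k < N) a k * T k y) + (a N *: T N)).
  exact: (is_deriveD IH (is_deriveZ (a N) (TdT N))).
by apply/funext => y; rewrite big_ord_recr.
Qed.

Lemma differentiable_lincomb (R : realType) (V : normedModType R) (a : nat -> R)
    (T : nat -> V -> R) (x : V) (N : nat) :
  (forall k, differentiable (T k) x) ->
  differentiable (fun y => \sum_(k < N) a k * T k y) x.
Proof.
move=> dT; elim: N => [|N IH].
  rewrite (_ : (fun y => _) = cst 0); first exact: differentiable_cst.
  by apply/funext => y; rewrite big_ord0.
rewrite (_ : (fun y => _) = (fun y => \sum_(k < N) a k * T k y) + (a N *: T N)).
  exact: (differentiableD IH (differentiableZ (a N) (dT N))).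
by apply/funext => y; rewrite big_ord_recr.
Qed.

Lemma continuous_lincomb (R : realType) (T : topologicalType) (a : nat -> R)
    (F : nat -> T -> R) (N : nat) :
  (forall k, continuous (F k)) -> continuous (fun y => \sum_(k < N) a k * F k y).
Proof.
move=> cF; elim: N => [|N IH] x.
  rewrite (_ : (fun y => _) = cst 0); first exact: cst_continuous.
  by apply/funext => y; rewrite big_ord0.
rewrite (_ : (fun y => _) = (fun y => \sum_(k < N) a k * F k y) + (cst (a N) \* F N)).
  by apply: continuousD; [exact: IH|apply: continuousM; [exact: cst_continuous|exact: cF]].
by apply/funext => y; rewrite big_ord_recr.
Qed.

Lemma lincomb_tail (R : realType) (a T : nat -> R) (C : R) (b : nat -> R) (M N : nat) :
  (M <= N)%N -> (forall k, `|T k| <= C) -> (forall k, `|a k| <= b k) ->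
  `|\sum_(k < N) a k * T k - \sum_(k < M) a k * T k| <= C * \sum_(M <= k < N) b k.
Proof.
move=> MN TC ab.
have -> : \sum_(k < N) a k * T k - \sum_(k < M) a k * T k = \sum_(M <= k < N) a k * T k.
  by rewrite -!(big_mkord xpredT (fun k => a k * T k)) (big_cat_nat (leq0n M) MN) /= addrAC subrr add0r.
rewrite (le_trans (ler_norm_sum _ _ _)) // mulr_sumr ler_sum // => k _.
by rewrite normrM mulrC ler_pM.
Qed.

Lemma uniform_limit_continuous_norm (R : realType) (T : topologicalType)
    (F : nat -> T -> R) (f : T -> R) (eps : nat -> R) :
  (forall N, continuous (F N)) -> (forall N x, `|f x - F N x| <= eps N) ->
  eps @ \oo --> 0 -> continuous f.
Proof.
move=> cF fF eps0 x; apply/cvgrPdist_le => e e0.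
have e3 : 0 < e / 3 by rewrite divr_gt0.
have /cvgr0Pnorm_le /(_ _ e3) [M _ MP] := eps0.
have Me : eps M <= e / 3 by apply: le_trans (ler_norm _) (MP M (leqnn M)).
have := cF M x; move/cvgrPdist_le => /(_ _ e3); apply: filterS => y xy.
have -> : f x - f y = (f x - F M x) + (F M x - F M y) + (F M y - f y) by ring.
have -> : e = e / 3 + e / 3 + e / 3 by field.
apply: le_trans (ler_normD _ _) _; apply: lerD; last first.
  by rewrite distrC; exact: le_trans (fF _ _) Me.
by apply: le_trans (ler_normD _ _) _; apply: lerD => //; exact: le_trans (fF _ _) Me.
Qed.

Section Series.
Context {R : realType} {n : nat}.
Local Notation V := 'rV[R]_n.+1.
Variables lam kap : R.
Hypotheses (lam0 : 0 < lam) (lam2 : lam < 2^-1) (kap0 : 0 < kap) (kap1 : kap < 1).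

Let al0 : 'I_n.+1 -> nat := fun=> 0%N.

(* The factor [lam ^ k] in [psum] absorbs the [k]-fold expansion, so that
   the first derivatives have weights [coef k], which sum to 1. *)
Definition coef (k : nat) : R := kap ^+ k * (1 - kap).

Definition psum (N : nat) (x : V) : R :=
  \sum_(k < N) (coef k * lam ^+ k) * tensor lam k al0 x.
Definition psum1 (N : nat) (j : 'I_n.+1) (x : V) : R :=
  \sum_(k < N) coef k * tensor lam k (incr al0 j) x.
Definition psum2 (N : nat) (j m : 'I_n.+1) (x : V) : R :=
  \sum_(k < N) (coef k * lam^-1 ^+ k) * tensor lam k (incr (incr al0 j) m) x.

Lemma coef_ge0 k : 0 <= coef k.
Proof. by rewrite mulr_ge0 ?exprn_ge0 ?subr_ge0 ?ltW. Qed.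

Lemma sum_coef M N : (M <= N)%N -> \sum_(M <= k < N) coef k = kap ^+ M - kap ^+ N.
Proof.
move=> MN; rewrite (eq_bigr (fun k => - (kap ^+ k.+1 - kap ^+ k))).
  by rewrite sumrN telescope_sumr // opprB.
by move=> k _; rewrite /coef exprS; ring.
Qed.

Lemma sum_coef_le M N : (M <= N)%N -> \sum_(M <= k < N) coef k <= kap ^+ M.
Proof. by move=> MN; rewrite sum_coef // gerBl exprn_ge0 // ltW. Qed.

Lemma psum_differentiable N x : differentiable (psum N) x.
Proof.
apply: (@differentiable_lincomb _ _ (fun k => coef k * lam ^+ k)
  (fun k => tensor lam k al0)) => k.
exact: tensor_differentiable.
Qed.

Lemma psum_is_derive N j x : is_derive x (ebasis j) (psum N) (psum1 N j x).
Proof.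
have D := @is_derive_lincomb R V (fun k => coef k * lam ^+ k) (fun k => tensor lam k al0)
  (fun k x => lam^-1 ^+ k * tensor lam k (incr al0 j) x) x (ebasis j) N
  (fun k => tensor_is_derive lam0 lam2 k x (isT : (al0 j < 2)%N)).
apply: (is_derive_eq D); apply: eq_bigr => k _.
rewrite mulrA -[coef k * _ * _]mulrA -exprMn mulfV ?gt_eqF // expr1n mulr1.
by [].
Qed.

Lemma psum1_is_derive N j m x : is_derive x (ebasis m) (psum1 N j) (psum2 N j m x).
Proof.
have jm : (incr al0 j m < 2)%N by rewrite /incr /al0; case: (m == j).
have D := @is_derive_lincomb R V coef (fun k => tensor lam k (incr al0 j))
  (fun k x => lam^-1 ^+ k * tensor lam k (incr (incr al0 j) m) x) x (ebasis m) N
  (fun k => tensor_is_derive lam0 lam2 k x jm).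
by apply: (is_derive_eq D); apply: eq_bigr => k _; rewrite mulrA.
Qed.

Lemma psum1_continuous N j : continuous (psum1 N j).
Proof.
by apply: (@continuous_lincomb _ _ coef (fun k => tensor lam k (incr al0 j))) => k;
  exact: tensor_continuous.
Qed.

Lemma psum2_continuous N j m : continuous (psum2 N j m).
Proof.
by apply: (@continuous_lincomb _ _ (fun k => coef k * lam^-1 ^+ k)
  (fun k => tensor lam k (incr (incr al0 j) m))) => k; exact: tensor_continuous.
Qed.

Lemma psum_psum1_tail : exists C : R, 0 <= C /\ forall M N x, (M <= N)%N ->
  `|psum N x - psum M x| <= C * kap ^+ M /\
  forall j, `|psum1 N j x - psum1 M j x| <= C * kap ^+ M.
Proof.
have [C CP] := @tensor_bounded R n lam lam2.
have C0 : 0 <= C by apply: le_trans (CP 0%N al0 0).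
exists C; split => // M N x MN; split.
  have ab k : `|coef k * lam ^+ k| <= coef k.
    have l0 : 0 <= lam ^+ k by rewrite exprn_ge0 // ltW.
    have l1 : lam <= 1 by move: lam2 => ?; lra.
    rewrite ger0_norm; last exact: mulr_ge0 (coef_ge0 k) l0.
    by rewrite ler_piMr ?coef_ge0 // exprn_ile1 // ltW.
  apply: le_trans (@lincomb_tail R _ (fun k => tensor lam k al0 x) C coef M N MN
    (fun k => CP k al0 x) ab) _.
  by rewrite ler_wpM2l // sum_coef_le.
move=> j; have ab k : `|coef k| <= coef k by rewrite ger0_norm ?coef_ge0.
apply: le_trans (@lincomb_tail R _ (fun k => tensor lam k (incr al0 j) x) C coef M N MN
  (fun k => CP k (incr al0 j) x) ab) _.
by rewrite ler_wpM2l // sum_coef_le.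
Qed.

Definition pert (x : V) : R := limn (fun N => psum N x).
Definition pert1 (j : 'I_n.+1) (x : V) : R := limn (fun N => psum1 N j x).

Lemma cvg_psum x : psum N x @[N --> \oo] --> pert x.
Proof.
have [C [_ CP]] := psum_psum1_tail.
by apply: (@cvg_of_geometric_bound R _ C kap (ltW kap0) kap1) => M N /CP => /(_ x) [].
Qed.

Lemma cvg_psum1 j x : psum1 N j x @[N --> \oo] --> pert1 j x.
Proof.
have [C [_ CP]] := psum_psum1_tail.
by apply: (@cvg_of_geometric_bound R _ C kap (ltW kap0) kap1) => M N /CP => /(_ x) [].
Qed.

Let cvg_geo C : C * kap ^+ N @[N --> \oo] --> (0 : R).
Proof.
rewrite -[X in _ --> X](mulr0 C).
by apply: cvgMr; apply: cvg_expr; rewrite ger0_norm // ltW.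
Qed.

Lemma pert_differentiable x :
  differentiable pert x /\ forall j, 'D_(ebasis j) pert x = pert1 j x.
Proof.
have [C [_ CP]] := psum_psum1_tail.
have E N j y : 'D_(ebasis j) (psum N) y = psum1 N j y by case: (psum_is_derive N j y).
apply: (@differentiable_uniform_limit R n psum pert pert1 (fun M => C * kap ^+ M)) => //.
- exact: psum_differentiable.
- by move=> M N y j MN; rewrite !E; case: (CP M N y MN).
- exact: cvg_psum.
- move=> y j; rewrite (_ : (fun N => _) = (fun N => psum1 N j y)); first exact: cvg_psum1.
  by apply/funext => N; rewrite E.
Qed.

Lemma pert1_dist : exists C : R, 0 <= C /\ forall N j x, `|pert1 j x - psum1 N j x| <= C * kap ^+ N.
Proof.
have [C [C0 CP]] := psum_psum1_tail; exists C; split => // N j x.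
have cv : (fun M => `|psum1 M j x - psum1 N j x|) @ \oo --> `|pert1 j x - psum1 N j x|.
  by apply: cvg_norm; apply: cvgB; [exact: cvg_psum1|exact: cvg_cst].
rewrite -(cvg_lim _ cv) //; apply: limr_le; first exact: (cvgP _ cv).
near=> M; have MN : (N <= M)%N by near: M; exact: nbhs_infty_ge.
by case: (CP N M x MN).
Unshelve. all: by end_near. Qed.

Lemma pert1_continuous j : continuous (pert1 j).
Proof.
have [C [C0 CP]] := pert1_dist.
apply: (@uniform_limit_continuous_norm R V (fun N => psum1 N j) _ (fun N => C * kap ^+ N)) => //.
by move=> N; exact: psum1_continuous.
Qed.

Lemma pert_off x : ~ cube R n.+1 x -> pert x = 0.
Proof.
move=> xc; have x0 : ~ shell lam 0 x.
  by move=> h; apply: xc => i; rewrite -ltr_norml; exact: h.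
rewrite /pert (_ : (fun N => _) = cst 0) ?lim_cst //.
apply/funext => N; rewrite /psum big1 // => k _; rewrite tensor_off ?mulr0 //.
by move=> h; apply: x0; move: h; exact: shell_le.
Qed.

(** Shells decrease, so all terms from index [m] on vanish at [x]: off the Cantor set every series
    here is pointwise a finite sum. *)
Lemma psum_stable (a : nat -> R) al m (x : V) N : ~ shell lam m x -> (m <= N)%N ->
  \sum_(k < N) a k * tensor lam k al x = \sum_(k < m) a k * tensor lam k al x.
Proof.
move=> xm mN; rewrite -!(big_mkord xpredT (fun k => a k * tensor lam k al x)).
rewrite (big_cat_nat (leq0n m) mN) /= [X in _ + X]big_nat_cond [X in _ + X]big1 ?addr0 //.
move=> k; rewrite andbT => /andP[mk _]; rewrite tensor_off ?mulr0 //.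
by move=> h; apply: xm; move: h; exact: shell_le.
Qed.

(** The factor of coordinate 0 is the derivative of [t] times the cut-off, at most 1 but possibly
    negative; the other factors lie in [[0, 1]]. Whatever the sign, the product is at most 1, and
    only upper bounds on [pert1 ord0] enter the Jacobian estimate. *)
Lemma tensor_incr0_le1 k (x : V) : tensor lam k (incr al0 ord0) x <= 1.
Proof.
rewrite /tensor (bigD1 ord0) //.
set a := prof _ _ _ _; set b := \prod_(i < n.+1 | _) _.
have b0 : 0 <= b <= 1.
  have H (i : 'I_n.+1) : i != ord0 ->
      0 <= prof lam (i == ord0) (incr al0 ord0 i) (orbit_coord lam k (x 0 i)) <= 1.
    by move=> i0; rewrite /incr (negbTE i0) addn0; exact: bump_itv.
  apply/andP; split; first by apply: prodr_ge0 => i /H /andP[].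
  by apply: prodr_ile1 => i /H.
have a1 : a <= 1 by exact: (bump_slope_le1 (plateau0 lam2) (plateau1 lam2)).
case/andP: b0 => b0 b1; have [a0|a0] := leP 0 a; first by rewrite mulr_ile1.
by apply: le_trans ler01; rewrite mulr_le0_ge0 // ltW.
Qed.

Lemma psum1_le_sum_coef N (x : V) : psum1 N ord0 x <= 1 - kap ^+ N.
Proof.
rewrite -[1](expr0 kap) -sum_coef // big_mkord; apply: ler_sum => k _.
by rewrite -[leRHS]mulr1 ler_wpM2l ?coef_ge0 ?tensor_incr0_le1.
Qed.

Lemma pert1_le1 (x : V) : pert1 ord0 x <= 1.
Proof.
have cv := @cvg_psum1 ord0 x.
rewrite -(cvg_lim _ cv) //; apply: limr_le; first exact: (cvgP _ cv).
apply: nearW => N; apply: le_trans (psum1_le_sum_coef N x) _.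
by rewrite gerBl exprn_ge0 // ltW.
Qed.

Lemma psum1_le m (x : V) N : ~ shell lam m x -> psum1 N ord0 x <= 1 - kap ^+ m.
Proof.
move=> xm.
have [mN|Nm] := leqP m N; first by rewrite /psum1 (psum_stable _ _ xm mN); exact: psum1_le_sum_coef.
(* For [N < m] nothing is truncated, but [1 - kap ^ N <= 1 - kap ^ m] already. *)
apply: le_trans (psum1_le_sum_coef N x) _; rewrite lerB // ler_wiXn2l ?(ltW kap0) ?(ltW kap1) //.
exact: ltnW.
Qed.

Lemma pert1_le m (x : V) : ~ shell lam m x -> pert1 ord0 x <= 1 - kap ^+ m.
Proof.
have cv := @cvg_psum1 ord0 x.
move=> xm; rewrite -(cvg_lim _ cv) //; apply: limr_le; first exact: (cvgP _ cv).
by apply: nearW => N; exact: psum1_le.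
Qed.

(** An orbit confined to the plateau meets every cut-off where its slope factor is 1, so the series
    is the telescoping sum of the [coef k]. *)
Lemma pert1_eq1 (x : V) : (forall k i, `|orbit_coord lam k (x 0 i)| <= plateau lam) ->
  pert1 ord0 x = 1.
Proof.
move=> xP; have T k : tensor lam k (incr al0 ord0) x = 1.
  rewrite /tensor big1 // => i _.
  have [h1 h2] := bump_plateau (plateau0 lam2) (plateau1 lam2) (xP k i).
  by rewrite /incr /prof; case: eqP.
have E : (fun N => psum1 N ord0 x) = (fun N => 1 - 1 * kap ^+ N).
  apply/funext => N; rewrite mul1r -[1](expr0 kap) -sum_coef // big_mkord.
  by apply: eq_bigr => k _; rewrite T mulr1.
apply: cvg_lim => //; rewrite E -[X in _ --> X]subr0.
by apply: cvgB; [exact: cvg_cst|exact: cvg_geo].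
Qed.

Definition cantor_null : set V := \bigcap_k shell lam k.

(* On the Cantor set the series of second derivatives may diverge; elsewhere
   it is a finite sum. The set is null, so the value there is irrelevant. *)
Definition pert2 (j m : 'I_n.+1) (x : V) : R :=
  limn (fun N => psum2 N j m x * \1_(~` cantor_null) x).

Lemma cvg_psum2 j m x : (fun N => psum2 N j m x * \1_(~` cantor_null) x) @ \oo --> pert2 j m x.
Proof.
suff [c cE] : exists c : R, \forall N \near \oo, psum2 N j m x * \1_(~` cantor_null) x = c.
  have H : (fun N => psum2 N j m x * \1_(~` cantor_null) x) @ \oo --> c.
    apply: (@cvg_trans _ (cst c @ \oo)); last exact: cvg_cst.
    by apply: near_eq_cvg; apply: filterS cE.
  exact: (cvgP _ H).
have [xE|xE] := pselect (cantor_null x).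
  by exists 0; apply: nearW => N; rewrite indicE memNset ?mulr0.
have [k xk] : exists k, ~ shell lam k x.
  by apply/not_existsP => h; apply: xE => k _; have := h k; move/contrapT.
exists (psum2 k j m x); near=> N; rewrite indicE mem_set // mulr1.
have kN : (k <= N)%N by near: N; exact: nbhs_infty_ge.
exact: (@psum_stable (fun k => coef k * lam^-1 ^+ k) (incr (incr al0 j) m) k x N xk kN).
Unshelve. all: by end_near. Qed.

Lemma pert2E j m x k : ~ shell lam k x -> pert2 j m x = psum2 k j m x.
Proof.
move=> xk; apply: cvg_lim => //.
apply: (@cvg_trans _ (cst (psum2 k j m x) @ \oo)); last exact: cvg_cst.
apply: near_eq_cvg; near=> N; rewrite indicE mem_set ?mulr1; last by move=> h; apply: xk; exact: h.
have kN : (k <= N)%N by near: N; exact: nbhs_infty_ge.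
exact/esym/(@psum_stable (fun k => coef k * lam^-1 ^+ k) (incr (incr al0 j) m) k x N xk kN).
Unshelve. all: by end_near. Qed.

(** Keeping the indicators of the shells makes the bound a partial sum of [shell_weight], the
    function that will dominate all [psum2]. *)
Lemma psum2_bound : exists C : R, 0 <= C /\ forall N j m x,
  `|psum2 N j m x| <= \sum_(k < N) C * (kap / lam) ^+ k * \1_(shell lam k) x.
Proof.
have [C CP] := @tensor_bounded R n lam lam2.
have C0 : 0 <= C by apply: le_trans (CP 0%N al0 0).
exists C; split => // N j m x.
rewrite (le_trans (ler_norm_sum _ _ _)) // ler_sum // => k _.
have [xk|xk] := pselect (shell lam k x); last first.
  by rewrite tensor_off // mulr0 normr0 indicE memNset // mulr0.
rewrite indicE mem_set // mulr1 normrM mulrC ler_pM //.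
have l0 : 0 <= lam^-1 ^+ k by rewrite exprn_ge0 // invr_ge0 ltW.
rewrite ger0_norm; last exact: mulr_ge0 (coef_ge0 k) l0.
rewrite expr_div_n -exprVn ler_wpM2r // /coef ler_piMr //.
  by rewrite exprn_ge0 // ltW.
by rewrite gerBl ltW.
Qed.

End Series.

(** * Hausdorff measure of the Cantor set *)

Section GammaPositive.
Context {R : realType}.
Local Notation mu := (@lebesgue_measure R).

Lemma powR_expR_le (p t : R) : 0 <= p -> 0 < t ->
  exists2 C : R, 0 < C & forall t, 0 < t -> t `^ p * expR (- t) <= C * expR (- t / 2).
Proof.
move=> p0 _; pose N := (Num.bound p).+1.
have pN : p <= N%:R.
  rewrite /N; apply: le_trans (ltW (archi_boundP p0)) _.
  by rewrite ler_nat.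
(* From [s <= expR s] with [s = t / (2 N)], raised to the power [N]:
   [t ^ N <= (2 N) ^ N * expR (t / 2)]. The summand 1 in [1 + B] covers [t <= 1]. *)
pose B : R := (2 * N%:R) ^+ N.
have B0 : 0 < B by rewrite exprn_gt0 // mulr_gt0.
exists (1 + B); first by rewrite addr_gt0.
move=> {}t t0.
have E : expR (- t) = expR (- t / 2) * expR (- t / 2).
  by rewrite -expRD; congr expR; field.
rewrite E mulrA ler_wpM2r ?expR_ge0 //.
rewrite mulNr expRN ler_pdivrMr ?expR_gt0 //.
have e1 : 1 <= expR (t / 2) by rewrite -expR0 ler_expR divr_ge0 // ltW.
have tB : t ^+ N <= B * expR (t / 2).
  have -> : t / 2 = (t / (2 * N%:R)) * N%:R by field; rewrite pnatr_eq0.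
  rewrite expRM_natr -exprMn.
  have te : t <= 2 * N%:R * expR (t / (2 * N%:R)).
    rewrite -ler_pdivrMl ?mulr_gt0 // mulrC.
    by apply: le_trans (expR_ge1Dx _); rewrite lerDr.
  by rewrite lerXn2r // nnegrE ?(ltW t0) // (le_trans (ltW t0) te).
have [t1|t1] := leP t 1.
  apply: (@le_trans _ _ 1).
    have tp : t `^ p <= 1 `^ p by rewrite ge0_ler_powR // nnegrE // ltW.
    by rewrite powR1 in tp.
  rewrite mulrDl mul1r -[leLHS]addr0 lerD // mulr_ge0 ?expR_ge0 // ltW //.
apply: (@le_trans _ _ (t ^+ N)); first by rewrite -powR_mulrn ?(ltW t0) // ler_powR // ltW.
by apply: le_trans tB _; rewrite ler_wpM2r ?expR_ge0 // lerDr.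
Qed.

Lemma measurable_gamma_integrand (p : R) (D : set R) :
  measurable_fun D (fun t : R => (t `^ p * expR (- t))%:E).
Proof.
apply: measurable_funTS; apply/measurable_EFinP; apply: measurable_funM.
  exact: measurable_powR.
by apply: measurableT_comp => //; exact: measurable_expR.
Qed.

Lemma integral_expR_half :
  (\int[mu]_(t in `]0%R, +oo[) (expR (- t / 2))%:E < +oo)%E.
Proof.
have h0 : 0 < 2^-1 :> R by rewrite invr_gt0.
have I1 := integral_exponential_pdf h0.
have mpdf : measurable_fun setT (EFin \o exponential_pdf (2^-1 : R)).
  by apply/measurable_EFinP; exact: measurable_exponential_pdf.
apply: (@le_lt_trans _ _ (\int[mu]_t (2%:E * (exponential_pdf 2^-1 t)%:E)))%E; last first.
  rewrite ge0_integralZl_EFin //; last by move=> t _; rewrite lee_fin exponential_pdf_ge0.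
  by rewrite I1 mule1 ltry.
apply: (@le_trans _ _ (\int[mu]_(t in `]0%R, +oo[) (2%:E * (exponential_pdf 2^-1 t)%:E)))%E.
  rewrite le_eqVlt; apply/orP; left; apply/eqP; apply: eq_integral => t.
  rewrite inE /= in_itv /= andbT => t0.
  rewrite -EFinM; congr EFin; rewrite /exponential_pdf patchE ifT; last first.
    by rewrite inE /= in_itv /= andbT ltW.
  by rewrite mulrA mulfV // mul1r mulNr mulrC mulNr mulrC.
apply: ge0_subset_integral => //.
- exact: measurable_funeM.
- by move=> t _; rewrite -EFinM lee_fin mulr_ge0 ?exponential_pdf_ge0.
Qed.

(** [Gamma] is a [fine], which sends an infinite integral to 0; so positivity needs finiteness as
    well as a positive lower bound. *)
Lemma Gamma_gt0 (s : R) : 1 <= s -> 0 < Gamma s.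
Proof.
move=> s1; rewrite /Gamma; set I := (\int[_]_(_ in _) _)%E.
have p0 : 0 <= s - 1 by rewrite subr_ge0.
have Ifin : (I < +oo)%E.
  have [C C0 CP] := powR_expR_le p0 ltr01.
  apply: (@le_lt_trans _ _ (\int[mu]_(t in `]0%R, +oo[) (C%:E * (expR (- t / 2))%:E)))%E.
    apply: ge0_le_integral => //.
    - by move=> t _; rewrite lee_fin mulr_ge0 ?powR_ge0 ?expR_ge0.
    - exact: measurable_gamma_integrand.
    - apply/measurable_EFinP; apply: measurable_funM => //; apply: measurableT_comp => //.
      exact: measurable_funM.
    - by move=> t /=; rewrite in_itv /= andbT -EFinM lee_fin; exact: CP.
  rewrite ge0_integralZl_EFin //; first last.
  - exact: ltW.
  - by apply/measurable_EFinP; apply: measurableT_comp => //; exact: measurable_funM.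
  apply: lte_mul_pinfty => //; first by rewrite lee_fin ltW.
  exact: integral_expR_half.
have I0 : ((expR (- 2))%:E <= I)%E.
  (* On [[1, 2]] the power is at least 1 and the exponential at least [expR (- 2)]. *)
  apply: (@le_trans _ _ (\int[mu]_(t in `[1%R, 2%R]) (cst (expR (- 2))%:E t)))%E.
    have mE : (mu (`[1%R, 2%R]%classic : set R) = 1)%E.
      rewrite lebesgue_measure_itv /= lte_fin ltr1n -EFinD; congr EFin; lra.
    by rewrite integral_cst // [X in (_ <= _ * X)%E]mE mule1.
  apply: (@le_trans _ _ (\int[mu]_(t in `[1%R, 2%R]) (t `^ (s - 1) * expR (- t))%:E))%E.
    apply: ge0_le_integral => //.
    - by move=> t _; rewrite lee_fin expR_ge0.
    - exact: measurable_gamma_integrand.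
    - move=> t /=; rewrite in_itv /= => /andP[t1 t2]; rewrite lee_fin.
      rewrite -[leLHS]mul1r ler_pM ?expR_ge0 // ?ler_expR ?lerN2 //.
      have tp : 1 `^ (s - 1) <= t `^ (s - 1) by rewrite ge0_ler_powR // nnegrE // (le_trans ler01).
      by rewrite powR1 in tp.
  apply: ge0_subset_integral => //.
  - exact: measurable_gamma_integrand.
  - by move=> t _; rewrite lee_fin mulr_ge0 ?powR_ge0 ?expR_ge0.
  - by move=> t /=; rewrite !in_itv /= andbT => /andP[t1 _]; rewrite (lt_le_trans ltr01).
rewrite -lte_fin fineK; first by apply: lt_le_trans I0; rewrite lte_fin expR_gt0.
rewrite ge0_fin_numE //; apply: le_trans I0; by rewrite lee_fin expR_ge0.
Qed.

End GammaPositive.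

(** * Symbolic coding of the one-dimensional Cantor set by sequences of signs *)

Section Address.
Context {R : realType}.
Variable lam : R.
Hypotheses (lam0 : 0 < lam) (lam2 : lam < 2^-1).

Local Notation pl := (plateau lam).

(** [plateau lam] is the fixed point of the inverse branch [t -> 1/2 + lam t], the right end of the
    Cantor set; this is what closes the induction bounding [cantor_psum]. *)
Lemma plateauE : pl = 2^-1 + lam * pl.
Proof.
have h : 1 - lam != 0 by rewrite gt_eqF // subr_gt0; move: lam2 => ?; lra.
have E : (1 - lam) * (1 - lam)^-1 = 1 by rewrite mulfV.
by rewrite /plateau invfM; move: E; move: (1 - lam)^-1 => w E; lra.
Qed.

Definition cantor_psum (sig : nat -> R) (N : nat) : R := \sum_(k < N) lam ^+ k * (sig k / 2).

Definition cantor_point (sig : nat -> R) : R := limn (cantor_psum sig).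

Definition signs (sig : nat -> R) : Prop := forall k, sig k = 1 \/ sig k = -1.

Lemma cantor_psum_rec sig N :
  cantor_psum sig N.+1 = sig 0%N / 2 + lam * cantor_psum (sig \o succn) N.
Proof.
rewrite /cantor_psum big_ord_recl expr0 mul1r; congr (_ + _).
by rewrite mulr_sumr; apply: eq_bigr => k _; rewrite lift0 exprS -mulrA.
Qed.

Lemma cantor_psum_le sig N : signs sig -> `|cantor_psum sig N| <= pl.
Proof.
elim: N sig => [|N IH] sig ssig.
  by rewrite /cantor_psum big_ord0 normr0 ltW // plateau0.
rewrite cantor_psum_rec [leRHS]plateauE (le_trans (ler_normD _ _)) // lerD //.
  by case: (ssig 0%N) => ->; rewrite ?mul1r ?mulN1r ?normrN ger0_norm.
rewrite normrM (gtr0_norm lam0) ler_wpM2l ?(ltW lam0) //.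
by apply: IH => k; exact: ssig.
Qed.

Lemma cvg_cantor_psum sig : signs sig -> cantor_psum sig N @[N --> \oo] --> cantor_point sig.
Proof.
move=> ssig; have l1 : lam < 1 by move: lam2 => ?; lra.
apply: (@cvg_of_geometric_bound R _ pl lam (ltW lam0) l1).
move=> M N MN; rewrite -(subnKC MN).
have -> : cantor_psum sig (M + (N - M)) - cantor_psum sig M =
    lam ^+ M * cantor_psum (fun k => sig (M + k)%N) (N - M).
  rewrite /cantor_psum big_split_ord /= addrAC subrr add0r mulr_sumr.
  by apply: eq_bigr => k _; rewrite /= exprD -mulrA.
rewrite normrM (ger0_norm (exprn_ge0 M (ltW lam0))) mulrC ler_wpM2r ?exprn_ge0 ?(ltW lam0) //.
by apply: cantor_psum_le => k; exact: ssig.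
Qed.

Lemma cantor_point_le sig : signs sig -> `|cantor_point sig| <= pl.
Proof.
move=> ssig; have cv : (fun N => `|cantor_psum sig N|) @ \oo --> `|cantor_point sig|.
  by apply: cvg_norm; exact: cvg_cantor_psum.
rewrite -(cvg_lim _ cv) //; apply: limr_le; first exact: (cvgP _ cv).
by apply: nearW => N; exact: cantor_psum_le.
Qed.

Lemma cantor_point_rec sig : signs sig ->
  cantor_point sig = sig 0%N / 2 + lam * cantor_point (sig \o succn).
Proof.
move=> ssig; apply: cvg_lim => //; rewrite -(cvg_shiftS (cantor_psum sig)).
rewrite (_ : (fun N => _) = (fun N => sig 0%N / 2 + lam * cantor_psum (sig \o succn) N)); last first.
  by apply/funext => N; exact: cantor_psum_rec.
apply: cvgD; first exact: cvg_cst.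
by apply: cvgMr; apply: cvg_cantor_psum => k; exact: ssig.
Qed.

Lemma lam_plateau : lam * pl < 2^-1.
Proof.
have h : 0 < 2 * (1 - lam) by move: lam2 => ?; lra.
by rewrite /plateau ltr_pdivrMr //; move: lam2 => ?; lra.
Qed.

(** The first term is 1/2 in absolute value and the rest of the series at most
    [lam * plateau lam < 1/2]. Hence [cexpand lam] reads off the first symbol and acts on addresses
    as the shift. *)
Lemma sgp_cantor_point sig : signs sig -> sgp (cantor_point sig) = sig 0%N.
Proof.
move=> ssig; rewrite cantor_point_rec //; set u := cantor_point _.
have : `|lam * u| < 2^-1.
  apply: le_lt_trans lam_plateau; rewrite normrM (gtr0_norm lam0) ler_wpM2l ?(ltW lam0) //.
  by apply: cantor_point_le => k; exact: ssig.
rewrite ltr_norml /sgp => /andP[h1 h2].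
case: (ssig 0%N) => ->.
  have -> // : 0 <= 1 / 2 + lam * u by move: (lam * u) h1 h2 => w h1 h2; lra.
have -> // : 0 <= -1 / 2 + lam * u = false.
by apply/negbTE; rewrite -ltNge; move: (lam * u) h1 h2 => w h1 h2; lra.
Qed.

Lemma cexpand_cantor_point sig : signs sig ->
  cexpand lam (cantor_point sig) = cantor_point (sig \o succn).
Proof.
move=> ssig; rewrite /cexpand sgp_cantor_point // cantor_point_rec //.
by rewrite addrC addKr mulKf // gt_eqF.
Qed.

Lemma orbit_cantor_point sig k : signs sig ->
  orbit_coord lam k (cantor_point sig) = cantor_point (fun j => sig (k + j)%N).
Proof.
move=> ssig; elim: k => [//|k IH].
rewrite /orbit_coord iterS -/(orbit_coord lam k _) IH cexpand_cantor_point.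
  by congr cantor_point; apply/funext => j /=; rewrite addnS.
by move=> j; exact: ssig.
Qed.

(** The distance between the two first-level pieces, which lie within [lam * plateau lam] of 1/2 and
    of -1/2. *)
Definition gap : R := 1 - 2 * lam * pl.

Lemma gap0 : 0 < gap.
Proof. by rewrite /gap subr_gt0 -mulrA; move: (lam * pl) lam_plateau => w ?; lra. Qed.

(** A common prefix of length [k] is peeled off by similarities of ratio [lam]; the remaining tails
    start with opposite signs and lie in different first-level pieces. *)
Lemma cantor_point_dist sig sig' k : signs sig -> signs sig' ->
  (forall j, (j < k)%N -> sig j = sig' j) -> sig k <> sig' k ->
  lam ^+ k * gap <= `|cantor_point sig - cantor_point sig'|.
Proof.
elim: k sig sig' => [|k IH] sig sig' ss ss' agree diff; last first.
  rewrite (cantor_point_rec ss) (cantor_point_rec ss') (agree 0%N) //.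
  rewrite opprD addrACA subrr add0r -mulrBr normrM (gtr0_norm lam0) exprS -mulrA.
  rewrite ler_wpM2l ?(ltW lam0) // IH //.
  - by move=> j; exact: ss.
  - by move=> j; exact: ss'.
  - by move=> j jk; exact: agree.
rewrite expr0 mul1r (cantor_point_rec ss) (cantor_point_rec ss').
have /ler_normlP [u1 u2] : `|cantor_point (sig \o succn)| <= pl by apply: cantor_point_le => j; exact: ss.
have /ler_normlP [v1 v2] : `|cantor_point (sig' \o succn)| <= pl by apply: cantor_point_le => j; exact: ss'.
move: u1 u2 v1 v2 lam0; rewrite /gap.
move: (cantor_point _) (cantor_point _) pl => u v w u1 u2 v1 v2 l0.
have lw1 : lam * u <= lam * w by rewrite ler_wpM2l // ltW.
have lw2 : lam * v <= lam * w by rewrite ler_wpM2l // ltW.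
have lw3 : lam * - u <= lam * w by rewrite ler_wpM2l // ltW.
have lw4 : lam * - v <= lam * w by rewrite ler_wpM2l // ltW.
case: (ss 0%N) (ss' 0%N) diff => -> [] -> // _.
  by apply: le_trans (ler_norm _); lra.
by rewrite -normrN; apply: le_trans (ler_norm _); lra.
Qed.

End Address.

(** * Signed binary digits of the points of [[-1, 1]] *)

Section Doubling.
Context {R : realType}.

(* [cexpand (1 / 2)] is the doubling map of [-1, 1]: these are signed binary digits. *)
Definition digit (y : R) (j : nat) : R := sgp (iter j (cexpand 2^-1) y).

Lemma signs_digit (y : R) : signs (digit y).
Proof. by move=> k; rewrite /digit /sgp; case: ifP; [left|right]. Qed.

Lemma iter_doubling_le (y : R) j : `|y| <= 1 -> `|iter j (cexpand 2^-1) y| <= 1.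
Proof.
move=> y1; elim: j => //= j; move: (iter _ _ _) => t t1.
rewrite /cexpand normrM norm_sub_sgp invrK ger0_norm //.
rewrite mulrC -ler_pdivlMr // mul1r ler_norml.
move: (normr_ge0 t) t1; move: `|t| => u u0 u1; apply/andP; split; lra.
Qed.

Lemma doubling_dist (y y' : R) j :
  (forall i, (i < j)%N -> digit y i = digit y' i) ->
  y - y' = 2^-1 ^+ j * (iter j (cexpand 2^-1) y - iter j (cexpand 2^-1) y').
Proof.
elim: j => [|j IH] agree; first by rewrite expr0 mul1r.
rewrite IH; last by move=> i ij; apply: agree; exact: ltnW.
have := agree j (ltnSn j); rewrite /digit !iterS exprSr -mulrA => E.
by congr (_ * _); rewrite /cexpand E -mulrBr mulrA mulfV ?mul1r //; ring.
Qed.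

Lemma doubling_dist_le (y y' : R) j : `|y| <= 1 -> `|y'| <= 1 ->
  (forall i, (i < j)%N -> digit y i = digit y' i) ->
  `|y - y'| <= 2 * 2^-1 ^+ j.
Proof.
move=> y1 y1' /doubling_dist ->.
rewrite normrM ger0_norm ?exprn_ge0 // mulrC ler_wpM2r ?exprn_ge0 //.
apply: le_trans (ler_normB _ _) _; rewrite -[leRHS]/(1 + 1).
by rewrite lerD // iter_doubling_le.
Qed.

(** Agreement of [k] digits forces distance at most [2 * 2 ^ (- k)], so distinct points disagree
    somewhere, and the first disagreement is taken. Dyadic points are harmless, since [digit] fixes
    one expansion of each point. *)
Lemma digit_inj (y y' : R) : `|y| <= 1 -> `|y'| <= 1 -> y <> y' ->
  exists j, digit y j <> digit y' j /\ forall i, (i < j)%N -> digit y i = digit y' i.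
Proof.
move=> y1 y1' yy'.
have H : exists j, digit y j != digit y' j.
  apply: contrapT => h; apply: yy'; apply/eqP; rewrite -subr_eq0 -normr_le0.
  apply/ler_addgt0Pr => e e0; rewrite add0r.
  have : 2 * 2^-1 ^+ k @[k --> \oo] --> (2 * 0 : R).
    by apply: cvgMr; apply: cvg_expr; rewrite ger0_norm // invf_lt1 // ltr1n.
  rewrite mulr0 => /cvgr0Pnorm_le /(_ e e0) [k _ kP].
  apply: le_trans (@doubling_dist_le y y' k y1 y1' _) _.
    by move=> i _; apply/eqP; apply: contrapT => /negP d; apply: h; exists i.
  exact: le_trans (ler_norm _) (kP k (leqnn k)).
case: (ex_minnP H) => j /eqP dj jmin; exists j; split => // i ij.
apply/eqP; apply: contrapT => /negP d.
by have := jmin i d; rewrite leqNgt ij.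
Qed.

End Doubling.

(** * A parametrisation of part of the product Cantor set with Hoelder inverse *)

Section HausdorffLower.
Context {R : realType} {n : nat}.
Local Notation V := 'rV[R]_n.+1.
Variables lam d : R.
Hypotheses (lam0 : 0 < lam) (lam2 : lam < 2^-1) (d0 : 0 < d).
Hypothesis (lamd : lam `^ d = 2^-1 ^+ n.+1).

(* The digits of [y] are dealt out cyclically to the coordinates. *)
Definition cantor_param (y : R) : V :=
  \row_i cantor_point lam (fun k => digit y (k * n.+1 + i)%N).

Lemma orbit_cantor_param y k i :
  `|orbit_coord lam k (cantor_param y 0 i)| <= plateau lam.
Proof.
rewrite mxE orbit_cantor_point //; last by move=> j; exact: signs_digit.
by apply: cantor_point_le => // j; exact: signs_digit.
Qed.

Definition holder_const : R := 2 * gap lam `^ (- d).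

Lemma enorm_ge (x : V) i : `|x 0 i| <= enorm x.
Proof.
rewrite /enorm -sqrtr_sqr ler_wsqrtr // (bigD1 i) //= lerDl.
by apply: sumr_ge0 => j _; exact: sqr_ge0.
Qed.

Lemma enorm_ge0 (x : V) : 0 <= enorm x. Proof. exact: sqrtr_ge0. Qed.

(** If the digits first differ at [j = k (n + 1) + i], then [|y - y'| <= 2 * 2 ^ (- j)], while the
    images are at least [lam ^ k * gap lam] apart in coordinate [i]. By [lamd], the [d]-th power of
    [lam ^ k] is [2 ^ (- k (n + 1)) >= 2 ^ (- j)]; what is left over is [holder_const]. *)
Lemma cantor_param_holder (y y' : R) : `|y| <= 1 -> `|y'| <= 1 ->
  `|y - y'| <= holder_const * enorm (cantor_param y - cantor_param y') `^ d.
Proof.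
move=> y1 y1'; have [<-|/eqP yy'] := eqVneq y y'.
  by rewrite subrr normr0 !mulr_ge0 ?powR_ge0.
have [j [dj agree]] := digit_inj y1 y1' yy'.
(* Digit [j] is the [k]-th symbol of coordinate [i]; earlier symbols of that coordinate come from
   earlier digits. *)
pose k := (j %/ n.+1)%N; pose i : 'I_n.+1 := Ordinal (ltn_pmod j (ltn0Sn n)).
have jE : j = (k * n.+1 + i)%N by exact: divn_eq.
apply: le_trans (doubling_dist_le y1 y1' agree) _.
have dist : lam ^+ k * gap lam <= enorm (cantor_param y - cantor_param y').
  apply: le_trans (enorm_ge _ i); rewrite !mxE; apply: cantor_point_dist => //.
  - by move=> m; exact: signs_digit.
  - by move=> m; exact: signs_digit.
  - move=> m mk; apply: agree; rewrite jE ltn_add2r ltn_pmul2r //.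
  - by rewrite -jE.
have g0 := gap0 lam2.
rewrite /holder_const -mulrA ler_wpM2l //.
apply: (@le_trans _ _ (gap lam `^ (- d) * (lam ^+ k * gap lam) `^ d)); last first.
  rewrite ler_wpM2l ?powR_ge0 // ge0_ler_powR ?nnegrE ?enorm_ge0 ?(ltW d0) //.
  by rewrite mulr_ge0 ?exprn_ge0 ?(ltW lam0) ?(ltW g0).
rewrite powRM ?exprn_ge0 ?(ltW lam0) ?(ltW g0) // mulrCA -powRD; last by rewrite (gt_eqF g0) implybT.
rewrite addNr powRr0 mulr1 -powR_mulrn ?(ltW lam0) // -powRrM mulrC powRrM lamd.
rewrite powR_mulrn ?exprn_ge0 // -exprM mulnC jE.
rewrite exprD ler_piMr ?exprn_ge0 // exprn_ile1 //.
by rewrite invf_le1 // ler1n.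
Qed.

End HausdorffLower.

Lemma hausdorff_const_gt0 (R : realType) (d : R) : 0 < d -> 0 < hausdorff_const d.
Proof.
move=> d0; rewrite /hausdorff_const divr_gt0 ?powR_gt0 ?pi_gt0 //.
by rewrite mulr_gt0 ?powR_gt0 // Gamma_gt0 // lerDr divr_ge0 // ltW.
Qed.

Section HausdorffPositive.
Context {R : realType} {n : nat}.
Local Notation V := 'rV[R]_n.+1.
Local Notation mu := (@lebesgue_measure R).

Lemma ediam_ge0 (C : set V) : (0 <= ediam C)%E.
Proof. by apply: ereal_sup_ubound; left. Qed.

Lemma enorm_le_ediam (C : set V) (delta : R) (x y : V) : (ediam C <= delta%:E)%E ->
  C x -> C y -> enorm (x - y) <= fine (ediam C).
Proof.
move=> Cd Cx Cy; rewrite -lee_fin fineK.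
  by apply: ereal_sup_ubound; right; exists x, y.
by rewrite ge0_fin_numE ?ediam_ge0 // (le_lt_trans Cd) // ltry.
Qed.

(* Mass distribution principle for a curve-like parametrisation [p] of part of
   [S] by [-1, 1] whose inverse is [d]-Hoelder. *)
Lemma hausdorff_measure_gt0 (d A : R) (p : R -> V) (S : set V) : 0 < d -> 0 < A ->
  (forall y, `|y| <= 1 -> S (p y)) ->
  (forall y y', `|y| <= 1 -> `|y'| <= 1 -> `|y - y'| <= A * enorm (p y - p y') `^ d) ->
  (0 < hausdorff_measure d S)%E.
Proof.
move=> d0 A0 Sp holder; have hc0 := hausdorff_const_gt0 d0.
set hc := hausdorff_const d in hc0 *.
apply: (@lt_le_trans _ _ (hc / A)%:E); first by rewrite lte_fin divr_gt0.
(* Any mesh bounds the supremum from below; the mesh serves only to make the diameters finite. *)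
apply: (@le_trans _ _ (hausdorff_delta d 1 S)); last first.
  by apply: ereal_sup_ubound; exists 1 => //; rewrite /= in_itv /= ltr01.
apply: le_ereal_inf_tmp => _ [C [SC [Cd ->]]].
pose r k := A * fine (ediam (C k)) `^ d.
have r0 k : 0 <= r k by rewrite mulr_ge0 ?powR_ge0 // ltW.
(* [c k] is a parameter whose image lies in [C k], with default 0 when there is none. By the Hoelder
   bound, all parameters with image in [C k] are within [r k] of it. *)
have /choice[c cP] k : exists c, (exists2 y, `|y| <= 1 & C k (p y)) -> `|c| <= 1 /\ C k (p c).
  have [[y y1 Cy]|h] := pselect (exists2 y, `|y| <= 1 & C k (p y)); first by exists y.
  by exists 0 => /h.
have cover : `[-1, 1]%classic `<=` \bigcup_k `[c k - r k, c k + r k]%classic.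
  move=> y /=; rewrite in_itv /= -ler_norml => y1.
  have [k _ Cky] := SC _ (Sp y y1); exists k => //=.
  have [c1 Cc] := cP k (ex_intro2 _ _ y y1 Cky).
  rewrite in_itv /= -ler_distl (le_trans (holder y (c k) y1 c1)) //.
  rewrite ler_pM2l // ge0_ler_powR ?nnegrE ?enorm_ge0 ?fine_ge0 ?ediam_ge0 ?(ltW d0) //.
  exact: enorm_le_ediam (Cd k) Cky Cc.
have two : (2%:E <= \sum_(0 <= k <oo) (2 * r k)%:E)%E.
  apply: (@le_trans _ _ (mu (`[-1, 1]%classic : set R))).
    rewrite lebesgue_measure_itv /= lte_fin; case: ifPn => [_|].
      by rewrite -EFinD lee_fin; lra.
    by rewrite -leNgt => h; exfalso; lra.
  apply: (@le_trans _ _ (\sum_(0 <= k <oo) mu (`[(c k - r k)%R, (c k + r k)%R]%classic : set R))%E).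
    apply: measure_sigma_subadditive => // k; exact: measurable_itv.
  apply: lee_nneseries => k _ //; rewrite lebesgue_measure_itv /= lte_fin.
  case: ifPn => _; last by rewrite lee_fin mulr_ge0.
  by rewrite -EFinD lee_fin; lra.
have -> : (\sum_(0 <= k <oo) (hc * fine (ediam (C k)) `^ d)%:E =
    (hc / A / 2)%:E * \sum_(0 <= k <oo) (2 * r k)%:E)%E.
  rewrite -nneseriesZl; last by move=> k _; rewrite lee_fin mulr_ge0.
  apply: eq_eseriesr => k _; rewrite -EFinM; congr EFin; rewrite /r.
  by field; rewrite gt_eqF.
have -> : (hc / A)%:E = ((hc / A / 2)%:E * 2%:E)%E by rewrite -EFinM; congr EFin; field; rewrite gt_eqF.
have h : 0 <= hc / A / 2 by rewrite divr_ge0 // divr_ge0 // ltW.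
by apply: lee_wpmul2l; [rewrite lee_fin|exact: two].
Qed.

End HausdorffPositive.

(** * Integrability over the shells *)

Lemma outer_measure_big_setU (R : realType) (T I : Type) (mu : {outer_measure set T -> \bar R})
    (r : seq I) (F : I -> set T) :
  (mu (\big[setU/set0]_(i <- r) F i) <= \sum_(i <- r) mu (F i))%E.
Proof.
elim: r => [|i r IH]; first by rewrite !big_nil outer_measure0.
by rewrite !big_cons (le_trans (outer_measureU2 _ _ _)) // leeD2l.
Qed.

Lemma geometric_sum (R : comNzRingType) (z : R) N :
  (1 - z) * \sum_(i < N) z ^+ i = 1 - z ^+ N.
Proof. by rewrite -[RHS]opprB subrX1 -mulNr opprB. Qed.

Section Shells.
Context {R : realType} {n : nat}.
Local Notation V := 'rV[R]_n.+1.
Local Notation X := (caratheodory_type (@leb_outer R n.+1)).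
Variable lam : R.
Hypotheses (lam0 : 0 < lam) (lam2 : lam < 2^-1).

Local Notation shl := (@shell R n lam).

(** The volume ratio of consecutive generations of cubes: [2 ^ (n + 1)] children, each scaled by
    [lam] in [n + 1] directions. *)
Definition shell_ratio : R := (2 * lam) ^+ n.+1.

Lemma shell0 : shl 0 = cube R n.+1.
Proof.
by apply/seteqP; split => x h i; have := h i; rewrite /orbit_coord /= ltr_norml.
Qed.

Lemma shell_ratio_ge0 : 0 <= shell_ratio.
Proof. by rewrite exprn_ge0 // mulr_ge0 // ltW. Qed.

(** On each of the [2 ^ (n + 1)] sign patterns the expanding map is affine of ratio [1 / lam] and
    sends shell [k + 1] into shell [k]; subadditivity and [leb_outer_affine] give one factor
    [shell_ratio]. *)
Lemma leb_shell_le k : (leb (shl k) <= (2 ^+ n.+1 * shell_ratio ^+ k)%:E)%E.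
Proof.
elim: k => [|k IH].
  rewrite shell0 expr0 mulr1.
  apply: le_trans (@leb_outer_le_box _ _ (const_mx (-1)) (const_mx 1) _ _ _) _.
  - by move=> i; rewrite !mxE; lra.
  - by move=> x xc i; rewrite !mxE; have /andP[/ltW -> /ltW ->] := xc i.
  - rewrite lee_fin /boxvol (eq_bigr (fun=> 2)) ?prodr_const ?card_ord //.
    by move=> i _; rewrite !mxE; ring.
pose sg (b : bool) : R := if b then 1 else -1.
pose B (s : {ffun 'I_n.+1 -> bool}) : set V :=
  [set x | shl k.+1 x /\ forall i, sgp (x 0 i) = sg (s i)].
have sub : shl k.+1 `<=` \big[setU/set0]_(s : {ffun 'I_n.+1 -> bool}) B s.
  move=> x xk; rewrite -bigcup_seq.
  exists [ffun i => 0 <= x 0 i]; first by rewrite /= mem_index_enum.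
  by split=> // i; rewrite ffunE /sgp.
apply: le_trans (le_leb_outer sub) _.
apply: le_trans (outer_measure_big_setU _ _ _) _.
apply: (@le_trans _ _ (\sum_(s : {ffun 'I_n.+1 -> bool})
    (lam ^+ n.+1 * (2 ^+ n.+1 * shell_ratio ^+ k))%:E)%E).
  apply: lee_sum => s _; rewrite EFinM.
  apply: le_trans (lee_wpmul2l _ IH); last by rewrite lee_fin exprn_ge0 // ltW.
  apply: (@leb_outer_affine R n (\row_i (sg (s i) / 2)) lam (shl k)) => // y [yk ys] i.
  have := yk i; rewrite /orbit_coord iterSr; congr (`|iter k _ _| < 1).
  by rewrite /cexpand !mxE ys.
rewrite sumEFin lee_fin sumr_const card_ffun card_bool card_ord [shell_ratio ^+ k.+1]exprS /shell_ratio.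
rewrite -[leLHS]mulr_natl natrX exprMn.
rewrite le_eqVlt; apply/orP; left; apply/eqP.
move: (2 ^+ n.+1) (lam ^+ n.+1) => u v; move: ((u * v) ^+ k) => w; ring. 
Qed.

Lemma measurable_cexpand : measurable_fun [set: R] (cexpand lam).
Proof.
rewrite (_ : cexpand lam = (fun t => lam^-1 * (t - (\1_(`[0, +oo[%classic) t - 2^-1)))).
  apply: measurable_funM => //; apply: measurable_funB => //.
  by apply: measurable_funB => //; exact: measurable_indic.
apply/funext => t; rewrite /cexpand /sgp indicE.
have [t0|t0] := leP 0 t.
  by rewrite mem_set /= ?in_itv /= ?t0 //; field; rewrite gt_eqF.
rewrite memNset /= ?in_itv /=; first by field; rewrite gt_eqF.
by rewrite leNgt t0.
Qed.

Lemma measurable_shell k : measurable (shl k : set X).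
Proof.
have mo : measurable_fun [set: R] (orbit_coord lam k).
  elim: k => [|k IH]; first exact: measurable_id.
  rewrite (_ : orbit_coord lam k.+1 = cexpand lam \o orbit_coord lam k) //.
  exact: measurableT_comp measurable_cexpand IH.
have -> : (shl k : set X) = \bigcap_(i in [set: 'I_n.+1])
     (fun x : X => `|orbit_coord lam k ((x : V) 0 i)|) @^-1` `]-oo, 1[.
  apply/seteqP; split => x /= xk i; first by move=> _ /=; rewrite in_itv/=.
  by have := xk i Logic.I; rewrite /= in_itv.
apply: fin_bigcap_measurable => // i _; rewrite -[X in measurable X]setTI.
have : measurable_fun [set: X] (fun x : X => `|orbit_coord lam k ((x : V) 0 i)|).
  apply: measurableT_comp => //; apply: measurableT_comp mo _.
  exact: measurable_coord.
by apply.
Qed.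

Lemma measurable_cantor_null : measurable (cantor_null lam : set X).
Proof. by apply: bigcapT_measurable => k; exact: measurable_shell. Qed.

Hypothesis ratio1 : shell_ratio < 1.

Lemma leb_cantor_null : leb (cantor_null lam : set X) = 0%E.
Proof.
apply/eqP; rewrite eq_le measure_ge0 andbT; apply/lee_addgt0Pr => e e0; rewrite add0e.
have r0 := shell_ratio_ge0.
have : 2 ^+ n.+1 * shell_ratio ^+ k @[k --> \oo] --> (2 ^+ n.+1 * 0 : R).
  by apply: cvgMr; apply: cvg_expr; rewrite ger0_norm.
rewrite mulr0 => /cvgr0Pnorm_le /(_ e e0) [k _ kP].
apply: (@le_trans _ _ (leb (shl k))); first by apply: le_leb_outer => x; exact.
apply: le_trans (leb_shell_le k) _; rewrite lee_fin.
exact: le_trans (ler_norm _) (kP k (leqnn k)).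
Qed.

Definition shell_weight (C s : R) (x : V) : \bar R :=
  (\sum_(k <oo) (C * s ^+ k * \1_(shl k) x)%:E)%E.

Lemma shell_weight_ge0 C s x : 0 <= C -> 0 <= s -> (0 <= shell_weight C s x)%E.
Proof.
by move=> C0 s0; apply: nneseries_ge0 => k _ _; rewrite lee_fin !mulr_ge0 ?exprn_ge0.
Qed.

Lemma measurable_shell_weight (D : set X) C s : 0 <= C -> 0 <= s ->
  measurable_fun D (shell_weight C s : X -> \bar R).
Proof.
move=> C0 s0; apply: (@measurable_funTS _ _ X).
apply: ge0_emeasurable_sum => [k x _ _|k _].
  by rewrite lee_fin !mulr_ge0 ?exprn_ge0.
apply/measurable_EFinP; apply: measurable_funM => //.
by apply: measurable_indic; exact: measurable_shell.
Qed.

(** Termwise integration and [leb_shell_le] leave a geometric series of ratio [s * shell_ratio]. *)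
Lemma integral_shell_weight C s : 0 <= C -> 0 <= s -> s * shell_ratio < 1 ->
  (\int[leb]_(x in cube R n.+1) shell_weight C s x < +oo)%E.
Proof.
move=> C0 s0 s1; have r0 := shell_ratio_ge0.
rewrite /shell_weight integral_nneseries //; first last.
- by move=> k x _; rewrite lee_fin !mulr_ge0 ?exprn_ge0.
- move=> k; apply/measurable_EFinP; apply: measurable_funM => //.
  by apply: measurable_indic; exact: measurable_shell.
- exact: measurable_cube.
apply: (@le_lt_trans _ _ (\sum_(k <oo) (C * 2 ^+ n.+1 * (s * shell_ratio) ^+ k)%:E)%E).
  apply: lee_nneseries => k _.
    by move=> _; apply: integral_ge0 => x _; rewrite lee_fin !mulr_ge0 ?exprn_ge0.
  under eq_integral do rewrite EFinM.
  rewrite ge0_integralZl_EFin ?mulr_ge0 ?exprn_ge0 //; first last.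
  - by apply/measurable_EFinP; apply: measurable_indic; exact: measurable_shell.
  - exact: measurable_cube.
  rewrite integral_indic; [|exact: measurable_cube|exact: measurable_shell].
  rewrite (_ : C * 2 ^+ n.+1 * (s * shell_ratio) ^+ k =
               C * s ^+ k * (2 ^+ n.+1 * shell_ratio ^+ k)); last first.
    by rewrite exprMn; ring.
  rewrite [X in (_ <= X)%E]EFinM lee_wpmul2l ?lee_fin ?mulr_ge0 ?exprn_ge0 //.
  apply: le_trans (leb_shell_le k); apply: le_leb_outer => x []; exact.
set a := C * 2 ^+ n.+1; set z := s * shell_ratio.
have a0 : 0 <= a by rewrite mulr_ge0 ?exprn_ge0.
have z0 : 0 <= z by rewrite mulr_ge0.
apply: (@le_lt_trans _ _ (a / (1 - z))%:E); last exact: ltry.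
apply: lime_le; first by apply: is_cvg_nneseries => k _ _; rewrite lee_fin mulr_ge0 ?exprn_ge0.
apply: nearW => N; rewrite sumEFin lee_fin big_mkord -mulr_sumr ler_wpM2l //.
have z1 : 0 < 1 - z by rewrite subr_gt0.
rewrite -[leRHS]mul1r ler_pdivlMr // mulrC.
rewrite geometric_sum.
by rewrite gerBl exprn_ge0.
Qed.

Lemma shell_cases (x : V) : cube R n.+1 x ->
  cantor_null lam x \/ exists m, shl m x /\ ~ shl m.+1 x.
Proof.
move=> xc; have [|xE] := pselect (cantor_null lam x); [by left|right].
have H : exists k, `[< ~ shl k x >].
  apply: contrapT => h; apply: xE => k _; apply: contrapT => xk.
  by apply: h; exists k; exact/asboolP.
case: (ex_minnP H) => -[|m] /asboolP xm mmin; first by move: xm; rewrite shell0.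
exists m; split => //; apply: contrapT => xm'.
by have := mmin m; rewrite ltnn => /(_ (introT (asboolP _) xm')).
Qed.

(** A point leaving at generation [m + 1] is controlled by the single term of index [m]. On the
    Cantor set the weight is [+oo], so nothing is asked of [g] there; this absorbs the poles of the
    Jacobian power. *)
Lemma le_shell_weight C s (g : \bar R) (x : V) : 0 < C -> 1 <= s -> cube R n.+1 x ->
  (forall m, shl m x -> ~ shl m.+1 x -> g <= (C * s ^+ m)%:E)%E ->
  (g <= shell_weight C s x)%E.
Proof.
move=> C0 s1 xc gle; have s0 : 0 <= s by exact: le_trans s1.
have t0 k : (0 <= (C * s ^+ k * \1_(shl k) x)%:E)%E.
  by rewrite lee_fin !mulr_ge0 ?exprn_ge0 // ltW.
have [xE|[m [xm xm1]]] := shell_cases xc; last first.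
  apply: le_trans (gle m xm xm1) _; rewrite /shell_weight (nneseries_split _ m.+1) //.
  have -> : (C * s ^+ m)%:E = (C * s ^+ m * \1_(shl m) x)%:E.
    by rewrite indicE mem_set // mulr1.
  rewrite big_mkord big_ord_recr /=.
  by rewrite -addeA addeCA leeDl // adde_ge0 ?sume_ge0 // nneseries_ge0.
suff -> : shell_weight C s x = +oo%E by rewrite leey.
(* On the Cantor set all indicators are 1 and [s >= 1], so each term is at least [C] and the first
   [N] of them sum to at least [A]. *)
apply/eq_infty => A; pose N := Num.bound `|A / C|.
apply: (@le_trans _ _ (\sum_(0 <= k < N) (C * s ^+ k * \1_(shl k) x)%:E)%E); last first.
  exact: nneseries_lim_ge.
rewrite sumEFin lee_fin big_mkord.
apply: (@le_trans _ _ (\sum_(k < N) C)).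
  rewrite sumr_const card_ord -mulr_natl -ler_pdivrMr //.
  exact: le_trans (ler_norm _) (ltW (archi_boundP (normr_ge0 _))).
apply: ler_sum => k _; rewrite indicE mem_set ?mulr1; last by apply: xE.
by rewrite ler_peMr ?exprn_ege1 // ltW.
Qed.

End Shells.

(** * Measurability, [Lp] and test functions on the cube *)

Section Lebesgue.
Context {R : realType} {n : nat}.
Local Notation V := 'rV[R]_n.+1.
Local Notation X := (caratheodory_type (@leb_outer R n.+1)).

Lemma leb_measurable_fun_of (D : set V) (g : V -> \bar R) : measurable (D : set X) ->
  measurable_fun (D : set X) (g : X -> \bar R) -> leb_measurable_fun D g.
Proof.
move=> mD mg; split; first exact: mD.
move=> t; have : measurable ((D : set X) `&` [set x : X | (t%:E < g x)%E]).
  by apply: measurable_lte => //; exact: measurable_cst.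
by [].
Qed.

Lemma sintE (D : set V) (g : V -> R) : measurable (D : set X) ->
  measurable_fun (D : set X) (EFin \o g : X -> \bar R) ->
  sint D g = (\int[leb]_(x in D) (g x)%:E)%E.
Proof.
move=> mD mg; rewrite /sint [RHS]integralE; congr (_ - _)%E.
  rewrite nnintE //.
  - by apply: eq_integral => x _; rewrite funeposE EFin_max.
  - have := measurable_funepos mg; congr measurable_fun.
    by apply/funext => x; rewrite funeposE EFin_max.
  - by move=> x _; rewrite lee_fin le_max lexx orbT.
rewrite nnintE //.
- by apply: eq_integral => x _; rewrite funenegE EFin_max.
- have := measurable_funeneg mg; congr measurable_fun.
  by apply/funext => x; rewrite funenegE EFin_max.
- by move=> x _; rewrite lee_fin le_max lexx orbT.
Qed.

Lemma measurable_powR_norm (D : set X) (p : R) (g : V -> R) :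
  measurable_fun D (g : X -> R) ->
  measurable_fun D ((fun x => (`|g x| `^ p)%:E) : X -> \bar R).
Proof.
move=> mg; apply/measurable_EFinP.
apply: (measurableT_comp (measurable_powR p)).
exact: measurableT_comp.
Qed.

Lemma Lp_continuous_cube (p : R) (g : V -> R) : 0 <= p -> continuous g ->
  Lp (cube R n.+1) p g.
Proof.
move=> p0 cg; have mg : measurable_fun (cube R n.+1 : set X) (g : X -> R).
  exact: measurable_funTS (continuous_measurable cg).
split; first by apply: leb_measurable_fun_of measurable_cube _; exact/measurable_EFinP.
rewrite nnintE; [|exact: measurable_cube|exact: measurable_powR_norm|]; last first.
  by move=> x _; rewrite lee_fin powR_ge0.
have [C CP] := continuous_bounded_abox 1 cg.
apply: (@le_lt_trans _ _ (\int[leb]_(x in (cube R n.+1 : set X)) (cst (C `^ p)%:E) x)%E).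
  apply: ge0_le_integral => [||||x xc].
  - exact: measurable_cube.
  - by move=> x _; rewrite lee_fin powR_ge0.
  - exact: measurable_powR_norm.
  - exact: measurable_cst.
  - rewrite lee_fin ge0_ler_powR ?nnegrE //.
      exact: le_trans (normr_ge0 _) (CP x (cube_sub_abox xc)).
    exact: CP (cube_sub_abox xc).
rewrite integral_cst; last exact: measurable_cube.
rewrite lte_mul_pinfty ?lee_fin ?powR_ge0 //.
exact: leb_cube_lty.
Qed.

Lemma test_fun_facts (phi : V -> R) : test_fun (cube R n.+1) phi ->
  exists K : set V, [/\ closed K, K `<=` cube R n.+1, continuous phi,
    (forall x, ~ K x -> phi x = 0) &
    (forall k, continuous (pd k phi) /\ forall x, is_derive x (ebasis k) phi (pd k phi x))].
Proof.
move=> [sphi [K [cK [Kc phi0]]]]; exists K; split => //.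
- by apply: compact_closed cK; exact: norm_hausdorff.
- by have [] := sphi [::].
- move=> k; split; first by have [] := sphi [:: k].
  by move=> x; apply: DeriveDef => //; have [_] := sphi [::]; exact.
Qed.

Lemma test_fun_pd (phi : V -> R) (k : 'I_n.+1) : test_fun (cube R n.+1) phi ->
  test_fun (cube R n.+1) (pd k phi).
Proof.
move=> tphi; have [K [cK Kc _ phi0 phiD]] := test_fun_facts tphi.
case: tphi => sphi [K' [cK' [Kc' phi0']]]; split.
  by move=> s; have := sphi (rcons s k); rewrite /iterd foldr_rcons.
exists K'; split => //; split => // x Kx.
have cl : closed K' by apply: compact_closed cK'; exact: norm_hausdorff.
by have [_ D] := phiD k; exact: (@deriv_zero_off_closed R V phi K' x _ _ cl phi0' Kx (D x)).
Qed.

Lemma weak_deriv1_cube (k : 'I_n.+1) (u du : V -> R) : continuous u -> continuous du ->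
  (forall x, is_derive x (ebasis k) u (du x)) ->
  weak_deriv (cube R n.+1) [:: k] u du.
Proof.
move=> cu cdu uD phi /test_fun_facts [K [cK Kc cphi phi0 phiD]].
have [cdphi phiD'] := phiD k.
have cM (g h : V -> R) : continuous g -> continuous h -> continuous (fun x => g x * h x).
  by move=> cg ch x; exact: (@continuousM R V g h x (cg x) (ch x)).
have mC : measurable (cube R n.+1 : set X) by exact: measurable_cube.
rewrite !sintE //; try by apply: measurable_EFin_continuous; apply: cM.
rewrite (integral_by_parts cu cdu cphi cdphi uD phiD' cK Kc phi0).
by rewrite expr1 EFinN mulN1e.
Qed.

End Lebesgue.

(** * Weak second derivatives of the perturbation *)

Section WeakSecond.
Context {R : realType} {n : nat}.
Local Notation V := 'rV[R]_n.+1.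
Local Notation X := (caratheodory_type (@leb_outer R n.+1)).
Variables lam kap : R.
Hypotheses (lam0 : 0 < lam) (lam2 : lam < 2^-1) (kap0 : 0 < kap) (kap1 : kap < 1).
Hypotheses (lamkap : lam < kap) (ratio : kap / lam * shell_ratio (n := n) lam < 1).

Let r := kap / lam.
Let r1 : 1 < r. Proof. by rewrite /r ltr_pdivlMr // mul1r. Qed.
Let r0 : 0 <= r. Proof. exact: ltW (lt_trans ltr01 r1). Qed.

Let ratio1 : shell_ratio (n := n) lam < 1.
Proof.
have h : 0 <= shell_ratio (n := n) lam by exact: shell_ratio_ge0.
apply: le_lt_trans ratio; rewrite -[leLHS]mul1r ler_wpM2r // ltW //.
Qed.

Let mC : measurable (cube R n.+1 : set X). Proof. exact: measurable_cube. Qed.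

Lemma pert2_measurable j m : measurable_fun [set: X] (pert2 lam kap j m : X -> R).
Proof.
apply: (@measurable_fun_cvg _ X R setT (fun N (x : X) => psum2 lam kap N j m x * \1_(~` cantor_null lam) x)).
  move=> N; apply: measurable_funM.
    exact: continuous_measurable (psum2_continuous lam0 lam2 (kap := kap) (N := N) (j := j) (m := m)).
  apply: measurable_indic; apply: measurableC; exact: measurable_cantor_null.
by move=> x _; exact: cvg_psum2.
Qed.

Lemma measurable_opp_scale_pert2 (D : set X) b j m :
  measurable_fun D ((fun x => - (b * pert2 lam kap j m x)) : X -> R).
Proof.
rewrite (_ : (fun x => _) = (fun x : X => - b * pert2 lam kap j m x)).
  apply: (@measurable_funM _ X R D (cst (- b)) (pert2 lam kap j m)); first exact: measurable_cst.
  by apply/measurable_funTS; exact: pert2_measurable.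
by apply/funext => x; rewrite mulNr.
Qed.

Lemma integrable_shell_weight C : 0 <= C ->
  leb.-integrable (cube R n.+1 : set X) (shell_weight lam C r : X -> \bar R).
Proof.
move=> C0; apply/integrableP; split; first exact: measurable_shell_weight.
under eq_integral do rewrite gee0_abs ?shell_weight_ge0 //.
exact: integral_shell_weight.
Qed.

(** Classical integration by parts does not apply to [pert1], whose second derivatives are
    controlled only off the Cantor set. It applies to each partial sum, and both sides pass to the
    limit by dominated convergence: the left under a constant, the right under [shell_weight] of
    ratio [kap / lam]. The form [a - b * pert1] covers the first partials of every coordinate of the
    map. *)
Lemma weak_second_pert j m (a b : R) (phi dphi : V -> R) (K : set V) :
  continuous phi -> continuous dphi -> (forall x, is_derive x (ebasis m) phi (dphi x)) ->
  closed K -> K `<=` cube R n.+1 -> (forall x, ~ K x -> phi x = 0) ->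
  (\int[leb]_(x in cube R n.+1) ((a - b * pert1 lam kap j x) * dphi x)%:E =
   - \int[leb]_(x in cube R n.+1) (- (b * pert2 lam kap j m x) * phi x)%:E)%E.
Proof.
move=> cphi cdphi phiD cK Kc phi0.
have cM (g h : V -> R) : continuous g -> continuous h -> continuous (fun x => g x * h x).
  by move=> cg ch x; exact: (@continuousM R V g h x (cg x) (ch x)).
have cc (c : R) : continuous (fun _ : V => c) by move=> x; exact: cst_continuous.
pose v N x := a - b * psum1 lam kap N j x.
pose w N x := - (b * psum2 lam kap N j m x).
have cv N : continuous (v N).
  move=> x; apply: (@continuousB R R V (cst a) (fun x => b * psum1 lam kap N j x)).
    exact: cst_continuous.
  exact: (cM _ _ (cc b) (@psum1_continuous R n lam kap lam0 lam2 N j)).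
have cw N : continuous (w N).
  move=> x; apply: (@continuousN R R V (fun x => b * psum2 lam kap N j m x)).
  exact: (cM _ _ (cc b) (@psum2_continuous R n lam kap lam0 lam2 N j m)).
have vD N x : is_derive x (ebasis m) (v N) (w N x).
  have D := psum1_is_derive kap lam0 lam2 N j m x.
  have D2 := is_deriveB (is_derive_cst a x (ebasis m)) (is_deriveZ b D).
  by apply: (is_derive_eq D2); rewrite sub0r.
have parts N := integral_by_parts (cv N) (cw N) cphi cdphi (vD N) phiD cK Kc phi0.
have [C1 C1P] := continuous_bounded_abox 1 cphi.
have [C2 C2P] := continuous_bounded_abox 1 cdphi.
have C10 : 0 <= C1.
  by apply: le_trans (C1P 0 _) => // i; rewrite !mxE; lra.
have [T [T0 TP]] := @psum_psum1_tail R n lam kap lam0 lam2 kap0 kap1.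
(* The tail estimate taken from index 0 is a bound on [psum1] uniform in [N] and [x]. *)
have vbound N x : `|v N x| <= `|a| + `|b| * T.
  rewrite /v (le_trans (ler_normB _ _)) // lerD2l normrM ler_wpM2l //.
  have [_ /(_ j)] := TP 0%N N x (leq0n N).
  by rewrite /(psum1 _ _ 0) big_ord0 subr0 expr0 mulr1.
have [Q [Q0 QP]] := @psum2_bound R n lam kap lam0 lam2 kap0 kap1.
have cp1 : continuous (fun x : V => (a - b * pert1 lam kap j x) * dphi x).
  apply: (cM) => // x.
  apply: (@continuousB R R V (cst a) (fun x => b * pert1 lam kap j x)); first exact: cst_continuous.
  exact: (cM _ _ (cc b) (@pert1_continuous R n lam kap lam0 lam2 kap0 kap1 j)).
have cvgL : (\int[leb]_(x in (cube R n.+1 : set X)) (v N x * dphi x)%:E)%E @[N --> \oo] -->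
    (\int[leb]_(x in cube R n.+1) ((a - b * pert1 lam kap j x) * dphi x)%:E)%E.
  have cvE : {ae leb, forall x : X, cube R n.+1 x ->
      (EFin \o (fun x => v N x * dphi x)) x @[N --> \oo] -->
      (EFin \o (fun x : V => (a - b * pert1 lam kap j x) * dphi x)) x}.
    apply: aeW => x _; apply/fine_cvgP; split; first exact: nearW.
    apply: cvgMl; apply: cvgB; first exact: cvg_cst.
    by apply: cvgMr; exact: cvg_psum1.
  have dom : {ae leb, forall (x : X) N, cube R n.+1 x ->
      (`|(EFin \o (fun x => (v N x * dphi x)%R)) x| <=
       (EFin \o (fun _ : V => ((`|a| + `|b| * T) * C2)%R)) x)%E}.
    apply: aeW => x N xc; rewrite /= lee_fin normrM ler_pM //.
    exact: C2P (cube_sub_abox xc).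
  have [_ _] := @dominated_convergence _ X R leb (cube R n.+1) mC _ _ _
    (fun N => measurable_EFin_continuous (cM _ _ (cv N) cdphi))
    (measurable_EFin_continuous cp1) cvE
    (integrable_continuous_cube (cc ((`|a| + `|b| * T) * C2))) dom.
  exact.
have cvgR : (\int[leb]_(x in (cube R n.+1 : set X)) (w N x * phi x)%:E)%E @[N --> \oo] -->
    (\int[leb]_(x in cube R n.+1) (- (b * pert2 lam kap j m x) * phi x)%:E)%E.
  have mp2 : measurable_fun (cube R n.+1 : set X)
      (EFin \o (fun x : V => - (b * pert2 lam kap j m x) * phi x) : X -> \bar R).
    apply/measurable_EFinP; apply: measurable_funM.
      exact: measurable_opp_scale_pert2.
    exact: measurable_funTS (continuous_measurable cphi).
  have C0 : 0 <= `|b| * Q * C1 by rewrite !mulr_ge0.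
  have cvE : {ae leb, forall x : X, cube R n.+1 x ->
      (EFin \o (fun x => w N x * phi x)) x @[N --> \oo] -->
      (EFin \o (fun x : V => - (b * pert2 lam kap j m x) * phi x)) x}.
    (* Pointwise convergence is claimed off this null set, where the indicator in the definition of
       [pert2] equals 1. *)
    exists (cantor_null lam : set X); split.
    - exact: measurable_cantor_null.
    - exact: leb_cantor_null.
    move=> x /= h; apply: contrapT => xE; apply: h => _.
    apply/fine_cvgP; split; first exact: nearW.
    apply: cvgMl; apply: cvgN; apply: cvgMr.
    have := @cvg_psum2 R n lam kap lam0 lam2 j m x.
    rewrite (_ : (fun N => _) = (fun N => psum2 lam kap N j m x)) //.
    by apply/funext => N; rewrite indicE mem_set // mulr1.
  have dom : {ae leb, forall (x : X) N, cube R n.+1 x ->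
      (`|(EFin \o (fun x => (w N x * phi x)%R)) x| <= shell_weight lam (`|b| * Q * C1) r x)%E}.
    apply: aeW => x N xc.
    apply: (@le_trans _ _ (\sum_(0 <= k < N) (`|b| * Q * C1 * r ^+ k * \1_(shell lam k) x)%:E)%E).
      rewrite sumEFin /= lee_fin big_mkord normrM normrN normrM.
      have := QP N j m x; rewrite -[r]/(kap / lam) => h.
      apply: (@le_trans _ _ (`|b| * (\sum_(k < N) Q * (kap / lam) ^+ k * \1_(shell lam k) x) * C1)).
        by rewrite ler_pM ?mulr_ge0 // ?ler_wpM2l // C1P //; exact: cube_sub_abox.
      rewrite mulr_sumr mulr_suml ler_sum // => k _.
      rewrite le_eqVlt; apply/orP; left; apply/eqP; ring.
    apply: nneseries_lim_ge => k _; rewrite lee_fin !mulr_ge0 ?exprn_ge0 //.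
  have [_ _] := @dominated_convergence _ X R leb (cube R n.+1) mC _ _ _
    (fun N => measurable_EFin_continuous (cM _ _ (cw N) cphi)) mp2 cvE
    (integrable_shell_weight C0) dom.
  exact.
rewrite -(cvg_lim _ cvgL) //.
under eq_fun do rewrite parts.
by apply: cvg_lim => //; exact: cvgeN.
Qed.

End WeakSecond.

Lemma exprn_powR (R : realType) (x p : R) (k : nat) : 0 <= x ->
  (x `^ p) ^+ k = (x ^+ k) `^ p.
Proof.
move=> x0; rewrite -(powR_mulrn k (powR_ge0 x p)) -(powR_mulrn k x0).
by rewrite -!powRrM [p * _]mulrC.
Qed.

Section ShellIntegrable.
Context {R : realType} {n : nat}.
Local Notation V := 'rV[R]_n.+1.
Local Notation X := (caratheodory_type (@leb_outer R n.+1)).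
Variables lam : R.
Hypotheses (lam0 : 0 < lam) (lam2 : lam < 2^-1).

Lemma nnint_shell_lty (C s : R) (g : V -> \bar R) : 0 < C -> 1 <= s ->
  s * shell_ratio (n := n) lam < 1 ->
  measurable_fun (cube R n.+1 : set X) (g : X -> \bar R) ->
  (forall x, (0 <= g x)%E) ->
  (forall m x, shell lam m x -> ~ shell lam m.+1 x -> (g x <= (C * s ^+ m)%:E)%E) ->
  (nnint (cube R n.+1) g < +oo)%E.
Proof.
move=> C0 s1 sr mg g0 gle; have s0 : 0 <= s by exact: le_trans s1.
rewrite nnintE; [|exact: measurable_cube|exact: mg|by move=> x _].
have I := @integral_shell_weight R n lam lam0 C s (ltW C0) s0 sr.
apply: (le_lt_trans _ I).
apply: ge0_le_integral => [||||x xc].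
- exact: measurable_cube.
- by move=> x _.
- exact: mg.
- by apply: measurable_shell_weight => //; exact: ltW.
- by apply: le_shell_weight => // m; exact: gle.
Qed.

Variables kap q : R.
Hypotheses (kap0 : 0 < kap) (kap1 : kap < 1) (lamkap : lam < kap).

(** As [kap / lam > 1], the geometric sum is comparable to its last term, with factor [r / (r - 1)].
    The index [N.+1] is the number of terms alive at a point of shell [N] outside the next one;
    [Q + 1] keeps the constant positive. *)
Lemma psum2_shell : exists C : R, 0 < C /\ forall j m N (x : V),
  shell lam N x -> `|psum2 lam kap N.+1 j m x| <= C * (kap / lam) ^+ N.
Proof.
have [Q [Q0 QP]] := @psum2_bound R n lam kap lam0 lam2 kap0 kap1.
have r1 : 1 < kap / lam by rewrite ltr_pdivlMr // mul1r.
set r := kap / lam in QP r1 *.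
have r0 : 0 < r by exact: lt_trans r1.
have r10 : 0 < r - 1 by rewrite subr_gt0.
exists ((Q + 1) * (r / (r - 1))); split.
  by rewrite mulr_gt0 ?divr_gt0 // ltr_wpDl.
move=> j m N x xN; apply: le_trans (QP _ j m x) _.
apply: (@le_trans _ _ (\sum_(k < N.+1) (Q + 1) * r ^+ k)).
  apply: ler_sum => k _; rewrite -[leRHS]mulr1; apply: ler_pM.
  - by rewrite mulr_ge0 // exprn_ge0 // ltW.
  - by rewrite indicE; case: (_ \in _).
  - by rewrite ler_wpM2r ?exprn_ge0 ?(ltW r0) // lerDl.
  - by rewrite indicE; case: (_ \in _).
rewrite -mulr_sumr -[leRHS]mulrA ler_wpM2l ?addr_ge0 //.
have -> : \sum_(k < N.+1) r ^+ k = (r ^+ N.+1 - 1) / (r - 1).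
  by rewrite subrX1 mulrAC mulfV ?mul1r // gt_eqF.
have -> : r / (r - 1) * r ^+ N = r ^+ N.+1 / (r - 1) by rewrite exprS mulrAC.
by rewrite ler_wpM2r ?invr_ge0 ?(ltW r10) // gerBl.
Qed.

Hypothesis (q0 : 0 < q) (qr : (kap / lam) `^ q * shell_ratio (n := n) lam < 1).

Lemma Lp_pert2 (b : R) (j m : 'I_n.+1) :
  Lp (cube R n.+1) q (fun x => - (b * pert2 lam kap j m x)).
Proof.
have r1 : 1 <= kap / lam by rewrite ler_pdivlMr // mul1r ltW.
have mw : measurable_fun (cube R n.+1 : set X) ((fun x => - (b * pert2 lam kap j m x)) : X -> R).
  exact: (@measurable_opp_scale_pert2 R n lam kap lam0 lam2).
split; first by apply: leb_measurable_fun_of; [exact: measurable_cube|exact/measurable_EFinP].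
have [C [C0 CP]] := psum2_shell.
(* [|b| + 1] keeps the constant positive when [b = 0], the case of the coordinates other than 0. *)
apply: (@nnint_shell_lty (((`|b| + 1) * C) `^ q) ((kap / lam) `^ q)) => //.
- by rewrite powR_gt0 // mulr_gt0 // ltr_wpDl.
- by rewrite -[leLHS](powRr0 (kap / lam)) ler_powR // ltW.
- exact: measurable_powR_norm.
move=> N x xN xN1; rewrite lee_fin.
have rr : 0 <= kap / lam by exact: le_trans r1.
have -> : ((`|b| + 1) * C) `^ q * (kap / lam) `^ q ^+ N = ((`|b| + 1) * C * (kap / lam) ^+ N) `^ q.
  rewrite [RHS]powRM ?mulr_ge0 ?addr_ge0 ?exprn_ge0 ?(ltW C0) //; congr (_ * _).
  exact: exprn_powR.
rewrite ge0_ler_powR ?nnegrE ?mulr_ge0 ?addr_ge0 ?exprn_ge0 ?(ltW q0) ?(ltW C0) //.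
rewrite normrN normrM -mulrA ler_pM ?lerDl //.
by rewrite (pert2E _ _ _ _ _ xN1) // CP.
Qed.

End ShellIntegrable.

(** * Choice of the two scales *)

Section ScaleChoice.
Context {R : realType}.

Let ltr_two_powR (x y : R) : x < y -> 2 `^ x < 2 `^ y.
Proof. by move=> xy; rewrite /powR pnatr_eq0 /= ltr_expR ltr_pM2r // ln_gt0 // ltr1n. Qed.

Let two_powR_lt1 (x : R) : x < 0 -> 2 `^ x < 1.
Proof. by move/ltr_two_powR; rewrite powRr0. Qed.

(** The exponent is the midpoint of the open interval from [b1] to [b2]. That [b1 < b2] amounts to
    four comparisons, and the only one that is not automatic is the hypothesis relating [a], [q] and
    [d], which enters the proof here. *)
Lemma exponent_exists (N q a d : R) : 1 <= q -> 0 < a -> d < N -> (1 - (N - d) / q) * a < N - d ->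
  exists b, [/\ 0 < b, b < 1, (1 - b) * q < N - d & a * b < N - d].
Proof.
move=> q1 a0 dN cond; have q0 : 0 < q by exact: lt_le_trans q1.
have e0 : 0 < N - d by rewrite subr_gt0.
pose b1 := Num.max 0 (1 - (N - d) / q); pose b2 := Num.min 1 ((N - d) / a).
have b12 : b1 < b2.
  rewrite /b1 /b2 gt_max !lt_min ltr01 divr_gt0 //= ltr_pdivlMr // cond andbT.
  by rewrite ltrBlDr ltrDl divr_gt0.
exists ((b1 + b2) / 2).
have [h1 h2] := midf_lt b12.
have b1_0 : 0 <= b1 by rewrite /b1 le_max lexx.
have b1_q : 1 - (N - d) / q <= b1 by rewrite /b1 le_max lexx orbT.
have b2_1 : b2 <= 1 by rewrite /b2 ge_min lexx.
have b2_a : b2 <= (N - d) / a by rewrite /b2 ge_min lexx orbT.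
split; first exact: le_lt_trans h1.
- exact: lt_le_trans b2_1.
- rewrite -ltr_pdivlMr // ltrBlDl -ltrBlDr; exact: le_lt_trans h1.
- rewrite mulrC -ltr_pdivlMr //; exact: lt_le_trans b2_a.
Qed.

(** All quantities are powers of 2: with [u = N / d], [lam = 2 ^ (- u)] and [kap = lam ^ b], the two
    ratios are 2 to the powers [u (a b - (N - d))] and [u ((1 - b) q - (N - d))], both negative. *)
Lemma parameters_exist (n : nat) (q a d : R) : 1 <= q -> 0 < a -> 0 < d -> d < n.+1%:R ->
  (1 - (n.+1%:R - d) / q) * a < n.+1%:R - d ->
  exists lam kap : R, [/\ (0 < lam) && (lam < 2^-1), (lam < kap) && (kap < 1),
    lam `^ d = 2^-1 ^+ n.+1, kap `^ (- a) * (2 * lam) ^+ n.+1 < 1 &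
    (kap / lam) `^ q * (2 * lam) ^+ n.+1 < 1].
Proof.
move=> q1 a0 d0 dN cond; have [b [b0 b1 bq ba]] := exponent_exists q1 a0 dN cond.
set N : R := n.+1%:R in dN cond bq ba.
have N0 : 0 < N by rewrite ltr0n.
pose u := N / d.
have u1 : 1 < u by rewrite ltr_pdivlMr // mul1r.
have u0 : 0 < u by exact: lt_trans u1.
have ud : u * d = N by rewrite mulfVK // gt_eqF.
have nz : (2 : R) != 0 by rewrite pnatr_eq0.
have lamE : 2 * 2 `^ (- u) = 2 `^ (1 - u) :> R.
  by rewrite powRD ?nz ?implybT // powRr1.
have ratE : (2 * 2 `^ (- u)) ^+ n.+1 = 2 `^ ((1 - u) * N) :> R.
  by rewrite lamE powRrM powR_mulrn ?powR_ge0.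
exists (2 `^ (- u)), (2 `^ (- (u * b))); split.
- by rewrite powR_gt0 //= -[X in _ < X^-1](@powRr1 R 2 (ler0n R 2)) -powRN ltr_two_powR // ltrN2 u1.
- rewrite ltr_two_powR ?ltrN2 ?gtr_pMr //=.
  by rewrite two_powR_lt1 // oppr_lt0 mulr_gt0.
- by rewrite -powRrM mulNr ud powRN exprVn /N powR_mulrn.
- rewrite ratE -powRrM -powRD ?nz ?implybT // two_powR_lt1 //.
  have -> : - (u * b) * - a + (1 - u) * N = u * (a * b - (N - d)) by rewrite -ud; ring.
  by rewrite pmulr_rlt0 // subr_lt0.
rewrite ratE -powRN opprK -powRD ?nz ?implybT // -powRrM -powRD ?nz ?implybT // two_powR_lt1 //.
have -> : (- (u * b) + u) * q + (1 - u) * N = u * ((1 - b) * q - (N - d)) by rewrite -ud; ring.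
by rewrite pmulr_rlt0 // subr_lt0.
Qed.

End ScaleChoice.

(** * The map and its Jacobian *)

Section Jacobian.
Context {R : realType} {n : nat}.
Local Notation V := 'rV[R]_n.+1.
Local Notation X := (caratheodory_type (@leb_outer R n.+1)).
Variables lam kap : R.
Hypotheses (lam0 : 0 < lam) (lam2 : lam < 2^-1) (kap0 : 0 < kap) (kap1 : kap < 1).

Definition pinch (x : V) : V := x - pert lam kap x *: ebasis ord0.

Let pertD (x : V) := (pert_differentiable lam0 lam2 kap0 kap1 x).1.
Let pertDE (x : V) := (pert_differentiable lam0 lam2 kap0 kap1 x).2.

Let shiftD (x : V) : differentiable (fun z : V => pert lam kap z *: (ebasis ord0 : V)) x.
Proof. exact: differentiableZl (pertD x). Qed.

Lemma pinch_differentiable (x : V) : differentiable pinch x.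
Proof.
exact: (@differentiableB R V V (fun z => z) (fun z => pert lam kap z *: ebasis ord0) x _ (shiftD x)).
Qed.

Lemma pinch_derive (x : V) j :
  'D_(ebasis j) pinch x = ebasis j - pert1 lam kap j x *: ebasis ord0.
Proof.
have shiftE : 'D_(ebasis j) (fun z : V => pert lam kap z *: (ebasis ord0 : V)) x =
    pert1 lam kap j x *: ebasis ord0.
  rewrite deriveE; last exact: shiftD.
  by rewrite (@diffZl R V V (pert lam kap) (ebasis ord0) x (pertD x)) /= -pertDE deriveE.
have := @deriveB R V V (fun z => z) (fun z => pert lam kap z *: ebasis ord0) x (ebasis j)
  (@derivable_id R V x (ebasis j)) (diff_derivable (shiftD x)).
rewrite shiftE (@derive_id R V x (ebasis j)) => <-; exact: erefl.
Qed.

Lemma pinch_C1 (O : set V) : C1_on O pinch.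
Proof.
move=> x _; split; first exact: pinch_differentiable.
move=> j; rewrite (_ : (fun y => _) = (fun y => ebasis j - pert1 lam kap j y *: ebasis ord0)); last first.
  by apply/funext => y; rewrite pinch_derive.
have cj := @pert1_continuous R n lam kap lam0 lam2 kap0 kap1 j x.
apply: (@continuousB R V V (fun=> ebasis j) (fun y => pert1 lam kap j y *: ebasis ord0) x).
  exact: cst_continuous.
exact: (cvgZ cj (cvg_cst _)).
Qed.

(** Rows of the Jacobian matrix index the directions of differentiation, so only column 0 differs
    from the identity: the matrix is lower triangular, with all diagonal entries but the first equal
    to 1. *)
Lemma jacdet_pinch (x : V) : jacdet pinch x = 1 - pert1 lam kap ord0 x.
Proof.
have JE i j : 'J pinch x i j = (i == j)%:R - pert1 lam kap i x * (j == ord0)%:R.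
  have <- : row i ('J pinch x) ord0 j = 'J pinch x i j by rewrite mxE.
  rewrite rowE -[delta_mx _ _]/(ebasis i) -(deriveEjacobian _ (pinch_differentiable x)).
  by rewrite pinch_derive !mxE eqxx /= (eq_sym j i).
rewrite /jacdet det_trig; last first.
  apply/is_trig_mxP => i j ij; rewrite JE.
  have -> : (j == ord0) = false by apply/negbTE; rewrite -val_eqE /= -lt0n (leq_ltn_trans _ ij).
  by rewrite mulr0 subr0 -val_eqE /= (ltn_eqF ij).
rewrite big_ord_recl big1 ?mulr1; last first.
  by move=> i _; rewrite JE eqxx /= mulr0 subr0.
by rewrite JE eqxx mulr1.
Qed.

End Jacobian.

Section JacobianEstimates.
Context {R : realType} {n : nat}.
Local Notation V := 'rV[R]_n.+1.
Local Notation X := (caratheodory_type (@leb_outer R n.+1)).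
Variables lam kap : R.
Hypotheses (lam0 : 0 < lam) (lam2 : lam < 2^-1) (kap0 : 0 < kap) (kap1 : kap < 1).

Let J (x : V) : R := 1 - pert1 lam kap ord0 x.

Let jacE (x : V) : jacdet (pinch lam kap) x = J x.
Proof. by rewrite jacdet_pinch. Qed.

Lemma jacobian_ge m (x : V) : ~ shell lam m x -> kap ^+ m <= 1 - pert1 lam kap ord0 x.
Proof.
move=> h; have hh : pert1 lam kap ord0 x <= 1 - kap ^+ m by exact: pert1_le.
by rewrite lerBrDr addrC -lerBrDr.
Qed.

Lemma jac_negpow_L1 (a : R) : 0 < a -> kap `^ (- a) * shell_ratio (n := n) lam < 1 ->
  L1_nonneg (cube R n.+1) (jac_negpow (pinch lam kap) a).
Proof.
move=> a0 ra.
have mJ : measurable_fun [set: X] (J : X -> R).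
  apply: continuous_measurable => x.
  have c := @pert1_continuous R n lam kap lam0 lam2 kap0 kap1 ord0 x.
  apply: (@continuousB R R V (cst 1) (pert1 lam kap ord0) x); first exact: cst_continuous.
  exact: c.
pose g (x : V) : \bar R := if J x == 0 then +oo%E else (`|J x| `^ (- a))%:E.
have -> : jac_negpow (pinch lam kap) a = g.
  by apply/funext => x; rewrite /jac_negpow jacE.
have mg : measurable_fun (cube R n.+1 : set X) (g : X -> \bar R).
  apply: measurable_funTS.
  apply: measurable_fun_ifT.
  - by apply: measurable_fun_eqr => //; exact: measurable_cst.
  - exact: measurable_cst.
  - exact: measurable_powR_norm.
split; first by apply: leb_measurable_fun_of; [exact: measurable_cube|exact: mg].
have s1 : 1 <= kap `^ (- a).
  by rewrite -[leLHS](powRr0 kap) ger_powR ?kap0 ?ltW // oppr_lt0.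
(* A point of shell [m] is only known to be outside shell [m + 1], so the Jacobian is at least
   [kap ^ (m + 1)]; the constant [kap ^ (- a)] pays for the extra factor. *)
apply: (@nnint_shell_lty R n lam lam0 (kap `^ (- a)) (kap `^ (- a))) => //.
- exact: powR_gt0.
- by move=> x; rewrite /g; case: ifP => // _; rewrite lee_fin powR_ge0.
move=> m x _ xm; have k0 : 0 < kap ^+ m.+1 by rewrite exprn_gt0.
have Jx := jacobian_ge xm; have J0 : 0 < J x by exact: lt_le_trans Jx.
rewrite /g gt_eqF // lee_fin -exprS gtr0_norm // -powR_mulrn ?powR_ge0 // -powRrM.
rewrite mulrC powRrM powR_mulrn ?(ltW kap0) //.
rewrite !powRN lef_pV2 ?posrE ?powR_gt0 // ge0_ler_powR ?nnegrE ?(ltW a0) ?(ltW k0) ?(ltW J0) //.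
Qed.

Variable d : R.
Hypotheses (d0 : 0 < d) (lamd : lam `^ d = 2^-1 ^+ n.+1).

Lemma hausdorff_critical_gt0 : (0 < hausdorff_measure d
  [set x : V | cube R n.+1 x /\ jacdet (pinch lam kap) x = 0%R])%E.
Proof.
apply: (@hausdorff_measure_gt0 R n d (holder_const lam d) (cantor_param lam)) => //.
- by rewrite mulr_gt0 ?powR_gt0 ?gap0.
- move=> y _; have h k i := orbit_cantor_param (n := n) lam0 lam2 y k i; split.
    move=> i; have := h 0%N i; rewrite /orbit_coord /= -ltr_norml => /le_lt_trans; apply.
    exact: plateau1.
  by rewrite jacE /J pert1_eq1 ?subrr.
- by move=> y y' y1 y1'; exact: cantor_param_holder.
Qed.

End JacobianEstimates.

(** * Sobolev regularity of the map *)

Section PinchSobolev.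
Context {R : realType} {n : nat}.
Local Notation V := 'rV[R]_n.+1.
Local Notation X := (caratheodory_type (@leb_outer R n.+1)).
Variables lam kap q : R.
Hypotheses (lam0 : 0 < lam) (lam2 : lam < 2^-1) (kap0 : 0 < kap) (kap1 : kap < 1).
Hypotheses (lamkap : lam < kap) (q1 : 1 <= q).
Hypothesis (qr : (kap / lam) `^ q * shell_ratio (n := n) lam < 1).

Lemma pinchE (x : V) i : pinch lam kap x 0 i = x 0 i - (i == ord0)%:R * pert lam kap x.
Proof. by rewrite !mxE eqxx /= mulrC. Qed.

Lemma pinch_coord_is_derive (x : V) i j :
  is_derive x (ebasis j) (fun x : V => pinch lam kap x 0 i)
    ((i == j)%:R - (i == ord0)%:R * pert1 lam kap j x).
Proof.
have D := diff_derivable (v := ebasis j) (pinch_differentiable lam0 lam2 kap0 kap1 x).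
apply: DeriveDef; first by move/derivable_mxP: D; exact.
have := pinch_derive lam0 lam2 kap0 kap1 x j; rewrite derive_mx // => /rowP /(_ i).
by rewrite !mxE eqxx /= => ->; rewrite mulrC.
Qed.

(** Since [kap / lam > 1] and [q >= 1], summability of the [q]-th powers contains the case of
    exponent 1, which dominated convergence uses. *)
Let ratio : kap / lam * shell_ratio (n := n) lam < 1.
Proof.
apply: le_lt_trans qr; rewrite ler_wpM2r ?shell_ratio_ge0 ?(ltW lam0) //.
have r1 : 1 <= kap / lam by rewrite ler_pdivlMr // mul1r ltW.
by rewrite -[leLHS]powRr1 ?ler_powR // (le_trans _ r1).
Qed.

Lemma pinch_sobolev2 : (forall x, cube R n.+1 x -> cube R n.+1 (pinch lam kap x)) ->
  sobolev2 (cube R n.+1) (cube R n.+1) q (pinch lam kap).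
Proof.
move=> fO; split => // i /=.
have q0 : 0 < q by exact: lt_le_trans q1.
set u := fun x => pinch lam kap x 0 i.
set b : R := (i == ord0)%:R.
pose du j (x : V) := (i == j)%:R - b * pert1 lam kap j x.
have uD j x : is_derive x (ebasis j) u (du j x) by exact: pinch_coord_is_derive.
have cM (g h : V -> R) : continuous g -> continuous h -> continuous (fun x => g x * h x).
  by move=> cg ch x; exact: (@continuousM R V g h x (cg x) (ch x)).
have cu : continuous u.
  move=> x; have /differentiable_continuous c := pinch_differentiable lam0 lam2 kap0 kap1 x.
  by apply: (@continuous_comp _ _ _ (pinch lam kap) (fun y : V => y 0 i) x c); exact: coord_continuous.
have cdu j : continuous (du j).
  move=> x; apply: (@continuousB R R V (cst (i == j)%:R) (fun x => b * pert1 lam kap j x)).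
    exact: cst_continuous.
  apply: (@cM (cst b)) => [y|]; first exact: cst_continuous.
  by move=> y; exact: (@pert1_continuous R n lam kap lam0 lam2 kap0 kap1 j y).
have mC : measurable (cube R n.+1 : set X) by exact: measurable_cube.
split; first exact: Lp_continuous_cube (ltW q0) cu.
case=> [|j [|k [|? ?]]] // _.
  exists (du j); split; first exact: Lp_continuous_cube (ltW q0) (cdu j).
  exact: weak_deriv1_cube.
exists (fun x => - (b * pert2 lam kap j k x)); split; first exact: Lp_pert2.
move=> phi tphi.
(* The first derivative is moved by testing against [pd k phi], again a test function;
   [weak_second_pert] then moves the second one. *)
rewrite /= -/(iterd [:: j] (pd k phi)).
rewrite (weak_deriv1_cube cu (cdu j) (uD j) (test_fun_pd k tphi)) /=.
have [K [cK Kc cphi phi0 phiD]] := test_fun_facts tphi; have [cdphi phiD'] := phiD k.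
have mw : measurable_fun (cube R n.+1 : set X)
    (EFin \o (fun x => - (b * pert2 lam kap j k x) * phi x) : X -> \bar R).
  apply/measurable_EFinP; apply: measurable_funM.
    exact: (@measurable_opp_scale_pert2 R n lam kap lam0 lam2).
  exact: measurable_funTS (continuous_measurable cphi).
rewrite !sintE //; last by apply: measurable_EFin_continuous; exact: cM.
rewrite (@weak_second_pert R n lam kap lam0 lam2 kap0 kap1 lamkap ratio j k _ b _ _ _
  cphi cdphi phiD' cK Kc phi0).
by rewrite ?expr1 ?sqrrN ?expr1n ?mul1e ?EFinN ?mulN1e oppeK.
Qed.

End PinchSobolev.

(** * The homeomorphism property *)

Section Escape.
Context {R : realType}.
Variable lam : R.
Hypotheses (lam0 : 0 < lam) (lam2 : lam < 2^-1).

(* [cexpand lam] stretches intervals avoiding 0 by the factor [1 / lam > 2]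
   and sends 0 outside of [(-1, 1)]. *)
Lemma orbit_escape_long k (t1 t2 : R) : 2 * lam ^+ k < t2 - t1 ->
  exists2 t, t1 < t < t2 & exists j, 1 <= `|orbit_coord lam j t|.
Proof.
elim: k t1 t2 => [|k IH] t1 t2; rewrite ?expr0 ?mulr1 => ht.
  (* An interval longer than 2 contains a point outside [(-1, 1)], already at time 0. *)
  have [h|h] := ltP t1 (-1).
    have [h'|h'] := ltP t2 (-1).
      exists ((t1 + t2) / 2); first by apply/andP; split; lra.
      by exists 0%N; rewrite /orbit_coord /= ler_normr; apply/orP; right; lra.
    exists ((t1 - 1) / 2); first by apply/andP; split; lra.
    by exists 0%N; rewrite /orbit_coord /= ler_normr; apply/orP; right; lra.
  exists ((Num.max t1 1 + t2) / 2).
    by case: (leP t1 1) => h1; apply/andP; split; lra.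
  by exists 0%N; rewrite /orbit_coord /= ler_normr; apply/orP; left; case: (leP t1 1) => h1; lra.
(* On an interval of constant sign the map is one affine branch; the induction hypothesis is applied
   to the image, and the escaping point is pulled back at the cost of one more iterate. *)
have step (s : R) : (forall t, t1 < t < t2 -> sgp t = s) ->
    exists2 t, t1 < t < t2 & exists j, 1 <= `|orbit_coord lam j t|.
  move=> sE; have [|t /andP[ta tb] [j tj]] := IH (lam^-1 * (t1 - s / 2)) (lam^-1 * (t2 - s / 2)).
    have -> : lam^-1 * (t2 - s / 2) - lam^-1 * (t1 - s / 2) = lam^-1 * (t2 - t1) by ring.
    rewrite -ltr_pdivrMl ?invr_gt0 // invrK.
    by have -> : lam * (2 * lam ^+ k) = 2 * lam ^+ k.+1 by rewrite exprS; ring.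
  have tI : t1 < lam * t + s / 2 < t2.
    apply/andP; split.
      by rewrite -ltrBlDr -ltr_pdivrMl.
    by rewrite -ltrBrDr -ltr_pdivlMl.
  exists (lam * t + s / 2) => //; exists j.+1.
  rewrite /orbit_coord iterSr /cexpand (sE _ tI) addrK mulKf ?gt_eqF //.
have [t10|t10] := leP 0 t1.
  by apply: (step 1) => t /andP[t1t _]; rewrite /sgp (le_trans t10 (ltW t1t)).
have [t20|t20] := ltP 0 t2.
  exists 0; first by rewrite t10.
  by exists 1%N; apply: (expand_mid lam0 lam2); rewrite normr0 subr_ge0 ltW.
by apply: (step (-1)) => t /andP[_ tt2]; rewrite /sgp leNgt (lt_le_trans tt2 t20).
Qed.

Lemma orbit_escape (t1 t2 : R) : t1 < t2 ->
  exists2 t, t1 < t < t2 & exists j, 1 <= `|orbit_coord lam j t|.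
Proof.
move=> t12; have e0 : 0 < (t2 - t1) / 2 by rewrite divr_gt0 // subr_gt0.
have /cvg_expr/cvgrPdist_lt/(_ _ e0)[k _ /(_ k (leqnn k))] : `|lam| < 1.
  by rewrite gtr0_norm // (lt_trans lam2) // invf_lt1 // ltr1n.
rewrite sub0r normrN normrX gtr0_norm // => hk.
by apply: (@orbit_escape_long k); rewrite mulrC -ltr_pdivlMr.
Qed.

End Escape.

(** The strict signs of [phi y] at [tau y - e] and [tau y + e] persist for nearby parameters, and
    monotonicity traps the root between them. No derivative has to be nonzero, unlike in the
    implicit function theorem. *)
Lemma continuous_implicit_root (R : realType) (T : topologicalType)
    (phi : T -> R -> R) (tau : T -> R) :
  (forall z, {mono phi z : s t / s < t}) -> (forall t, continuous (phi^~ t)) ->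
  (forall z, phi z (tau z) = 0) -> continuous tau.
Proof.
move=> inc c root y; apply/cvgrPdist_lt => e e0.
have lo : phi y (tau y - e) < 0 by rewrite -(root y) inc gtrBl.
have hi : 0 < phi y (tau y + e) by rewrite -(root y) inc ltrDl.
near=> z; rewrite ltr_distlC; apply/andP; split.
  rewrite -(inc z) root; near: z; exact: (c _ y _ (lt_nbhsl lo)).
rewrite -(inc z) root; near: z; exact: (c _ y _ (lt_nbhsr hi)).
Unshelve. all: by end_near. Qed.

Section Homeomorphism.
Context {R : realType} {n : nat}.
Local Notation V := 'rV[R]_n.+1.
Variables lam kap : R.
Hypotheses (lam0 : 0 < lam) (lam2 : lam < 2^-1) (kap0 : 0 < kap) (kap1 : kap < 1).

Local Notation F := (pinch lam kap : V -> V).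

(** Parametrises the line through [x] parallel to [e_0] by its coordinate 0. The map preserves each
    such line and acts on it as [fibre x]. *)
Definition slide (x : V) (t : R) : V := (x - x 0 ord0 *: ebasis ord0) + t *: ebasis ord0.

Lemma slideE x t i : slide x t 0 i = if i == ord0 then t else x 0 i.
Proof.
rewrite !mxE eqxx /=; case: eqP => [->|_]; last by rewrite !mulr0 subr0 addr0.
by rewrite !mulr1 subrr add0r.
Qed.

Lemma slide_id x : slide x (x 0 ord0) = x.
Proof. by apply/rowP => i; rewrite slideE; case: eqP => // ->. Qed.

Lemma slide_slide x s t : slide (slide x s) t = slide x t.
Proof. by apply/rowP => i; rewrite !slideE; case: eqP. Qed.

Definition fibre (x : V) (t : R) : R := F (slide x t) 0 ord0.

Lemma pinch_slide x t : F (slide x t) = slide x (fibre x t).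
Proof.
apply/rowP => i; rewrite slideE pinchE; case: eqP => [->|ne]; last first.
  by rewrite mul0r subr0 slideE; case: eqP.
by rewrite /fibre pinchE.
Qed.

Lemma fibre_slide x s t : fibre (slide x s) t = fibre x t.
Proof. by rewrite /fibre slide_slide. Qed.

Lemma fibre_off x t : 1 <= `|t| -> fibre x t = t.
Proof.
move=> t1; rewrite /fibre pinchE pert_off ?mulr0 ?subr0 ?slideE ?eqxx // => /(_ ord0).
by rewrite slideE eqxx -ltr_norml ltNge t1.
Qed.

Lemma fibre_is_derive x t :
  is_derive t (1 : R) (fibre x) (1 - pert1 lam kap ord0 (slide x t)).
Proof.
have := pinch_coord_is_derive lam0 lam2 kap0 kap1 (slide x t) ord0 ord0.
rewrite eqxx mul1r; exact: is_derive_line.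
Qed.

Lemma fibre_continuous x : continuous (fibre x).
Proof. exact: is_derive_continuous (fibre_is_derive x). Qed.

(** The derivative is nonnegative but may vanish on the Cantor set, so only weak monotonicity is
    immediate. Equal values at [s < t] would make [fibre x] constant between them, contradicting a
    positive derivative at a point [r] there whose orbit escapes. *)
Lemma fibre_lt x : {homo fibre x : s t / s < t}.
Proof.
have d1 t : 'D_1 (fibre x) t = 1 - pert1 lam kap ord0 (slide x t).
  by have := fibre_is_derive x t => D; rewrite derive_val.
have le s t : s <= t -> fibre x s <= fibre x t.
  move=> st; apply: (@ger0_derive1_ndecr R (fibre x) s t) => //.
  - by move=> r _; have := fibre_is_derive x r => D; exact: ex_derive.
  - by move=> r _; rewrite derive1E d1 subr_ge0; exact: pert1_le1.
  - by apply: continuous_subspaceT => r; exact: fibre_continuous.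
move=> s t st; rewrite lt_neqAle le ?(ltW st) // andbT; apply/eqP => E.
have [r /andP[sr rt] [k rk]] := orbit_escape lam0 lam2 st.
have pos : 0 < 'D_1 (fibre x) r.
  have out : ~ shell lam k (slide x r) by move/(_ ord0); rewrite slideE eqxx ltNge rk.
  rewrite d1; apply: lt_le_trans (jacobian_ge lam0 lam2 kap0 kap1 out).
  by rewrite exprn_gt0.
suff z : 'D_1 (fibre x) r = 0 by rewrite z ltxx in pos.
rewrite -(derive_cst (fibre x s) r (1 : R)); apply: near_eq_derive.
near=> u; apply/eqP; rewrite eq_le; apply/andP; split; last first.
  apply: le; apply: ltW; near: u; exact: lt_nbhsr.
rewrite E; apply: le; apply: ltW; near: u; exact: lt_nbhsl.
Unshelve. all: by end_near. Qed.

Lemma fibre_mono x : {mono fibre x : s t / s < t}.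
Proof. exact: leW_mono (le_mono (@fibre_lt x)). Qed.

Lemma fibre_surj x c : exists t, fibre x t = c.
Proof.
pose M := `|c| + 1; have M1 : 1 <= M by rewrite lerDr.
have M0 : 0 <= M by exact: le_trans M1.
have [|||t _ tc] := @IVT R (fibre x) (- M) M c.
- by rewrite ge0_cp.
- by apply: continuous_subspaceT => r; exact: fibre_continuous.
- rewrite !fibre_off ?normrN ?ger0_norm //; apply/andP; split.
    by rewrite ge_min lerNl /M; apply/orP; left; rewrite (le_trans (ler_norm _)) // normrN lerDl.
  by rewrite le_max; apply/orP; right; rewrite (le_trans (ler_norm _)) // lerDl.
- by exists t.
Qed.

Lemma fibre_itv x t : (-1 < fibre x t < 1) = (-1 < t < 1).
Proof.
have lo : fibre x (-1) = -1 by rewrite fibre_off // normrN normr1.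
have hi : fibre x 1 = 1 by rewrite fibre_off // normr1.
by rewrite -(fibre_mono x (-1) t) -(fibre_mono x t 1) lo hi.
Qed.

(** The default 0 is never taken, by [fibre_surj], and strict monotonicity makes the chosen root
    unique. *)
Definition fibre_inv (y : V) : R := xget 0 [set t | fibre y t = y 0 ord0].

Lemma fibre_invK y : fibre y (fibre_inv y) = y 0 ord0.
Proof. by rewrite /fibre_inv; case: xgetP => // h; have [t /h] := fibre_surj y (y 0 ord0). Qed.

Definition pinch_inv (y : V) : V := slide y (fibre_inv y).

Lemma pinch_invK y : F (pinch_inv y) = y.
Proof. by rewrite /pinch_inv pinch_slide fibre_invK slide_id. Qed.

Lemma slide_continuous t : continuous (slide^~ t).
Proof.
move=> x; have c := @coord_continuous R 1 n.+1 0 ord0 x.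
exact: cvgD (cvgB cvg_id (cvgZ c (cvg_cst _))) (cvg_cst _).
Qed.

(** The root depends on [y] both through the line carrying it and through the target [y 0 ord0];
    joint dependence is handled by viewing it as a zero of [fibre z t - z 0 ord0]. *)
Lemma fibre_inv_continuous : continuous fibre_inv.
Proof.
apply: (@continuous_implicit_root R V (fun z t => fibre z t - z 0 ord0)) => [z s t|t z|z].
- by rewrite ltrD2r fibre_mono.
- have c1 := @coord_continuous R 1 n.+1 0 ord0 z.
  have c2 := @coord_continuous R 1 n.+1 0 ord0 (F (slide z t)).
  have cF := differentiable_continuous (pinch_differentiable lam0 lam2 kap0 kap1 (slide z t)).
  have c3 := @continuous_comp _ _ _ (slide^~ t) F z (@slide_continuous t z) cF.
  have c4 := @continuous_comp _ _ _ (F \o slide^~ t) (fun v : V => v 0 ord0) z c3 c2.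
  exact: (@continuousB R R V (fun v => fibre v t) (fun v => v 0 ord0) z c4 c1).
- by rewrite fibre_invK subrr.
Qed.

Lemma pinch_homeo : homeo_on (cube R n.+1) F.
Proof.
have sc x t : cube R n.+1 x -> -1 < t < 1 -> cube R n.+1 (slide x t).
  by move=> xc t1 i; rewrite slideE; case: eqP => _.
split.
  move=> x xc; rewrite -(slide_id x) pinch_slide; apply: sc => //.
  by rewrite fibre_itv.
exists pinch_inv; split.
  by move=> y yc; apply: sc => //; rewrite -(fibre_itv y) fibre_invK.
split.
  move=> x _; rewrite -{1}(slide_id x) pinch_slide /pinch_inv slide_slide.
  rewrite -[RHS]slide_id; congr (slide x _).
  set s := fibre x (x 0 ord0).
  have := fibre_invK (slide x s); rewrite fibre_slide slideE eqxx.
  have inj : injective (fibre x) by exact: inc_inj (le_mono (@fibre_lt x)).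
  exact: inj.
split; first by move=> y _; exact: pinch_invK.
split=> x _; first exact: differentiable_continuous (pinch_differentiable lam0 lam2 kap0 kap1 x).
have c := @coord_continuous R 1 n.+1 0 ord0 x.
have ci := @fibre_inv_continuous x.
exact: cvgD (cvgB cvg_id (cvgZ c (cvg_cst _))) (cvgZ ci (cvg_cst _)).
Qed.

Lemma pinch_cube x : cube R n.+1 x -> cube R n.+1 (F x).
Proof. exact: pinch_homeo.1. Qed.

End Homeomorphism.

Unset Implicit Arguments.

Theorem mainTheorem3 (R : realType) (n : nat) (q a d : R) :
  (2 <= n)%N -> 1 <= q -> 0 < a -> 0 < d -> d < n%:R ->
  (1 - (n%:R - d) / q) * a < n%:R - d ->
  exists f : 'rV[R]_n -> 'rV[R]_n,
    [/\ homeo_on (cube R n) f,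
        C1_on (cube R n) f,
        sobolev2 (cube R n) (cube R n) q f,
        L1_nonneg (cube R n) (jac_negpow f a)
      & (0 < hausdorff_measure d [set x | cube R n x /\ jacdet f x = 0%R])%E].
Proof.
case: n => [//|n] _ q1 a0 d0 dn cond.
have [lam [kap [/andP[lam0 lam2] /andP[lamkap kap1] lamd ra rq]]] :=
  parameters_exist q1 a0 d0 dn cond.
have kap0 : 0 < kap by exact: lt_trans lamkap.
exists (pinch lam kap); split.
- exact: pinch_homeo.
- exact: pinch_C1.
- by apply: pinch_sobolev2 => // x; exact: pinch_cube.
- exact: jac_negpow_L1.
- exact: hausdorff_critical_gt0.
Qed.
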